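(* Let $d\in\{2,3\}$, $0\le\gamma\le1$, and let $$\sigma_1=\begin{cases}1+d/2+\varepsilon,&\gamma\le d/4-1/2,\\ 2+2\gamma,&\gamma>d/4-1/2,\end{cases}$$ where $\varepsilon>0$ can be chosen arbitrarily small. Let $u$ be the solution of $i\partial_tu=-\Delta u+\mu|u|^2u$ on $\mathbb{T}^d$, $u(0)=u_0$, let $T>0$ be smaller than its maximal existence time, and suppose $M_{\sigma_1}<\infty$. Let $u^n$ be computed by the scheme sLRI1: $$u^{n+1}=e^{2i\tau\Delta}u^{n-1}-2i\mu\tau e^{i\tau\Delta}\bigl((u^n)^2\varphi_s(2\tau\Delta)\overline{u^n}\bigr)\ (n\ge1),$$ $$u^1=e^{i\tau\Delta}u_0-i\mu\tau e^{i\tau\Delta}\bigl(u_0^2\,\varphi_1(-2i\tau\Delta)\overline{u_0}\bigr),\qquad u^0=u_0.$$ Then for all $0<\tau\le\tau_0$ with $\tau_0>0$ depending on $M_{\sigma_1}$ and $T$, $$\|u(t_n)-u^n\|_{H^1}\le C(M_{\sigma_1})\,\tau^{1+\gamma},\qquad 0\le n\le T/\tau,\quad t_n=n\tau.$$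
   Context: $\mathbb{T}^d$ is the $2\pi$-periodic torus, $\mu$ a nonzero real constant; $H^\delta=H^\delta(\mathbb{T}^d)$ is the periodic Sobolev space with norm $\|u\|_{H^\delta}^2=\sum_{\mathbf{k}\in\mathbb{Z}^d}(1+|\mathbf{k}|^2)^\delta|\hat u_{\mathbf{k}}|^2$. $M_\delta:=\sup_{0\le t\le T}\|u(t)\|_{H^\delta}$. $\varphi_s(x)=\sin(x)/x$ and $\varphi_1(z)=(e^z-1)/z$ (with value $1$ at $0$). Functions of $\Delta$ are Fourier multipliers: $f(\Delta)$ has symbol $f(-|\mathbf{k}|^2)$. $C(M_\delta)$ denotes a positive constant depending on $M_\delta$ and on the fixed data ($T$, $\mu$, $d$, $\gamma$, $\varepsilon$), but independent of $\tau$ and $n$; likewise $\tau_0$ may depend on the fixed data. *)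

(* Defs.v *)
From HB Require Import structures.
From mathcomp Require Import all_boot all_order all_algebra.
From mathcomp Require Import all_classical all_reals all_analysis.
From mathcomp Require Export complex.

Set Implicit Arguments.
Unset Strict Implicit.
Unset Printing Implicit Defensive.

Import Order.TTheory GRing.Theory Num.Theory.
Import numFieldNormedType.Exports.

Local Open Scope classical_set_scope.
Local Open Scope ring_scope.
Local Open Scope complex_scope.

Local Notation Re := complex.Re.
Local Notation Im := complex.Im.

Section complex_calculus.
Context {R : realType}.
Implicit Types z : R[i].

Definition cexp z : R[i] := (expR (Re z))%:C * (cos (Im z) +i* sin (Im z)).

Definition phi1 z : R[i] := if z == 0 then 1 else (cexp z - 1) / z.

Definition phis (x : R) : R := if x == 0 then 1 else sin x / x.

Definition clim (a : nat -> R[i]) : R[i] :=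
  limn (fun n => Re (a n)) +i* limn (fun n => Im (a n)).

Definition ccontinuous {T : topologicalType} (f : T -> R[i]) : Prop :=
  continuous (fun x => Re (f x)) /\ continuous (fun x => Im (f x)).

Definition ccontinuous_within (A : set R) (f : R -> R[i]) : Prop :=
  {within A, continuous (fun t => Re (f t))} /\
  {within A, continuous (fun t => Im (f t))}.

Definition is_cderive (f : R -> R[i]) (t : R) (z : R[i]) : Prop :=
  is_derive t 1 (fun s => Re (f s)) (Re z) /\
  is_derive t 1 (fun s => Im (f s)) (Im z).

End complex_calculus.

(** Functions on the torus are 2 pi-periodic functions on R^d.  The
    solution and the numerical iterates lie in H^delta for some delta > d/2,
    which embeds into the continuous functions; they are represented by their
    continuous representatives. *)
Section torus.
Context {R : realType}.

Definition periodic d (f : 'rV[R]_d -> R[i]) : Prop :=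
  forall x (i : 'I_d), f (x + (2 * pi) *: delta_mx 0 i) = f x.

Definition torus_fun d (f : 'rV[R]_d -> R[i]) : Prop :=
  periodic f /\ ccontinuous f.

(** Iterated integral over [0, 2 pi]^d, first coordinate outermost. *)
Fixpoint torus_int d : ('rV[R]_d -> R) -> R :=
  match d return ('rV[R]_d -> R) -> R with
  | 0%N => fun f => f 0
  | d'.+1 => fun f =>
      \int[lebesgue_measure]_(t in `[0, 2 * pi])
        torus_int (fun y : 'rV[R]_d' => f (row_mx (const_mx t : 'rV[R]_1) y))
  end.

Definition torus_cint d (f : 'rV[R]_d -> R[i]) : R[i] :=
  torus_int (fun x => Re (f x)) +i* torus_int (fun x => Im (f x)).

Definition freq_dot d (k : 'rV[int]_d) (x : 'rV[R]_d) : R :=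
  \sum_(i < d) (k 0 i)%:~R * x 0 i.

Definition freq_sq d (k : 'rV[int]_d) : R :=
  \sum_(i < d) (k 0 i)%:~R ^+ 2.

Definition fourier d (f : 'rV[R]_d -> R[i]) (k : 'rV[int]_d) : R[i] :=
  ((2 * pi) ^- d)%:C * torus_cint (fun x => f x * cexp ('i * (- freq_dot k x)%:C)).

(** Sum over Z^d as the limit of the sums over the cubes [-N, N]^d.
    For functions in H^delta, delta > d/2, the Fourier series converges
    absolutely, so the choice of cubes is immaterial. *)
Definition freq_sum d (a : 'rV[int]_d -> R[i]) : R[i] :=
  clim (fun N => \sum_(j : {ffun 'I_d -> 'I_(N.*2.+1)})
                   a (\row_i ((j i)%:Z - N%:Z))).

(** [multiplier m f] is [m(Delta) f]: [m] is applied to the symbol -|k|^2 of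
    the Laplacian. *)
Definition multiplier d (m : R -> R[i]) (f : 'rV[R]_d -> R[i])
    (x : 'rV[R]_d) : R[i] :=
  freq_sum (fun k =>
    m (- freq_sq k) * fourier f k * cexp ('i * (freq_dot k x)%:C)).

Definition sobolev_norm d (delta : R) (f : 'rV[R]_d -> R[i]) : \bar R :=
  poweR (\esum_(k in [set: 'rV[int]_d])
           ((1 + freq_sq k) `^ delta * ComplexField.Normc.normc (fourier f k) ^+ 2)%:E)
        2^-1.

Definition sup_sobolev_norm d (T delta : R) (u : R -> 'rV[R]_d -> R[i]) :
    \bar R :=
  ereal_sup [set sobolev_norm delta (u t) | t in `[0, T]].

(** i u_t = - Delta u + mu |u|^2 u on [0, T] x T^d, in the sense of periodic
    distributions in space: the equation is tested against every e^{i k x}.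
    The regularity of u in H^delta is expressed by [sup_sobolev_norm]. *)
Definition nls_solution d (mu T : R) (u0 : 'rV[R]_d -> R[i])
    (u : R -> 'rV[R]_d -> R[i]) : Prop :=
  [/\ u 0 = u0,
      forall t : R, t \in `[0, T] -> torus_fun (u t),
      forall k, ccontinuous_within `[0, T] (fun t => fourier (u t) k)
    & forall (t : R) k, t \in `]0, T[ ->
        exists2 z, is_cderive (fun s => fourier (u s) k) t z
        & 'i * z = - ((- freq_sq k)%:C * fourier (u t) k)
                   + mu%:C * fourier (fun x => `|u t x| ^+ 2 * u t x) k].

End torus.

Section scheme.
Context {R : realType}.

Definition schrodinger d (t : R) : ('rV[R]_d -> R[i]) -> 'rV[R]_d -> R[i] :=
  multiplier (fun l => cexp ('i * (t * l)%:C)).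

Definition sLRI1_start d (mu tau : R) (u0 : 'rV[R]_d -> R[i])
    (x : 'rV[R]_d) : R[i] :=
  schrodinger tau u0 x
  - 'i * (mu * tau)%:C
    * schrodinger tau (fun y => u0 y ^+ 2
        * multiplier (fun l => phi1 (- (2 * 'i) * (tau * l)%:C))
            (fun w => (u0 w)^*) y) x.

Definition sLRI1_step d (mu tau : R) (v w : 'rV[R]_d -> R[i])
    (x : 'rV[R]_d) : R[i] :=
  schrodinger (2 * tau) w x
  - 2 * 'i * (mu * tau)%:C
    * schrodinger tau (fun y => v y ^+ 2
        * multiplier (fun l => (phis (2 * tau * l))%:C)
            (fun z => (v z)^*) y) x.

Fixpoint sLRI1 d (mu tau : R) (u0 : 'rV[R]_d -> R[i]) (n : nat) :
    'rV[R]_d -> R[i] :=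
  match n with
  | 0%N => u0
  | n1.+1 =>
    match n1 with
    | 0%N => sLRI1_start mu tau u0
    | n2.+1 => sLRI1_step mu tau (sLRI1 mu tau u0 n1) (sLRI1 mu tau u0 n2)
    end
  end.

Definition sigma1 (d : nat) (gamma eps : R) : R :=
  if gamma <= d%:R / 4 - 1 / 2 then 1 + d%:R / 2 + eps else 2 + 2 * gamma.

End scheme.

(* Main.v *)
(** Everything takes place on the Fourier side.  With [w(t)] the coefficients of
    the solution, fix [t0 = t_n] and twist: [p(s) = e^{i s |k|^2} w(t0 + s)] and
    [q(s) = e^{-i s |k|^2} w(t0 - s)].  Their derivatives are the cubic
    convolution weighted by [e^{i s Phi}], respectively [e^{-i s Phi}], where
    [Phi = |k|^2 - |j|^2 - |l|^2 + |m|^2], [m = j + l - k], equals [2 |m|^2] plus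
    inner products of two distinct frequencies among [j], [l], [m].  The
    scheme replaces [Phi] by [2 |m|^2], which gives the filter [phi_s].  In the
    sum of the two equations the errors of odd order in [s] cancel: only
    [cos(s Phi) - cos(2 s |m|^2)] and products of at least one factor
    [sin(s Phi)] or second difference [p + q - 2 w(t0)] remain, and these cost
    [1 + 2 gamma] derivatives spread over the three factors for a local error
    [tau^(2 + gamma)].  Stability is first proved in [H^{s0}], [s0 = sigma_1 - 1],
    with rate [tau], which bounds the numerical solution, and then in [H^1] with
    rate [tau^(1 + gamma)].

    The passage from functions to coefficients needs that a continuous periodic
    function with vanishing Fourier coefficients is zero.  In one variable it
    is tested against [(1 + cos(t - t0) - cos delta)^n], which concentrates at
    [t0]; higher dimensions follow by slicing. *)

Require Import Defs.
From mathcomp Require Import all_boot all_order all_algebra.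
From mathcomp Require Import all_classical all_reals all_analysis.
From mathcomp Require Import ring lra zify.

Set Implicit Arguments.
Unset Strict Implicit.
Unset Printing Implicit Defensive.

Import Order.TTheory GRing.Theory Num.Theory.
Import numFieldNormedType.Exports.

Local Open Scope classical_set_scope.
Local Open Scope ring_scope.
Local Open Scope complex_scope.

Local Notation Re := complex.Re.
Local Notation Im := complex.Im.
Local Notation nc := ComplexField.Normc.normc.

(** * Complex numbers and phases *)

Section complex_facts.
Context {R : realType}.
Implicit Types (z w : R[i]) (x y : R).

(** The index s0 must exceed d/2, so that H^{s0} embeds into the absolutely summable coefficients,
    and must be at least 1 + 2 gamma; both branches of [sigma1] ensure this for sigma_1 - 1. The
    extra derivative in sigma_1 pays for the kernel: inner products take one derivative from each
    factor instead of two from a single one. The 2 theta derivatives of an interpolated phase and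
    the r derivatives of the norm being measured all fall on the largest frequency, whence r + 2
    theta <= s0. The pairs (r, theta) = (s0, 0) and (1, gamma) both satisfy this and run through the
    same lemmas. The obstacle is that H^1 is not an algebra for d = 2 or 3, so an H^1 error bound
    cannot control the iterates by itself; the H^{s0} pass supplies that control, closed by a
    bootstrap that fixes the threshold tau0. Although the scheme has two steps, its propagators are
    unitary at each frequency, so old errors grow only through the Lipschitz term. The one-sided
    start loses the cancellation, but its error tau^2 occurs once, while about T / tau steps each
    contribute tau^(2 + gamma). *)

Lemma complex_ext z w : Re z = Re w -> Im z = Im w -> z = w.
Proof. by case: z w => [a b] [c e] /= -> ->. Qed.

Lemma cReD z w : Re (z + w) = Re z + Re w. Proof. by case: z w => [? ?] []. Qed.
Lemma cImD z w : Im (z + w) = Im z + Im w. Proof. by case: z w => [? ?] []. Qed.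
Lemma cReN z : Re (- z) = - Re z. Proof. by case: z. Qed.
Lemma cImN z : Im (- z) = - Im z. Proof. by case: z. Qed.
Lemma cReM z w : Re (z * w) = Re z * Re w - Im z * Im w.
Proof. by case: z w => [? ?] []. Qed.
Lemma cImM z w : Im (z * w) = Re z * Im w + Im z * Re w.
Proof. by case: z w => [? ?] []. Qed.
Lemma cReJ z : Re (conjc z) = Re z. Proof. by case: z. Qed.
Lemma cImJ z : Im (conjc z) = - Im z. Proof. by case: z. Qed.
Lemma cReC x : Re x%:C = x. Proof. by []. Qed.
Lemma cImC x : Im x%:C = 0. Proof. by []. Qed.

Lemma cJM z w : conjc (z * w) = (conjc z) * (conjc w). Proof. exact: rmorphM. Qed.
Lemma cJD z w : conjc (z + w) = (conjc z) + (conjc w). Proof. exact: rmorphD. Qed.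
Lemma cJB z w : conjc (z - w) = (conjc z) - (conjc w). Proof. exact: rmorphB. Qed.

Lemma cRei : Re ('i : R[i]) = 0. Proof. by []. Qed.
Lemma cImi : Im ('i : R[i]) = 1. Proof. by []. Qed.
Lemma cRe0 : Re (0 : R[i]) = 0. Proof. by []. Qed.
Lemma cIm0 : Im (0 : R[i]) = 0. Proof. by []. Qed.
Lemma cRe1 : Re (1 : R[i]) = 1. Proof. by []. Qed.
Lemma cIm1 : Im (1 : R[i]) = 0. Proof. by []. Qed.

Lemma Re_sum (J : Type) (s : seq J) (P : pred J) (F : J -> R[i]) :
  Re (\sum_(j <- s | P j) F j) = \sum_(j <- s | P j) Re (F j).
Proof. by elim/big_rec2 : _ => // j _ y _ <-; rewrite cReD. Qed.

Lemma Im_sum (J : Type) (s : seq J) (P : pred J) (F : J -> R[i]) :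
  Im (\sum_(j <- s | P j) F j) = \sum_(j <- s | P j) Im (F j).
Proof. by elim/big_rec2 : _ => // j _ y _ <-; rewrite cImD. Qed.

Definition complexRIE := (cReD, cImD, cReN, cImN, cReM, cImM, cReJ, cImJ, cRei, cImi, cRe0, cIm0, cRe1, cIm1,
  cReC, cImC).

Lemma nc_sqr z : nc z ^+ 2 = Re z ^+ 2 + Im z ^+ 2.
Proof. by case: z => a b /=; rewrite sqr_sqrtr// addr_ge0 ?sqr_ge0. Qed.

Lemma nc_ge0 z : 0 <= nc z. Proof. by case: z => a b /=; exact: sqrtr_ge0. Qed.

Lemma nc0 : nc (0 : R[i]) = 0. Proof. exact: ComplexField.Normc.normc0. Qed.
Lemma nc1 : nc (1 : R[i]) = 1. Proof. exact: ComplexField.Normc.normc1. Qed.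
Lemma ncM z w : nc (z * w) = nc z * nc w.
Proof. exact: ComplexField.Normc.normcM. Qed.

Lemma ncD z w : nc (z + w) <= nc z + nc w. Proof. exact: le_normcD. Qed.
Lemma ncN z : nc (- z) = nc z. Proof. exact: normcN. Qed.
Lemma ncJ z : nc (conjc z) = nc z. Proof. by case: z => a b /=; rewrite sqrrN. Qed.
Lemma ncR x : nc x%:C = `|x|.
Proof. by rewrite /= expr0n addr0 sqrtr_sqr. Qed.
Lemma nci : nc ('i : R[i]) = 1. Proof. by rewrite /= expr0n add0r expr1n sqrtr1. Qed.

Lemma nc_sum (J : Type) (s : seq J) (P : pred J) (F : J -> R[i]) :
  nc (\sum_(j <- s | P j) F j) <= \sum_(j <- s | P j) nc (F j).
Proof.
elim/big_rec2 : _ => [|j x y _ h]; first by rewrite nc0.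
by rewrite (le_trans (ncD _ _))// lerD2l.
Qed.

Lemma nc_sqrtr z : nc z = Num.sqrt (Re z ^+ 2 + Im z ^+ 2).
Proof. by case: z. Qed.

Lemma normRe_le z : `|Re z| <= nc z.
Proof. by rewrite nc_sqrtr -sqrtr_sqr ler_wsqrtr// lerDl sqr_ge0. Qed.
Lemma normIm_le z : `|Im z| <= nc z.
Proof. by rewrite nc_sqrtr -sqrtr_sqr ler_wsqrtr// lerDr sqr_ge0. Qed.

Lemma nc_le z : nc z <= `|Re z| + `|Im z|.
Proof.
rewrite -(@ler_pXn2r _ 2) ?nnegrE ?nc_ge0 ?addr_ge0// nc_sqr.
have := real_normK (num_real (Re z)); have := real_normK (num_real (Im z)).
by have := normr_ge0 (Re z); have := normr_ge0 (Im z); nra.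
Qed.

Definition eix x : R[i] := cos x +i* sin x.

Lemma cexp_i x : cexp ('i * x%:C) = eix x.
Proof.
by apply: complex_ext;
  rewrite /cexp /eix !complexRIE /= !(mul0r, mulr0, mul1r, subrr, subr0, addr0, add0r, oppr0) expR0 mul1r.
Qed.

Lemma eixD x y : eix (x + y) = eix x * eix y.
Proof.
apply: complex_ext; rewrite !complexRIE /eix /= ?cosD ?sinD //.
by rewrite addrC.
Qed.

Lemma eix0 : eix 0 = 1. Proof. by rewrite /eix cos0 sin0. Qed.

Lemma eixJ x : conjc (eix x) = eix (- x).
Proof. by rewrite /eix cosN sinN. Qed.

Lemma nc_eix x : nc (eix x) = 1.
Proof. by rewrite /= cos2Dsin2 sqrtr1. Qed.

Lemma eixNK x : eix (- x) * eix x = 1.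
Proof. by rewrite -eixD addNr eix0. Qed.

Lemma eix_subN x : eix x - eix (- x) = (2 * sin x)%:C * 'i.
Proof.
apply: complex_ext; rewrite !complexRIE /eix /= ?cosN ?sinN; ring.
Qed.

Lemma eix_addN x : eix x + eix (- x) = (2 * cos x)%:C.
Proof. apply: complex_ext; rewrite !complexRIE /eix /= ?cosN ?sinN; ring. Qed.

Lemma eixB x y : eix x - eix y = eix ((x + y) / 2) * ((2 * sin ((x - y) / 2))%:C * 'i).
Proof.
rewrite -eix_subN mulrBr -!eixD; by congr (eix _ - eix _); lra.
Qed.

Lemma cosB_prod x y : cos x - cos y = - (2 * sin ((x + y) / 2) * sin ((x - y) / 2)).
Proof.
set a := (x + y) / 2; set b := (x - y) / 2.
have -> : x = a + b by rewrite /a /b; lra.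
have -> : y = a - b by rewrite /a /b; lra.
by rewrite cosB cosD; ring.
Qed.

Lemma sin_le_id x : 0 <= x -> sin x <= x.
Proof.
move=> x0; pose f (y : R) := y - sin y.
have [->|xn0] := eqVneq x 0; first by rewrite sin0.
have xp : 0 < x by rewrite lt_def xn0.
have df y : is_derive y (1 : R) f (1 - cos y).
  by rewrite /f; apply: is_deriveB.
have cf : {within `[0, x], continuous f}.
  by apply: continuous_subspaceT => y; apply/differentiable_continuous/derivable1_diffP; exact: ex_derive.
have [c _] := MVT xp (fun y _ => df y) cf.
rewrite /f sin0 !subr0 => e.
by rewrite -subr_ge0 e mulr_ge0// subr_ge0; exact: cos_le1.
Qed.

Lemma abs_sin_le x : `|sin x| <= `|x|.
Proof.
wlog x0 : x / 0 <= x => [h|].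
  have [/h//|/ltW x0] := leP 0 x.
  by rewrite -normrN -sinN -(normrN x) h// oppr_ge0.
have [px|px] := leP x pi.
  by rewrite !ger0_norm ?sin_le_id// sin_ge0_pi// x0.
rewrite (ger0_norm x0) (le_trans _ (ltW px))//.
have pi1 : 1 <= (pi : R) by rewrite (le_trans _ (pi_ge2 R))// ler1n.
by rewrite (le_trans _ pi1)// ler_norml sin_geN1 sin_le1.
Qed.

Lemma abs_sin_le1 x : `|sin x| <= 1.
Proof. by rewrite ler_norml sin_geN1 sin_le1. Qed.

(** Interpolation between the bounds 1 and |x|: it trades a power theta of time for the same power
    of the frequency weight. *)
Lemma abs_sin_powR x theta : 0 <= theta <= 1 -> `|sin x| <= `|x| `^ theta.
Proof.
move=> /andP[t0 t1].
have [x1|x1] := leP 1 `|x|.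
  by rewrite (le_trans (abs_sin_le1 x))// -(powRr0 `|x|) ler_powR.
rewrite (le_trans (abs_sin_le x))//.
have [->|xn0] := eqVneq x 0; first by rewrite normr0 powR_ge0.
by rewrite ger1_powR// normr_gt0 xn0 ltW.
Qed.

End complex_facts.

(** * Families bounded in l^1 and l^2, discrete Young inequalities *)

Section finite_sums.
Context {R : realType} {I : zmodType}.
Implicit Types (a b c : I -> R) (A B C : R) (J K L : seq I).

(* Bounds on finite subfamilies, so that no summability proof is carried along. *)
Definition l1le a B := 0 <= B /\ forall K, uniq K -> \sum_(k <- K) a k <= B.
Definition l2le a B := 0 <= B /\ forall K, uniq K -> \sum_(k <- K) a k ^+ 2 <= B ^+ 2.

Lemma ler_sqr_le (x y : R) : 0 <= y -> x ^+ 2 <= y ^+ 2 -> x <= y.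
Proof.
move=> y0; rewrite -[x ^+ 2]real_normK ?num_real// ler_pXn2r ?nnegrE// => h.
exact: le_trans (ler_norm _) h.
Qed.

Lemma sum_CS (T : Type) (s : seq T) (p q : T -> R) :
  (\sum_(j <- s) p j * q j) ^+ 2 <=
    (\sum_(j <- s) p j ^+ 2) * (\sum_(j <- s) q j ^+ 2).
Proof.
elim: s => [|x s ih]; first by rewrite !big_nil expr0n mulr0.
rewrite !big_cons.
set P := \sum_(j <- s) p j ^+ 2 in ih *.
set Q := \sum_(j <- s) p j * q j in ih *.
set S := \sum_(j <- s) q j ^+ 2 in ih *.
have P0 : 0 <= P by apply: sumr_ge0 => j _; rewrite sqr_ge0.
have S0 : 0 <= S by apply: sumr_ge0 => j _; rewrite sqr_ge0.
suff h : 2 * (p x * q x) * Q <= p x ^+ 2 * S + P * q x ^+ 2 by nra.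
set u := p x * q x.
(* The induction hypothesis bounds u^2 Q^2 by the product of [p x ^+ 2 * S] and [P * q x ^+ 2],
   hence by the square of their mean. *)
have h2 : `|u * Q| ^+ 2 <= ((p x ^+ 2 * S + P * q x ^+ 2) / 2) ^+ 2.
  rewrite real_normK ?num_real// exprMn.
  apply: (@le_trans _ _ (u ^+ 2 * (P * S))); first by rewrite ler_wpM2l// sqr_ge0.
  have : 0 <= (p x ^+ 2 * S - P * q x ^+ 2) ^+ 2 by exact: sqr_ge0.
  by rewrite /u; nra.
have h3 : 0 <= (p x ^+ 2 * S + P * q x ^+ 2) / 2.
  by rewrite divr_ge0// addr_ge0// mulr_ge0// sqr_ge0.
have := le_trans (ler_norm _) (ler_sqr_le h3 h2); rewrite /u; lra.
Qed.

(** Cauchy-Schwarz after splitting each weight into two square roots; this is the form that Young's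
    inequality uses. *)
Lemma sum_weighted_CS (T : Type) (s : seq T) (p q : T -> R) :
  (forall j, 0 <= p j) ->
  (\sum_(j <- s) p j * q j) ^+ 2 <=
    (\sum_(j <- s) p j) * (\sum_(j <- s) p j * q j ^+ 2).
Proof.
move=> p0; rewrite (eq_bigr (fun j => Num.sqrt (p j) * (Num.sqrt (p j) * q j))) => [|j _]; last first.
  by rewrite mulrA -expr2 sqr_sqrtr.
apply: le_trans (sum_CS _ _ _) _; rewrite le_eqVlt; apply/orP; left; apply/eqP.
by congr (_ * _); apply: eq_bigr => j _; rewrite ?exprMn sqr_sqrtr.
Qed.

Lemma l1le_ge0 a B : l1le a B -> 0 <= B. Proof. by case. Qed.

Lemma l1le_le a b B : (forall k, a k <= b k) -> l1le b B -> l1le a B.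
Proof. by move=> h [B0 hB]; split=> // K /hB; apply: le_trans; exact: ler_sum. Qed.

Lemma l2le_le a b B : (forall k, `|a k| <= b k) -> l2le b B -> l2le a B.
Proof.
move=> h [B0 hB]; split=> // K /hB; apply: le_trans; apply: ler_sum => k _.
by rewrite -real_normK ?num_real// ler_pXn2r ?nnegrE// (le_trans _ (h k)).
Qed.

Lemma l2le_mono a B B' : B <= B' -> l2le a B -> l2le a B'.
Proof.
move=> h [B0 hB]; split=> [|K /hB /le_trans]; [exact: le_trans h|apply].
by rewrite ler_pXn2r ?nnegrE// (le_trans B0).
Qed.

Lemma l1leD a b A B : l1le a A -> l1le b B -> l1le (fun k => a k + b k) (A + B).
Proof.
move=> [A0 hA] [B0 hB]; split=> [|K uK]; first exact: addr_ge0.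
by rewrite big_split lerD ?hA ?hB.
Qed.

Lemma l1leZ (c : R) a A : 0 <= c -> l1le a A -> l1le (fun k => c * a k) (c * A).
Proof.
move=> c0 [A0 hA]; split=> [|K uK]; first exact: mulr_ge0.
by rewrite -big_distrr/= ler_wpM2l ?hA.
Qed.

Lemma l2leZ (c : R) a A : 0 <= c -> l2le a A -> l2le (fun k => c * a k) (c * A).
Proof.
move=> c0 [A0 hA]; split=> [|K uK]; first exact: mulr_ge0.
under eq_bigr do rewrite exprMn.
by rewrite -big_distrr/= exprMn ler_wpM2l ?hA ?sqr_ge0.
Qed.

Lemma l2leD a b A B : l2le a A -> l2le b B -> l2le (fun k => a k + b k) (A + B).
Proof.
move=> [A0 hA] [B0 hB]; split=> [|K uK]; first exact: addr_ge0.
have := hA _ uK; have := hB _ uK; have := sum_CS K a b.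
rewrite [in X in _ -> _ -> _ -> X <= _](eq_bigr (fun k => a k ^+ 2 + 2 * (a k * b k) + b k ^+ 2)); last first.
  by move=> k _; ring.
rewrite !big_split/= -big_distrr/=.
set P := \sum_(j <- K) a j ^+ 2.
set Q := \sum_(j <- K) a j * b j.
set S := \sum_(j <- K) b j ^+ 2 => h1 h2 h3.
have P0 : 0 <= P by apply: sumr_ge0 => j _; rewrite sqr_ge0.
have S0 : 0 <= S by apply: sumr_ge0 => j _; rewrite sqr_ge0.
have h4 : Q ^+ 2 <= (A * B) ^+ 2 by rewrite (le_trans h1)// exprMn ler_pM.
have h5 := ler_sqr_le (mulr_ge0 A0 B0) h4.
nra.
Qed.

Lemma l1le_sup a B k : l1le a B -> a k <= B.
Proof. by move=> [_ /(_ [:: k] isT)]; rewrite big_seq1. Qed.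

Lemma l2le_sup a B k : l2le a B -> `|a k| <= B.
Proof.
move=> [B0 /(_ [:: k] isT)]; rewrite big_seq1 -[a k ^+ 2]real_normK ?num_real//.
by rewrite ler_pXn2r.
Qed.

Lemma l1le_shift a B (f : I -> I) : injective f -> l1le a B -> l1le (a \o f) B.
Proof.
move=> fi [B0 hB]; split=> // K uK.
by rewrite -(big_map f xpredT a) hB// map_inj_uniq.
Qed.

Lemma l2le_shift a B (f : I -> I) : injective f -> l2le a B -> l2le (a \o f) B.
Proof.
move=> fi [B0 hB]; split=> // K uK.
by rewrite -(big_map f xpredT (fun k => a k ^+ 2)) hB// map_inj_uniq.
Qed.

Lemma l1le_mul_l2 a b A B : l2le a A -> l2le b B -> l1le (fun k => a k * b k) (A * B).
Proof.
move=> [A0 hA] [B0 hB]; split=> [|K uK]; first exact: mulr_ge0.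
apply: ler_sqr_le; first exact: mulr_ge0.
rewrite (le_trans (sum_CS _ _ _))// exprMn.
by rewrite ler_pM ?hA ?hB// sumr_ge0// => k _; rewrite sqr_ge0.
Qed.

Definition fconv J a b (k : I) := \sum_(j <- J) a j * b (k - j).

Lemma fconv_ge0 J a b k : (forall j, 0 <= a j) -> (forall j, 0 <= b j) -> 0 <= fconv J a b k.
Proof. by move=> a0 b0; apply: sumr_ge0 => j _; rewrite mulr_ge0. Qed.

Lemma fconv_l1 J a b A B : uniq J -> (forall j, 0 <= a j) ->
  l1le a A -> l1le b B -> l1le (fconv J a b) (A * B).
Proof.
move=> uJ a0 [A0 hA] [B0 hB]; split=> [|K uK]; first exact: mulr_ge0.
rewrite exchange_big/=.
apply: (@le_trans _ _ (\sum_(j <- J) a j * B)); last by rewrite -big_distrl/= ler_wpM2r ?hA.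
apply: ler_sum => j _; rewrite -big_distrr/= ler_wpM2l//.
by have [_ /(_ K uK)] := @l1le_shift b B (fun k => k - j) (addIr _) (conj B0 hB).
Qed.

(** Young's inequality: Cauchy-Schwarz with the weights [a j], then exchange of the sums and
    translation invariance of the bound on [b]. *)
Lemma fconv_l12 J a b A B : uniq J -> (forall j, 0 <= a j) ->
  l1le a A -> l2le b B -> l2le (fconv J a b) (A * B).
Proof.
move=> uJ a0 [A0 hA] [B0 hB]; split=> [|K uK]; first exact: mulr_ge0.
apply: (@le_trans _ _ (\sum_(k <- K) A * \sum_(j <- J) a j * b (k - j) ^+ 2)).
  apply: ler_sum => k _; rewrite (le_trans (sum_weighted_CS _ _ a0))//.
  by rewrite ler_wpM2r ?hA// sumr_ge0// => j _; rewrite mulr_ge0// sqr_ge0.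
rewrite -big_distrr/= exchange_big/= exprMn expr2 -mulrA ler_wpM2l//.
apply: (@le_trans _ _ (\sum_(j <- J) a j * B ^+ 2)).
  apply: ler_sum => j _; rewrite -big_distrr/= ler_wpM2l//.
  by have [_ /(_ K uK)] := @l2le_shift b B (fun k => k - j) (addIr _) (conj B0 hB).
by rewrite -big_distrl/= ler_wpM2r ?hA// sqr_ge0.
Qed.

(** The truncation [J] acts on the index of the first factor only, so this is not the previous bound
    with the factors swapped; here the Cauchy-Schwarz weights are [b (k - j)]. *)
Lemma fconv_l21 J a b A B : uniq J -> (forall j, 0 <= b j) ->
  l2le a A -> l1le b B -> l2le (fconv J a b) (A * B).
Proof.
move=> uJ b0 [A0 hA] [B0 hB]; split=> [|K uK]; first exact: mulr_ge0.
apply: (@le_trans _ _ (\sum_(k <- K) B * \sum_(j <- J) b (k - j) * a j ^+ 2)).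
  apply: ler_sum => k _; rewrite /fconv.
  under eq_bigr do rewrite mulrC.
  rewrite (le_trans (sum_weighted_CS _ _ _))//.
  rewrite ler_wpM2r ?sumr_ge0// => [j _|]; first by rewrite mulr_ge0// sqr_ge0.
  by have [_ /(_ J uJ)] := @l1le_shift b B (fun j => k - j) (subrI _) (conj B0 hB).
rewrite -big_distrr/= exchange_big/= mulrC exprMn [in leRHS]expr2 [in leRHS]expr2.
rewrite [leRHS](_ : _ = B * (A ^+ 2 * B)); last by ring.
rewrite mulrC ler_wpM2l//.
apply: (@le_trans _ _ (\sum_(j <- J) a j ^+ 2 * B)).
  apply: ler_sum => j _; under eq_bigr do rewrite mulrC; rewrite -big_distrr/= ler_wpM2l ?sqr_ge0//.
  by have [_ /(_ K uK)] := @l1le_shift b B (fun k => k - j) (addIr _) (conj B0 hB).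
by rewrite -big_distrl/= ler_wpM2r ?hA.
Qed.

(** Models the Fourier coefficients of a b conj(c): conjugation reverses frequencies, so [c] is read
    at j + l - k, and reflecting [c] gives an iterated convolution. *)
Definition ftri J L a b c (k : I) :=
  \sum_(j <- J) \sum_(l <- L) a j * b l * c (j + l - k).

Lemma ftriE J L a b c k : ftri J L a b c k = fconv J a (fconv L b (c \o -%R)) k.
Proof.
apply: eq_bigr => j _; rewrite big_distrr/=; apply: eq_bigr => l _.
by rewrite mulrA /= !opprB addrA [l + j]addrC.
Qed.

Section ftri_bounds.
Variables (J L : seq I) (a b c : I -> R) (A B C : R).
Hypotheses (uJ : uniq J) (uL : uniq L) (a0 : forall j, 0 <= a j)
  (b0 : forall j, 0 <= b j) (c0 : forall j, 0 <= c j).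

(** The digits give the space of each factor: Young's inequality takes one factor in l^2 and the
    other two in l^1. *)
Lemma ftri_l211 : l2le a A -> l1le b B -> l1le c C -> l2le (ftri J L a b c) (A * (B * C)).
Proof.
move=> ha hb hc; apply: (@l2le_le _ (fconv J a (fconv L b (c \o -%R)))).
  by move=> k; rewrite ftriE ger0_norm// !fconv_ge0// => j; rewrite fconv_ge0// => i; exact: c0.
apply: fconv_l21 => // [j|]; first by rewrite fconv_ge0// => i; exact: c0.
by apply: fconv_l1 => //; exact: l1le_shift oppr_inj hc.
Qed.

Lemma ftri_l121 : l1le a A -> l2le b B -> l1le c C -> l2le (ftri J L a b c) (A * (B * C)).
Proof.
move=> ha hb hc; apply: (@l2le_le _ (fconv J a (fconv L b (c \o -%R)))).
  by move=> k; rewrite ftriE ger0_norm// !fconv_ge0// => j; rewrite fconv_ge0// => i; exact: c0.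
apply: fconv_l12 => //.
by apply: fconv_l21 => // [j|]; [exact: c0|exact: l1le_shift oppr_inj hc].
Qed.

Lemma ftri_l112 : l1le a A -> l1le b B -> l2le c C -> l2le (ftri J L a b c) (A * (B * C)).
Proof.
move=> ha hb hc; apply: (@l2le_le _ (fconv J a (fconv L b (c \o -%R)))).
  by move=> k; rewrite ftriE ger0_norm// !fconv_ge0// => j; rewrite fconv_ge0// => i; exact: c0.
apply: fconv_l12 => //.
by apply: fconv_l12 => //; exact: l2le_shift oppr_inj hc.
Qed.

Lemma ftri_le_l1 k : l1le a A -> l1le b B -> l1le c C -> ftri J L a b c k <= A * (B * C).
Proof.
move=> ha hb hc; rewrite ftriE.
have h : l1le (fconv J a (fconv L b (c \o -%R))) (A * (B * C)).
  by do 2!(apply: fconv_l1 => //); exact: l1le_shift oppr_inj hc.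
exact: l1le_sup h.
Qed.

End ftri_bounds.
End finite_sums.

(** * Summation over the frequency lattice *)

Section cubes.
Context {R : realType} {d : nat}.
Local Notation I := 'rV[int]_d.

(** Lists the cubes of [freq_sum] without repetition, the form over which [l1le] and [l2le]
    quantify. *)
Definition cube_pt N (j : {ffun 'I_d -> 'I_(N.*2.+1)}) : I := \row_i ((j i)%:Z - N%:Z).

Definition cube N : seq I := [seq cube_pt j | j <- enum {: {ffun 'I_d -> 'I_(N.*2.+1)}}].

Lemma cube_uniq N : uniq (cube N).
Proof.
rewrite map_inj_uniq ?enum_uniq// => j1 j2 /rowP e; apply/ffunP => i.
by have := e i; rewrite !mxE => /addIr [] /val_inj.
Qed.

Lemma mem_cube N (k : I) : (k \in cube N) = [forall i, `|k 0 i| <= N%:Z].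
Proof.
apply/mapP/forallP => [[j _ ->] i|h].
  by rewrite mxE ler_norml; case: (j i) => n /=; lia.
have hk i : (absz (k 0 i + N%:Z)%R < N.*2.+1)%N.
  by have := h i; rewrite ler_norml; lia.
exists [ffun i => Ordinal (hk i)]; first by rewrite mem_enum.
apply/rowP => i; rewrite mxE ffunE /=.
by have := h i; rewrite ler_norml; lia.
Qed.

Lemma cube_sub M N : (M <= N)%N -> {subset cube M <= cube N}.
Proof.
move=> MN k; rewrite !mem_cube => /forallP h; apply/forallP => i.
by rewrite (le_trans (h i))// lez_nat.
Qed.

Lemma cube_cofinal (K : seq I) : exists N, {subset K <= cube N}.
Proof.
elim: K => [|k K [N h]]; first by exists 0%N.
pose M := (\max_(i < d) absz (k 0%R i))%N.
exists (maxn M N) => x; rewrite in_cons => /orP[/eqP ->|/h]; last first.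
  by apply: cube_sub; exact: leq_maxr.
rewrite mem_cube; apply/forallP => i.
have : (absz (k 0%R i) <= M)%N by exact: (@leq_bigmax _ (fun i => absz (k 0%R i)) i).
by have := leq_maxl M N; lia.
Qed.

Definition cubesum (V : nmodType) (a : I -> V) N := \sum_(k <- cube N) a k.

Lemma sum_subset_le (a : I -> R) (K L : seq I) : uniq K -> uniq L ->
  {subset K <= L} -> (forall k, 0 <= a k) -> \sum_(k <- K) a k <= \sum_(k <- L) a k.
Proof.
move=> uK uL KL a0.
have pK : perm_eq K [seq l <- L | l \in K].
  apply: uniq_perm => //; first exact: filter_uniq.
  by move=> x; rewrite mem_filter; case xK : (x \in K) => //=; rewrite KL.
rewrite (perm_big _ pK)/= big_filter [leRHS](bigID (mem K))/= lerDl.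
exact: sumr_ge0.
Qed.

Lemma cubesum_nd (a : I -> R) : (forall k, 0 <= a k) -> nondecreasing_seq (cubesum a).
Proof.
by move=> a0 M N MN; apply: sum_subset_le => //; rewrite ?cube_uniq//; exact: cube_sub.
Qed.

Lemma cubesum_le (a : I -> R) B N : l1le a B -> cubesum a N <= B.
Proof. by move=> [_]; apply; exact: cube_uniq. Qed.

Definition rsum (a : I -> R) := limn (cubesum a).

Definition rsummable (a : I -> R) := exists B, l1le (fun k => `|a k|) B.

Lemma rsummable_le (a b : I -> R) : (forall k, `|a k| <= b k) -> rsummable b -> rsummable a.
Proof.
move=> h [B hB]; exists B; apply: l1le_le hB => k.
exact: le_trans (h k) (ler_norm _).
Qed.

Lemma rsummableD (a b : I -> R) : rsummable a -> rsummable b -> rsummable (fun k => a k + b k).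
Proof.
move=> [A hA] [B hB]; exists (A + B); apply: l1le_le (l1leD hA hB) => k.
exact: ler_normD.
Qed.

Lemma rsummableZ (c : R) (a : I -> R) : rsummable a -> rsummable (fun k => c * a k).
Proof.
move=> [A hA]; exists (`|c| * A); apply: l1le_le (l1leZ (normr_ge0 c) hA) => k.
by rewrite normrM.
Qed.

Lemma rsummable_norm (a : I -> R) : rsummable a -> rsummable (fun k => `|a k|).
Proof. by move=> [A hA]; exists A; apply: l1le_le hA => k; rewrite normr_id. Qed.

Lemma rsum_ge0_cvg (a : I -> R) : (forall k, 0 <= a k) -> rsummable a -> cvgn (cubesum a).
Proof.
move=> a0 [B hB]; apply: nondecreasing_is_cvgn; first exact: cubesum_nd.
exists B => _ [N _ <-]; apply: le_trans (cubesum_le N hB).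
by apply: ler_sum => k _; exact: ler_norm.
Qed.

Lemma cubesumD (V : nmodType) (a b : I -> V) : cubesum (fun k => a k + b k) = cubesum a \+ cubesum b.
Proof. by apply/funext => N; rewrite /cubesum big_split. Qed.

Lemma cubesumZ (c : R) (a : I -> R) : cubesum (fun k => c * a k) = (fun N => c * cubesum a N).
Proof. by apply/funext => N; rewrite /cubesum big_distrr. Qed.

Lemma rsum_cvg (a : I -> R) : rsummable a -> cubesum a @ \oo --> rsum a.
Proof.
move=> sa; suff : cvgn (cubesum a) by [].
have sna := rsummable_norm sa.
(* Writes [a] as a difference of two nonnegative summable families, whose cube sums are monotone and
   bounded. *)
have -> : cubesum a = cubesum (fun k => `|a k| + a k) \- cubesum (fun k => `|a k|).
  by apply/funext => N; rewrite cubesumD /= addrAC subrr add0r.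
apply: is_cvgB; apply: rsum_ge0_cvg => //; last exact: rsummableD.
by move=> k; rewrite -lerBlDr sub0r -normrN ler_norm.
Qed.

Lemma rsum_unique (a : I -> R) l : cubesum a @ \oo --> l -> rsum a = l.
Proof. exact: cvg_lim. Qed.

Lemma rsumD (a b : I -> R) : rsummable a -> rsummable b ->
  rsum (fun k => a k + b k) = rsum a + rsum b.
Proof. by move=> sa sb; apply: rsum_unique; rewrite cubesumD; apply: cvgD; exact: rsum_cvg. Qed.

Lemma rsumZ (c : R) (a : I -> R) : rsummable a -> rsum (fun k => c * a k) = c * rsum a.
Proof. by move=> sa; apply: rsum_unique; rewrite cubesumZ; apply: cvgMr; exact: rsum_cvg. Qed.

Lemma rsum_le (a b : I -> R) : rsummable a -> rsummable b -> (forall k, a k <= b k) ->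
  rsum a <= rsum b.
Proof.
move=> sa sb h; apply: ler_lim; [exact: rsum_cvg|exact: rsum_cvg|].
by near=> N; apply: ler_sum => k _; exact: h.
Unshelve. all: by end_near. Qed.

Lemma cubesum_le_rsum (a : I -> R) N : rsummable a -> (forall k, 0 <= a k) -> cubesum a N <= rsum a.
Proof.
move=> sa a0; apply: nondecreasing_cvgn_le; [exact: cubesum_nd|exact: rsum_cvg].
Qed.

(** The families b + a and b - a are nonnegative, so their cube sums stay below their full sums;
    these are the two sides of the absolute value. *)
Lemma rsum_tail (a b : I -> R) N : rsummable b -> (forall k, `|a k| <= b k) ->
  `|rsum a - cubesum a N| <= rsum b - cubesum b N.
Proof.
move=> sb h; have sa := rsummable_le h sb.
have h1 : cubesum (fun k => b k + a k) N <= rsum (fun k => b k + a k).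
  apply: cubesum_le_rsum; first exact: rsummableD.
  by move=> k; have := h k; rewrite ler_norml; lra.
have h2 : cubesum (fun k => b k + (-1) * a k) N <= rsum (fun k => b k + (-1) * a k).
  apply: cubesum_le_rsum; first exact/rsummableD/rsummableZ.
  by move=> k; have := h k; rewrite ler_norml; lra.
move: h1 h2; rewrite !rsumD ?rsumZ//; last exact: rsummableZ.
rewrite !cubesumD cubesumZ /= ler_norml; lra.
Qed.

(** Dominated differentiation: outside a large cube the derivatives and the difference quotients are
    both controlled by the tail of [c], and inside it the sum is finite. *)
Lemma is_derive_rsum (f f' : I -> R -> R) (c : I -> R) (s : R) :
  (forall j t, is_derive t (1 : R) (f j) (f' j t)) ->
  (forall j t, `|f' j t| <= c j) -> rsummable c ->
  (forall t, rsummable (fun j => f j t)) ->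
  is_derive s (1 : R) (fun t => rsum (fun j => f j t)) (rsum (fun j => f' j s)).
Proof.
move=> df bf sc sf.
have lip j x y : `|f j x - f j y| <= `|x - y| * c j.
  wlog xy : x y / y < x => [hw|].
    case: (ltgtP y x) => xy.
    - exact: hw.
    - by have := hw y x xy; rewrite distrC [`|y - x|]distrC.
    - by rewrite xy !subrr normr0 mul0r.
  have cf : {within `[y, x], continuous (f j)}.
    apply: continuous_subspaceT => z.
    by apply/differentiable_continuous/derivable1_diffP; have := df j z => ?; exact: ex_derive.
  have [z _ ->] := MVT xy (fun z _ => df j z) cf.
  by rewrite normrM mulrC ler_wpM2l.
suff h : h^-1 *: (((fun t => rsum (fun j => f j t)) \o shift s) (h *: (1 : R)) -
      rsum (fun j => f j s)) @[h --> (0 : R)^'] --> rsum (fun j => f' j s).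
  apply: DeriveDef; first by apply/cvg_ex; eexists; exact: h.
  exact: cvg_lim h.
apply/cvgrPdist_le => e e0.
have e4 : 0 < e / 4 by rewrite divr_gt0.
have c0 k : 0 <= c k by exact: le_trans (bf k 0).
have /cvgrPdist_le /(_ _ e4) [N _ hN] := rsum_cvg sc.
have {hN} := hN N (leqnn N); rewrite ger0_norm ?subr_ge0 ?cubesum_le_rsum// => hN.
have dS : is_derive s (1 : R) (fun t => cubesum (fun j => f j t) N) (cubesum (fun j => f' j s) N).
  rewrite /cubesum; elim: (cube N) => [|k K ih].
    under eq_fun do rewrite big_nil; rewrite big_nil; exact: is_derive_cst.
  under eq_fun do rewrite big_cons; rewrite big_cons; exact: is_deriveD.
have hS : h^-1 *: (cubesum (fun j => f j (h *: (1:R) + s)) N - cubesum (fun j => f j s) N)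
    @[h --> (0 : R)^'] --> cubesum (fun j => f' j s) N.
  by case: dS => ex; rewrite /derive => <-; exact: ex.
near=> h.
have hn0 : h != 0 by near: h; exact: nbhs_dnbhs_neq.
have : `|cubesum (fun j => f' j s) N -
   h^-1 *: (cubesum (fun j => f j (h *: (1:R) + s)) N - cubesum (fun j => f j s) N)| <= e / 4.
  by near: h; move/cvgrPdist_le : hS => /(_ _ e4).
have t1 : `|rsum (fun j => f' j s) - cubesum (fun j => f' j s) N| <= e / 4.
  by rewrite (le_trans (rsum_tail N sc _)).
have t2 : `|h^-1 * (rsum (fun j => f j (h *: (1:R) + s)) - rsum (fun j => f j s) -
    (cubesum (fun j => f j (h *: (1:R) + s)) N - cubesum (fun j => f j s) N))| <= e / 4.
  (* By the mean value bound [lip] the increments are dominated by |h| c, so the tail of the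
     difference quotient is at most the tail of [c]. *)
  pose g j := f j (h *: (1:R) + s) + (-1) * f j s.
  have sg : forall k, `|g k| <= `|h| * c k.
    move=> k; have := lip k (h *: (1:R) + s) s.
    by rewrite /g mulN1r -addrA subrr addr0 /GRing.scale/= mulr1.
  have := rsum_tail N (rsummableZ `|h| sc) sg.
  rewrite rsumZ// cubesumZ /g rsumD// ?rsumZ// ?cubesumD ?cubesumZ//=; last exact: rsummableZ.
  rewrite -mulrBr normrM normfV ler_pdivrMl ?normr_gt0// !mulN1r => hh.
  rewrite (_ : _ - _ - _ = rsum (fun j : 'rV_d => f j (h *: 1 + s)) -
     rsum (f^~ s) - (cubesum (fun k : 'rV_d => f k (h *: 1 + s)) N - cubesum (f^~ s) N)) in hh; last by ring.
  by rewrite (le_trans hh)// ler_wpM2l.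
move: t1 t2; rewrite /= /GRing.scale/= mulr1.
set a := rsum _; set b := cubesum _ N; set A := rsum _; set B := rsum _.
set A' := cubesum _ N; set B' := cubesum _ N.
rewrite !ler_norml !mulrBr; lra.
Unshelve. all: by end_near. Qed.

End cubes.

(** * Complex sums over the lattice and iterated double sums *)

Section complex_sums.
Context {R : realType} {d : nat}.
Local Notation I := 'rV[int]_d.
Implicit Types (a b : I -> R[i]) (z : R[i]).

Definition ccvg (s : nat -> R[i]) z :=
  (Re (s n) @[n --> \oo] --> Re z) /\ (Im (s n) @[n --> \oo] --> Im z).

Lemma cvg_le_bound (u : nat -> R) l B : u @ \oo --> l -> (forall n, u n <= B) -> l <= B.
Proof. by move=> h hB; apply: (cvgr_to_le h); near=> n; exact: hB. Unshelve. all: by end_near. Qed.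

Lemma cvg_seq_sum (T : Type) (K : seq T) (u : T -> nat -> R) (l : T -> R) :
  (forall k, u k n @[n --> \oo] --> l k) ->
  (\sum_(k <- K) u k n) @[n --> \oo] --> \sum_(k <- K) l k.
Proof.
move=> h; elim: K => [|k K ih].
  by rewrite big_nil; under eq_fun do rewrite big_nil; exact: cvg_cst.
by rewrite big_cons; under eq_fun do rewrite big_cons; exact: cvgD.
Qed.

Lemma rsum_ge0 (a : I -> R) : rsummable a -> (forall k, 0 <= a k) -> 0 <= rsum a.
Proof.
by move=> sa a0; apply: le_trans (cubesum_le_rsum 0 sa a0); exact: sumr_ge0.
Qed.

Lemma ccvg_nc s z : ccvg s z -> nc (s n) @[n --> \oo] --> nc z.
Proof.
move=> [h1 h2]; rewrite nc_sqrtr.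
under eq_fun do rewrite nc_sqrtr.
apply: continuous_cvg; first exact: sqrt_continuous.
by under eq_fun do rewrite !expr2; rewrite !expr2; apply: cvgD; apply: cvgM.
Qed.

Lemma ccvgD s s' z w : ccvg s z -> ccvg s' w -> ccvg (fun n => s n + s' n) (z + w).
Proof.
move=> [h1 h2] [h3 h4]; split; rewrite complexRIE.
  by under eq_fun do rewrite cReD; exact: cvgD.
by under eq_fun do rewrite cImD; exact: cvgD.
Qed.

Lemma ccvgZ s z w : ccvg s z -> ccvg (fun n => w * s n) (w * z).
Proof.
move=> [h1 h2]; split; rewrite complexRIE.
  by under eq_fun do rewrite cReM; apply: cvgB; apply: cvgMr.
by under eq_fun do rewrite cImM; apply: cvgD; apply: cvgMr.
Qed.

Lemma ccvg_sum (T : Type) (K : seq T) (s : T -> nat -> R[i]) (z : T -> R[i]) :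
  (forall k, ccvg (s k) (z k)) -> ccvg (fun n => \sum_(k <- K) s k n) (\sum_(k <- K) z k).
Proof.
move=> h; elim: K => [|k K ih].
  by rewrite big_nil; under eq_fun do rewrite big_nil; split; exact: cvg_cst.
by rewrite big_cons; under eq_fun do rewrite big_cons; exact: ccvgD.
Qed.

Lemma ccvg_dist s z (e : nat -> R) : (forall n, nc (z - s n) <= e n) ->
  e @ \oo --> (0 : R) -> ccvg s z.
Proof.
move=> h e0; split.
  apply/cvgrPdist_le => x x0; move/cvgrPdist_le : e0 => /(_ _ x0); apply: filterS => n.
  rewrite sub0r normrN => hn; rewrite -cReN -cReD (le_trans (normRe_le _))//.
  by rewrite (le_trans (h n))// (le_trans (ler_norm _)).
apply/cvgrPdist_le => x x0; move/cvgrPdist_le : e0 => /(_ _ x0); apply: filterS => n.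
rewrite sub0r normrN => hn; rewrite -cImN -cImD (le_trans (normIm_le _))//.
by rewrite (le_trans (h n))// (le_trans (ler_norm _)).
Qed.

Lemma freq_sumE a : freq_sum a = rsum (fun k => Re (a k)) +i* rsum (fun k => Im (a k)).
Proof.
rewrite /freq_sum /clim /rsum; congr (limn _ +i* limn _); apply/funext => N.
  by rewrite /cubesum Re_sum big_map big_enum.
by rewrite /cubesum Im_sum big_map big_enum.
Qed.

Definition csummable a := exists B, l1le (fun k => nc (a k)) B.

Lemma csummable_rsummable a : csummable a -> rsummable (fun k => nc (a k)).
Proof. by move=> [B hB]; exists B; apply: l1le_le hB => k; rewrite ger0_norm ?nc_ge0. Qed.

Lemma csummable_Re a : csummable a -> rsummable (fun k => Re (a k)).
Proof. by move=> [B hB]; exists B; apply: l1le_le hB => k; exact: normRe_le. Qed.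

Lemma csummable_Im a : csummable a -> rsummable (fun k => Im (a k)).
Proof. by move=> [B hB]; exists B; apply: l1le_le hB => k; exact: normIm_le. Qed.

Lemma csummableD a b : csummable a -> csummable b -> csummable (fun k => a k + b k).
Proof.
move=> [A hA] [B hB]; exists (A + B); apply: l1le_le (l1leD hA hB) => k; exact: ncD.
Qed.

Lemma csummableM (m : I -> R[i]) C a : (forall k, nc (m k) <= C) -> csummable a ->
  csummable (fun k => m k * a k).
Proof.
move=> hm [A hA]; have C0 : 0 <= C by apply: le_trans (hm 0); exact: nc_ge0.
exists (C * A); apply: l1le_le (l1leZ C0 hA) => k.
by rewrite ncM ler_wpM2r// nc_ge0.
Qed.

Lemma csummableZ z a : csummable a -> csummable (fun k => z * a k).
Proof. by move=> sa; apply: (@csummableM (fun=> z) (nc z)) => // k; exact: lexx. Qed.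

Lemma freq_sum_ccvg a : csummable a -> ccvg (cubesum a) (freq_sum a).
Proof.
move=> sa; rewrite freq_sumE; split => /=.
  under eq_fun do rewrite Re_sum; exact: rsum_cvg (csummable_Re sa).
under eq_fun do rewrite Im_sum; exact: rsum_cvg (csummable_Im sa).
Qed.

Lemma freq_sum_unique a z : ccvg (cubesum a) z -> freq_sum a = z.
Proof.
move=> [h1 h2]; rewrite freq_sumE; apply: complex_ext; apply: rsum_unique.
  by move: h1; under eq_fun do rewrite Re_sum.
by move: h2; under eq_fun do rewrite Im_sum.
Qed.

Lemma freq_sumD a b : csummable a -> csummable b ->
  freq_sum (fun k => a k + b k) = freq_sum a + freq_sum b.
Proof.
move=> sa sb; apply: freq_sum_unique; rewrite cubesumD.
by apply: ccvgD; exact: freq_sum_ccvg.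
Qed.

Lemma freq_sumZ z a : csummable a -> freq_sum (fun k => z * a k) = z * freq_sum a.
Proof.
move=> sa; apply: freq_sum_unique.
have -> : cubesum (fun k => z * a k) = fun N => z * cubesum a N.
  by apply/funext => N; rewrite /cubesum big_distrr.
by apply: ccvgZ; exact: freq_sum_ccvg.
Qed.

Lemma nc_freq_sum a : csummable a -> nc (freq_sum a) <= rsum (fun k => nc (a k)).
Proof.
move=> sa; have h1 := ccvg_nc (freq_sum_ccvg sa).
have h2 := rsum_cvg (csummable_rsummable sa).
by apply: (ler_cvg_to h1 h2); near=> N; exact: nc_sum.
Unshelve. all: by end_near. Qed.

Lemma nc_freq_sum_tail a (b : I -> R) N : rsummable b -> (forall k, nc (a k) <= b k) ->
  nc (freq_sum a - cubesum a N) <= 2 * (rsum b - cubesum b N).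
Proof.
move=> sb h; rewrite (le_trans (nc_le _))// freq_sumE cReD cImD cReN cImN Re_sum Im_sum /=.
have h1 := @rsum_tail _ _ (fun k => Re (a k)) b N sb (fun k => le_trans (normRe_le _) (h k)).
have h2 := @rsum_tail _ _ (fun k => Im (a k)) b N sb (fun k => le_trans (normIm_le _) (h k)).
move: h1 h2; rewrite /cubesum. lra.
Qed.

(** Iterated, not a limit over pairs: multiplying by one Fourier series at a time produces
    coefficients in this form. *)
Definition csum2 (X : I -> I -> R[i]) := freq_sum (fun j => freq_sum (fun l => X j l)).

Definition le2 (X : I -> I -> R[i]) B := 0 <= B /\ forall J L, uniq J -> uniq L ->
  \sum_(j <- J) \sum_(l <- L) nc (X j l) <= B.

Definition csummable2 X := exists B, le2 X B.

Lemma le2_inner X B j : le2 X B -> l1le (fun l => nc (X j l)) B.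
Proof. by move=> [B0 hB]; split=> // L uL; have := hB [:: j] L isT uL; rewrite big_seq1. Qed.

Lemma le2_outer X B : le2 X B -> l1le (fun j => nc (freq_sum (X j))) B.
Proof.
move=> hX; have [B0 hB] := hX; split=> // J uJ.
have si j : csummable (X j) by exists B; exact: le2_inner hX.
have h1 : (\sum_(j <- J) nc (cubesum (X j) N)) @[N --> \oo] --> \sum_(j <- J) nc (freq_sum (X j)).
  by apply: cvg_seq_sum => j; exact/ccvg_nc/freq_sum_ccvg.
apply: (cvg_le_bound h1) => N; apply: le_trans (hB J (cube N) uJ (cube_uniq _)).
by apply: ler_sum => j _; exact: nc_sum.
Qed.

Lemma csummable2_inner X j : csummable2 X -> csummable (X j).
Proof. by move=> [B hB]; exists B; exact: le2_inner hB. Qed.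

Lemma csummable2_outer X : csummable2 X -> csummable (fun j => freq_sum (X j)).
Proof. by move=> [B hB]; exists B; exact: le2_outer hB. Qed.

Lemma csummable2D X Y : csummable2 X -> csummable2 Y -> csummable2 (fun j l => X j l + Y j l).
Proof.
move=> [A [A0 hA]] [B [B0 hB]]; exists (A + B); split=> [|J L uJ uL]; first exact: addr_ge0.
apply: le_trans (lerD (hA J L uJ uL) (hB J L uJ uL)); rewrite -big_split/=.
apply: ler_sum => j _; rewrite -big_split/=; apply: ler_sum => l _; exact: ncD.
Qed.

Lemma csummable2M (m : I -> I -> R[i]) C X : (forall j l, nc (m j l) <= C) ->
  csummable2 X -> csummable2 (fun j l => m j l * X j l).
Proof.
move=> hm [A [A0 hA]]; have C0 : 0 <= C by apply: le_trans (hm 0 0); exact: nc_ge0.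
exists (C * A); split=> [|J L uJ uL]; first exact: mulr_ge0.
apply: le_trans (ler_wpM2l C0 (hA J L uJ uL)); rewrite big_distrr/=.
apply: ler_sum => j _; rewrite big_distrr/=; apply: ler_sum => l _.
by rewrite ncM ler_wpM2r// nc_ge0.
Qed.

Lemma csum2D X Y : csummable2 X -> csummable2 Y ->
  csum2 (fun j l => X j l + Y j l) = csum2 X + csum2 Y.
Proof.
move=> sX sY; rewrite -freq_sumD; [|exact: csummable2_outer..].
by congr freq_sum; apply/funext => j; rewrite freq_sumD//; exact: csummable2_inner.
Qed.

Lemma csum2Z z X : csummable2 X -> csum2 (fun j l => z * X j l) = z * csum2 X.
Proof.
move=> sX; rewrite -freq_sumZ; last exact: csummable2_outer.
by congr freq_sum; apply/funext => j; rewrite freq_sumZ//; exact: csummable2_inner.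
Qed.

(** A Fatou property: bounds on finite subfamilies survive pointwise limits. *)
Lemma l2le_lim (s : nat -> I -> R[i]) (z : I -> R[i]) (w : I -> R) B :
  (forall k, ccvg (s^~ k) (z k)) -> (forall N, l2le (fun k => w k * nc (s N k)) B) ->
  l2le (fun k => w k * nc (z k)) B.
Proof.
move=> h1 h2; split=> [|K uK]; first by have [] := h2 0%N.
have h : (\sum_(k <- K) (w k * nc (s N k)) ^+ 2) @[N --> \oo] --> \sum_(k <- K) (w k * nc (z k)) ^+ 2.
  apply: cvg_seq_sum => k; under eq_fun do rewrite expr2; rewrite expr2.
  by apply: cvgM; apply: cvgMr; exact: ccvg_nc.
by apply: (cvg_le_bound h) => N; have [_ ->] := h2 N.
Qed.

(** The bound on all finite truncations gives summability at each k because [w k] is positive; the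
    Fatou property is then used twice, for the outer and for the inner sum. *)
Lemma l2le_csum2 (X : I -> I -> I -> R[i]) (w : I -> R) B :
  (forall k, 0 < w k) ->
  (forall J L, uniq J -> uniq L ->
    l2le (fun k => w k * \sum_(j <- J) \sum_(l <- L) nc (X k j l)) B) ->
  (forall k, csummable2 (X k)) /\ l2le (fun k => w k * nc (csum2 (X k))) B.
Proof.
move=> w0 h; have sX k : csummable2 (X k).
  have B0 : 0 <= B by have [] := h [::] [::] isT isT.
  exists (B / w k); split=> [|J L uJ uL]; first by rewrite divr_ge0// ltW.
  rewrite ler_pdivlMr// mulrC.
  by have := l2le_sup k (h J L uJ uL); exact/le_trans/ler_norm.
split=> //.
apply: (@l2le_lim (fun N k => cubesum (fun j => freq_sum (X k j)) N)) => [k|N].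
  exact/freq_sum_ccvg/csummable2_outer.
apply: (@l2le_lim (fun M k => \sum_(j <- cube N) cubesum (X k j) M)) => [k|M].
  by apply: ccvg_sum => j; exact/freq_sum_ccvg/csummable2_inner.
apply: l2le_le (h (cube N) (cube M) (cube_uniq _) (cube_uniq _)) => k.
have wk := ltW (w0 k).
rewrite ger0_norm; last by rewrite mulr_ge0// nc_ge0.
by rewrite ler_wpM2l// (le_trans (nc_sum _ _ _))//; apply: ler_sum => j _; exact: nc_sum.
Qed.

Lemma is_cderive_freq_sum (f f' : I -> R -> R[i]) (c : I -> R) (s : R) :
  (forall j t, is_cderive (f j) t (f' j t)) ->
  (forall j t, nc (f' j t) <= c j) -> rsummable c ->
  (forall t, csummable (fun j => f j t)) ->
  is_cderive (fun t => freq_sum (fun j => f j t)) s (freq_sum (fun j => f' j s)).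
Proof.
move=> df bf sc sf; split; under eq_fun do rewrite freq_sumE; rewrite freq_sumE.
  apply: (@is_derive_rsum _ _ (fun j t => Re (f j t)) (fun j t => Re (f' j t)) c) => //.
  - by move=> j t; have [] := df j t.
  - by move=> j t; exact: le_trans (normRe_le _) (bf j t).
  - by move=> t; exact: csummable_Re.
apply: (@is_derive_rsum _ _ (fun j t => Im (f j t)) (fun j t => Im (f' j t)) c) => //.
- by move=> j t; have [] := df j t.
- by move=> j t; exact: le_trans (normIm_le _) (bf j t).
- by move=> t; exact: csummable_Im.
Qed.

Lemma is_cderive_csum2 (f f' : I -> I -> R -> R[i]) (c : I -> I -> R[i]) (s : R) :
  (forall j l t, is_cderive (f j l) t (f' j l t)) ->
  (forall j l t, nc (f' j l t) <= nc (c j l)) -> csummable2 c ->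
  (forall t, csummable2 (fun j l => f j l t)) ->
  is_cderive (fun t => csum2 (fun j l => f j l t)) s (csum2 (fun j l => f' j l s)).
Proof.
move=> df bf sc sf; have [B hB] := sc.
have hi j : l1le (fun l => nc (c j l)) B by exact: le2_inner hB.
have ri j : rsummable (fun l => nc (c j l)) by apply: csummable_rsummable; exists B.
apply: (@is_cderive_freq_sum (fun j t => freq_sum (fun l => f j l t))
  (fun j t => freq_sum (fun l => f' j l t)) (fun j => rsum (fun l => nc (c j l)))).
- move=> j t; apply: (@is_cderive_freq_sum (f j) (f' j) (fun l => nc (c j l))) => // t'.
  exact: (csummable2_inner j (sf t')).
- move=> j t; have sf' : csummable (fun l => f' j l t) by exists B; exact: l1le_le (bf j ^~ t) (hi j).
  rewrite (le_trans (nc_freq_sum sf'))//; apply: rsum_le => //.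
  exact: csummable_rsummable.
- exists B; split=> [|J uJ]; first by case: hB.
  rewrite (eq_bigr (fun j => rsum (fun l => nc (c j l)))); last first.
    by move=> j _; rewrite ger0_norm// rsum_ge0// => l; exact: nc_ge0.
  have h1 : (\sum_(j <- J) cubesum (fun l => nc (c j l)) N) @[N --> \oo] --> \sum_(j <- J) rsum (fun l => nc (c j l)).
    by apply: cvg_seq_sum => j; exact: rsum_cvg.
  by apply: (cvg_le_bound h1) => N; have [_] := hB; apply => //; exact: cube_uniq.
- by move=> t; exact: csummable2_outer.
Qed.

End complex_sums.

(** * Weighted l^2 spaces of coefficients *)

Section weights.
Context {R : realType} {d : nat}.
Local Notation I := 'rV[int]_d.
Implicit Types (j k l m : I).

Definition om k : R := 1 + freq_sq k.

Lemma freq_sq_ge0 k : 0 <= freq_sq k :> R.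
Proof. by apply: sumr_ge0 => i _; rewrite sqr_ge0. Qed.

Lemma om_ge1 k : 1 <= om k. Proof. by rewrite lerDl freq_sq_ge0. Qed.

Lemma om_gt0 k : 0 < om k. Proof. exact: lt_le_trans (om_ge1 k). Qed.

Lemma om_ge0 k : 0 <= om k. Proof. exact: ltW (om_gt0 k). Qed.

Lemma freq_sqN k : freq_sq (- k) = freq_sq k :> R.
Proof. by apply: eq_bigr => i _; rewrite mxE rmorphN sqrrN. Qed.

Definition dot j l : R := \sum_(i < d) (j 0 i)%:~R * (l 0 i)%:~R.

Lemma freq_sq_tri j l m : freq_sq (j + l - m) =
  freq_sq j + freq_sq l + freq_sq m + 2 * (dot j l - dot j m - dot l m) :> R.
Proof.
rewrite /freq_sq /dot -!sumrB big_distrr/= -!big_split/=.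
apply: eq_bigr => i _; rewrite !mxE rmorphD rmorphN rmorphD /=; ring.
Qed.

Lemma dot_le j l : `|dot j l| <= om j `^ (1 / 2) * om l `^ (1 / 2).
Proof.
rewrite -powRM ?om_ge0// [1 / 2]mul1r powR12_sqrt ?mulr_ge0 ?om_ge0//.
rewrite -sqrtr_sqr ler_wsqrtr//.
apply: le_trans (sum_CS _ _ _) _.
by apply: ler_pM; rewrite ?freq_sq_ge0 ?lerDr.
Qed.

Lemma om_tri j l m : om (j + l - m) <= 3 * (om j + om l + om m).
Proof.
suff : freq_sq (j + l - m) <= 3 * (freq_sq j + freq_sq l + freq_sq m) :> R by rewrite /om; lra.
rewrite /freq_sq -!big_split/= big_distrr/=; apply: ler_sum => i _.
rewrite !mxE rmorphD rmorphN rmorphD /=.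
move: ((j 0 i)%:~R) ((l 0 i)%:~R) ((m 0 i)%:~R) => x y z.
have := sqr_ge0 (x - y); have := sqr_ge0 (x + z); have := sqr_ge0 (y + z); nra.
Qed.

(** The H^r norm read on coefficients; the exponent is halved because [l2le] squares. *)
Definition hle (r : R) (a : I -> R[i]) (B : R) := l2le (fun k => om k `^ (r / 2) * nc (a k)) B.

(** Cauchy condensation: the block from 2^m to 2^(m+1) has 2^m terms, each at most 2^(-q m). *)
Lemma sum_powR_dyadic (q : R) (m : nat) : 1 < q ->
  \sum_(1 <= n < 2 ^ m) n%:R `^ (- q) <= \sum_(i < m) (2 `^ (1 - q)) ^+ i.
Proof.
move=> q1; elim: m => [|m ih]; first by rewrite big_geq ?big_ord0.
rewrite big_ord_recr/= (big_cat_nat _ (n := 2 ^ m))/= ?expn_gt0 ?leq_exp2l//.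
apply: lerD => //.
apply: (@le_trans _ _ (\sum_(2 ^ m <= n < 2 ^ m.+1) (2 ^ m)%:R `^ (- q))).
  apply: ler_sum_nat => n /andP[h _].
  rewrite !powRN lef_pV2 ?posrE ?powR_gt0 ?ltr0n ?expn_gt0//; last first.
    by rewrite (leq_trans _ h)// expn_gt0.
  apply: ge0_ler_powR; rewrite ?nnegrE ?ler_nat//; lra.
rewrite sumr_const_nat expnS mul2n -addnn addnK.
rewrite -[leLHS]mulr_natl natrX -(@powR_mulrn _ 2 m)// -powRrM.
rewrite -powRD; last by rewrite pnatr_eq0 implybT.
rewrite -powR_mulrn ?powR_ge0// -powRrM.
by rewrite (_ : (1 - q) * m%:R = m%:R + m%:R * - q); last by ring.
Qed.

Lemma sum_powR_bounded (q : R) : 1 < q ->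
  exists B : R, forall N, \sum_(1 <= n < N) n%:R `^ (- q) <= B.
Proof.
move=> q1; exists (1 - 2 `^ (1 - q))^-1 => N.
have r1 : 2 `^ (1 - q) < 1 :> R.
  have -> : 2 `^ (1 - q) = (2 `^ (q - 1))^-1 :> R by rewrite -powRN opprB.
  rewrite invf_lt1 ?powR_gt0//.
  have h := @gt0_ltr_powR R (q - 1); rewrite subr_gt0 in h.
  have {h} := h q1 1 2; rewrite powR1 => -> //; rewrite ?nnegrE//; lra.
apply: (@le_trans _ _ (\sum_(1 <= n < 2 ^ N) n%:R `^ (- q))).
  case: N => [|N]; first by rewrite big_geq// sumr_ge0// => n _; exact: powR_ge0.
  rewrite [leRHS](big_cat_nat _ (n := N.+1))//=; last by rewrite ltnW// ltn_expl.
  by rewrite lerDl sumr_ge0// => n _; exact: powR_ge0.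
apply: le_trans (sum_powR_dyadic N q1) _.
set x := 2 `^ (1 - q) in r1 *.
have x0 : 0 <= x by exact: powR_ge0.
rewrite -[leRHS]mul1r ler_pdivlMr ?subr_gt0//.
have := subrX1 x N; have : 0 <= x ^+ N by rewrite exprn_ge0.
set S := \sum_(i < N) _; lra.
Qed.

Lemma sum_int_bounded (p : R) : 1 / 2 < p ->
  exists B : R, forall N, \sum_(j < N.*2.+1) (1 + (j%:Z - N%:Z)%:~R ^+ 2) `^ (- p) <= B.
Proof.
move=> p1; have [|B hB] := @sum_powR_bounded (2 * p); first by lra.
exists (1 + 2 * B) => N.
pose f (z : int) := (1 + z%:~R ^+ 2 : R) `^ (- p).
have fn n : (0 < n)%N -> f n%:Z <= n%:R `^ (- (2 * p)).
  move=> n0; rewrite /f -mulrN powRrM powR_mulrn// !powRN.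
  have n0' : 0 < n%:R :> R by rewrite ltr0n.
  have h1 : 0 < 1 + n%:R ^+ 2 :> R by rewrite ltr_pwDl// sqr_ge0.
  rewrite lef_pV2 ?posrE ?powR_gt0 ?exprn_gt0//.
  by apply: ge0_ler_powR; rewrite ?nnegrE ?sqr_ge0 ?addr_ge0 ?lerDr//; lra.
have fN z : f (- z) = f z by rewrite /f rmorphN sqrrN.
have hS : \sum_(1 <= n < N.+1) f n%:Z <= B.
  apply: le_trans (hB N.+1); apply: ler_sum_nat => n /andP[n0 _]; exact: fn.
(* Splits the shifted range at its centre and folds the negative half onto the positive one. *)
have -> : \sum_(j < N.*2.+1) (1 + (j%:Z - N%:Z)%:~R ^+ 2) `^ (- p) =
    f 0 + \sum_(1 <= n < N.+1) f n%:Z + \sum_(1 <= n < N.+1) f n%:Z.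
  rewrite -(big_mkord xpredT (fun i : nat => (1 + (i%:Z - N%:Z)%:~R ^+ 2) `^ (- p))).

  rewrite (big_cat_nat _ (n := N))//=; last by lia.
  rewrite addrC; congr (_ + _).
    rewrite -[N in X in \sum_(X <= _ < _) _ = _]add0n big_addn.
    rewrite (_ : (N.*2.+1 - N)%N = N.+1); last by lia.
    rewrite big_nat_recl//= big_add1/=; congr (_ + _).
      by rewrite /f add0n subrr.
    by apply: eq_big_nat => n _; congr (f _); lia.
  rewrite big_nat_rev/= [RHS]big_add1/=.
  by apply: eq_big_nat => n hn; rewrite -fN; congr (f _); lia.
have f0 : f 0 <= 1 by rewrite /f expr0n addr0 powR1.
lra.
Qed.

(** Each factor 1 + k_i^2 is at most [om k], so the weight is dominated by a product of
    one-dimensional weights with exponent s / d > 1/2. *)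
Lemma om_summable (s : R) : (0 < d)%N -> d%:R / 2 < s ->
  exists B : R, l1le (fun k => om k `^ (- s)) B.
Proof.
move=> d0 ds; have dp : 0 < d%:R :> R by rewrite ltr0n.
have [|B hB] := @sum_int_bounded (s / d%:R).
  by rewrite ltr_pdivlMr// mulrC mulrA mulr1.
pose g (z : int) : R := (1 + z%:~R ^+ 2) `^ (- (s / d%:R)).
have sp : 0 <= s by rewrite ltW// (le_lt_trans _ ds)// divr_ge0.
have hk k : om k `^ (- s) <= \prod_(i < d) g (k 0 i).
  have -> : om k `^ (- s) = \prod_(i < d) om k `^ (- (s / d%:R)).
    rewrite prodr_const card_ord -powR_mulrn ?powR_ge0// -powRrM; congr (_ `^ _).
    by rewrite mulNr divfK// gt_eqF.
  apply: ler_prod => i _; rewrite powR_ge0/= /g !powRN.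
  have h1 : 0 < 1 + (k 0 i)%:~R ^+ 2 :> R by rewrite ltr_pwDl// sqr_ge0.
  rewrite lef_pV2 ?posrE ?powR_gt0 ?om_gt0//.
  apply: ge0_ler_powR; rewrite ?nnegrE ?om_ge0 ?addr_ge0 ?sqr_ge0 ?divr_ge0//.
  by rewrite lerD2l /freq_sq (bigD1 i)//= lerDl sumr_ge0// => i' _; rewrite sqr_ge0.
have hc N : \sum_(k <- cube N) \prod_(i < d) g (k 0 i) <= B ^+ d.
  rewrite big_map big_enum/=.
  under eq_bigr => j _ do under eq_bigr => i _ do rewrite mxE.
  rewrite -(bigA_distr_bigA (fun (i : 'I_d) (j : 'I_N.*2.+1) => g (j%:Z - N%:Z))).
  have h0 : 0 <= \sum_(j < N.*2.+1) g (j%:Z - N%:Z) by apply: sumr_ge0 => j _; exact: powR_ge0.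
  by rewrite prodr_const card_ord lerXn2r ?nnegrE ?(le_trans h0 (hB N)) ?hB.
exists (B ^+ d); split=> [|K uK].
  by apply: le_trans (hc 0%N); apply: sumr_ge0 => k _; apply: prodr_ge0 => i _; exact: powR_ge0.
have [N KN] := cube_cofinal K.
apply: le_trans (hc N).
apply: le_trans (sum_subset_le uK (cube_uniq N) KN _) _ => [k|]; first exact: powR_ge0.
by apply: ler_sum => k _.
Qed.

Lemma om_powRD k (x y : R) : om k `^ (x + y) = om k `^ x * om k `^ y.
Proof. by rewrite powRD// (gt_eqF (om_gt0 k)) implybT. Qed.

(* The embedding of h^s into l^1 for s > d/2, with r - s spare weights. *)
Lemma hle_l1 (s : R) : (0 < d)%N -> d%:R / 2 < s ->
  exists2 C : R, 0 < C & forall r a A, hle r a A ->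
    l1le (fun k => om k `^ ((r - s) / 2) * nc (a k)) (C * A).
Proof.
move=> d0 ds; have [B [B0 hB]] := om_summable d0 ds.
exists (Num.sqrt B + 1) => [|r a A ha]; first by rewrite ltr_wpDl// sqrtr_ge0.
have h : l2le (fun k => om k `^ (- s / 2)) (Num.sqrt B + 1).
  split=> [|K uK]; first by rewrite addr_ge0 ?sqrtr_ge0.
  apply: (@le_trans _ _ (Num.sqrt B ^+ 2)); last first.
    by rewrite lerXn2r ?nnegrE ?sqrtr_ge0 ?addr_ge0 ?sqrtr_ge0// lerDl.
  rewrite sqr_sqrtr//; apply: le_trans (hB K uK); apply: ler_sum => k _.
  by rewrite expr2 -om_powRD le_eqVlt; apply/orP; left; apply/eqP; congr (_ `^ _); lra.
apply: l1le_le (l1le_mul_l2 h ha) => k.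
by rewrite mulrA -om_powRD le_eqVlt; apply/orP; left; apply/eqP; congr (_ `^ _ * _); lra.
Qed.

Lemma hle_mono r r' a A : r' <= r -> hle r a A -> hle r' a A.
Proof.
move=> rr; apply: l2le_le => k; rewrite ger0_norm ?mulr_ge0 ?powR_ge0 ?nc_ge0//.
by rewrite ler_wpM2r ?nc_ge0// ler_powR ?om_ge1//; lra.
Qed.

Lemma hle_csummable s a A : (0 < d)%N -> d%:R / 2 < s -> hle s a A -> csummable a.
Proof.
move=> d0 ds; have [C _ hC] := hle_l1 d0 ds; move=> /hC h; exists (C * A); apply: l1le_le h => k.
by rewrite subrr mul0r powRr0 mul1r.
Qed.

Lemma hleD r a b A B : hle r a A -> hle r b B -> hle r (fun k => a k + b k) (A + B).
Proof.
move=> ha hb; apply: l2le_le (l2leD ha hb) => k.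
rewrite ger0_norm ?mulr_ge0 ?powR_ge0 ?nc_ge0// -mulrDr ler_wpM2l ?powR_ge0//; exact: ncD.
Qed.

Lemma hle_nc r a b A : (forall k, nc (a k) <= nc (b k)) -> hle r b A -> hle r a A.
Proof.
move=> h; apply: l2le_le => k.
by rewrite ger0_norm ?mulr_ge0 ?powR_ge0 ?nc_ge0// ler_wpM2l ?powR_ge0.
Qed.

Lemma hleM r (m : I -> R[i]) (c : R) a A : 0 <= c -> (forall k, nc (m k) <= c) -> hle r a A ->
  hle r (fun k => m k * a k) (c * A).
Proof.
move=> c0 h ha; apply: l2le_le (l2leZ c0 ha) => k.
rewrite ger0_norm ?mulr_ge0 ?powR_ge0 ?nc_ge0// ncM mulrCA ler_wpM2r//.
by rewrite mulr_ge0 ?powR_ge0 ?nc_ge0.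
Qed.

End weights.

Lemma eq_ler (R : realType) (x y z t : R) : x <= y -> x = z -> y = t -> z <= t.
Proof. by move=> h <- <-. Qed.

(** * Trilinear estimates *)

Section trilinear.
Context {R : realType} {d : nat}.
Local Notation I := 'rV[int]_d.
Implicit Types (a b c : I -> R[i]) (j k l m : I) (X Y : I -> I -> I -> R).
Local Notation om := (@om R d).

(* The truncations to j in J, l in L keep all sums finite; [csum2_hle] passes to the limit. *)
Definition tle (r : R) X B := forall J L, uniq J -> uniq L ->
  l2le (fun k => om k `^ (r / 2) * \sum_(j <- J) \sum_(l <- L) X k j l) B.

Lemma tle_le r X Y B : (forall k j l, 0 <= X k j l <= Y k j l) -> tle r Y B -> tle r X B.
Proof.
move=> h hY J L uJ uL; apply: l2le_le (hY J L uJ uL) => k.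
rewrite ger0_norm; last first.
  rewrite mulr_ge0 ?powR_ge0// sumr_ge0// => j _; rewrite sumr_ge0// => l _.
  by case/andP: (h k j l).
rewrite ler_wpM2l ?powR_ge0//; apply: ler_sum => j _; apply: ler_sum => l _.
by case/andP: (h k j l).
Qed.

Lemma tleD r X Y A B : tle r X A -> tle r Y B ->
  tle r (fun k j l => X k j l + Y k j l) (A + B).
Proof.
move=> hX hY J L uJ uL.
have := l2leD (hX J L uJ uL) (hY J L uJ uL); congr l2le; apply/funext => k.
by rewrite -mulrDr -big_split/=; congr (_ * _); apply: eq_bigr => j _; rewrite big_split.
Qed.

Lemma tleZ r (x : R) X A : 0 <= x -> tle r X A -> tle r (fun k j l => x * X k j l) (x * A).
Proof.
move=> x0 hX J L uJ uL.
have := l2leZ x0 (hX J L uJ uL); congr l2le; apply/funext => k.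
by rewrite mulrCA; congr (_ * _); rewrite big_distrr; apply: eq_bigr => j _; rewrite big_distrr.
Qed.

Lemma tle_mono r X A B : A <= B -> tle r X A -> tle r X B.
Proof. by move=> AB h J L uJ uL; exact: l2le_mono AB (h J L uJ uL). Qed.

Lemma csum2_hle r (X : I -> I -> I -> R[i]) B : tle r (fun k j l => nc (X k j l)) B ->
  (forall k, csummable2 (X k)) /\ hle r (fun k => csum2 (X k)) B.
Proof. by move=> h; apply: l2le_csum2 => // k; rewrite powR_gt0// om_gt0. Qed.

Definition wn (r : R) a k := om k `^ (r / 2) * nc (a k).

Lemma wn_ge0 r a k : 0 <= wn r a k. Proof. by rewrite mulr_ge0 ?powR_ge0 ?nc_ge0. Qed.

Definition nc3 a b c k j l := nc (a j) * nc (b l) * nc (c (j + l - k)).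

Lemma nc3_ge0 a b c k j l : 0 <= nc3 a b c k j l.
Proof. by rewrite !mulr_ge0 ?nc_ge0. Qed.

(* The weight at the output frequency is paid for by the largest input frequency. *)
Lemma out_weight (p x y z r s : R) : 1 <= x -> 1 <= y -> 1 <= z -> 0 <= p <= 3 * (x + y + z) ->
  0 <= r <= s ->
  p `^ (r / 2) <= 9 `^ (r / 2) * (x `^ (r / 2) + x `^ ((r - s) / 2) * y `^ (s / 2)
                               + x `^ ((r - s) / 2) * z `^ (s / 2)).
Proof.
move=> x1 y1 z1 /andP[p0 pb] /andP[r0 rs].
have hm t : 1 <= t -> p <= 9 * t -> p `^ (r / 2) <= 9 `^ (r / 2) * t `^ (r / 2).
  move=> t1 pt; rewrite -powRM//; last by lra.
  by apply: ge0_ler_powR; rewrite ?nnegrE//; lra.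
(* The exponent (r - s) / 2 is nonpositive, so enlarging its base from x to t only decreases the
   power. *)
have ht t : x <= t -> t `^ (r / 2) <= x `^ ((r - s) / 2) * t `^ (s / 2).
  move=> xt; rewrite (_ : r / 2 = (r - s) / 2 + s / 2); last by lra.
  have t0 : t != 0 by rewrite gt_eqF//; lra.
  rewrite powRD ?t0 ?implybT// ler_wpM2r ?powR_ge0//.
  rewrite (_ : (r - s) / 2 = - ((s - r) / 2)); last by lra.
  rewrite !powRN lef_pV2 ?posrE ?powR_gt0; try lra.
  by apply: ge0_ler_powR; rewrite ?nnegrE; lra.
have n0 := powR_ge0 9 (r / 2).
have X0 := powR_ge0 x (r / 2).
have Y0 := mulr_ge0 (powR_ge0 x ((r - s) / 2)) (powR_ge0 y (s / 2)).
have Z0 := mulr_ge0 (powR_ge0 x ((r - s) / 2)) (powR_ge0 z (s / 2)).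
have [xy|xy] := leP y x.
  have [xz|xz] := leP z x.
    by apply: le_trans (hm x x1 _) _; [lra|rewrite ler_wpM2l//; lra].
  apply: le_trans (hm z z1 _) _; first by lra.
  by rewrite ler_wpM2l//; have := ht z (ltW xz); lra.
have [yz|yz] := leP z y.
  apply: le_trans (hm y y1 _) _; first by lra.
  by rewrite ler_wpM2l//; have := ht y (ltW xy); lra.
apply: le_trans (hm z z1 _) _; first by lra.
by rewrite ler_wpM2l//; have := ht z (ltW (lt_trans xy yz)); lra.
Qed.

Lemma om_out k j l : 0 <= om k <= 3 * (om j + om l + om (j + l - k)).
Proof.
rewrite om_ge0/=; have := om_tri j l (j + l - k).
by rewrite opprB addrC subrK.
Qed.

Variable s0 : R.
Hypotheses (d0 : (0 < d)%N) (hs0 : d%:R / 2 < s0).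

Lemma s0_ge0 : 0 <= s0.
Proof. by rewrite ltW// (le_lt_trans _ hs0)// divr_ge0. Qed.

(** Reduces a trilinear estimate to a pointwise inequality that splits the weighted kernel into
    three products, one for each factor that may be the one kept in l^2. *)
Lemma tle_products (Z : R) (f : I -> I -> I -> R) r (a1 b1 c1 a2 b2 c2 a3 b3 c3 : I -> R) B1 B2 B3 :
  0 <= Z -> (forall k j l, 0 <= f k j l) ->
  (forall k j l, om k `^ (r / 2) * f k j l <= Z * (a1 j * b1 l * c1 (j + l - k)
     + a2 j * b2 l * c2 (j + l - k) + a3 j * b3 l * c3 (j + l - k))) ->
  (forall J L, uniq J -> uniq L -> l2le (ftri J L a1 b1 c1) B1) ->
  (forall J L, uniq J -> uniq L -> l2le (ftri J L a2 b2 c2) B2) ->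
  (forall J L, uniq J -> uniq L -> l2le (ftri J L a3 b3 c3) B3) ->
  tle r f (Z * (B1 + B2 + B3)).
Proof.
move=> Z0 f0 h h1 h2 h3 J L uJ uL.
apply: l2le_le (l2leZ Z0 (l2leD (l2leD (h1 J L uJ uL) (h2 J L uJ uL)) (h3 J L uJ uL))) => k.
rewrite ger0_norm; last first.
  by rewrite mulr_ge0 ?powR_ge0// sumr_ge0// => j _; rewrite sumr_ge0.
rewrite /ftri -!big_split/= !big_distrr/=; apply: ler_sum => j _.
by rewrite -!big_split/= !big_distrr/=; apply: ler_sum => l _.
Qed.

(** If the largest weight is on [b] or [c], that factor pays s0 and is taken in l^2, while [a] keeps
    the weight r - s0, which is exactly what [hle_l1] places in l^1. *)
Lemma tle_hss r : 0 <= r <= s0 -> exists2 C : R, 0 < C &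
  forall a b c A B D, hle r a A -> hle s0 b B -> hle s0 c D ->
    tle r (nc3 a b c) (C * (A * B * D)).
Proof.
move=> hr; have [K K0 hK] := hle_l1 d0 hs0.
exists (9 `^ (r / 2) * (K * K + K * K + K * K)).
  by rewrite mulr_gt0 ?powR_gt0// !addr_gt0// mulr_gt0.
move=> a b c A B D ha hb hc.
have ha' := hK _ _ _ ha; have := hK _ _ _ hb; have := hK _ _ _ hc; rewrite subrr => hc' hb'.
have -> : 9 `^ (r / 2) * (K * K + K * K + K * K) * (A * B * D) =
  9 `^ (r / 2) * (A * (K * B * (K * D)) + K * A * (B * (K * D)) + K * A * (K * B * D)) by ring.
apply: (@tle_products _ _ _ (wn r a) (wn 0 b) (wn 0 c)
   (wn (r - s0) a) (wn s0 b) (wn 0 c) (wn (r - s0) a) (wn 0 b) (wn s0 c)).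
- exact: powR_ge0.
- exact: nc3_ge0.
- move=> k j l.
  have := out_weight (om_ge1 j) (om_ge1 l) (om_ge1 (j + l - k)) (om_out k j l) hr.
  move=> /(ler_wpM2r (nc3_ge0 a b c k j l)) /le_trans; apply.
  by rewrite /nc3 /wn mul0r !powRr0 le_eqVlt; apply/orP; left; apply/eqP; ring.
- by move=> J L uJ uL; apply: ftri_l211 => // k; exact: wn_ge0.
- by move=> J L uJ uL; apply: ftri_l121 => // k; exact: wn_ge0.
- by move=> J L uJ uL; apply: ftri_l112 => // k; exact: wn_ge0.
Qed.

Lemma tle_shs r : 0 <= r <= s0 -> exists2 C : R, 0 < C &
  forall a b c A B D, hle s0 a A -> hle r b B -> hle s0 c D ->
    tle r (nc3 a b c) (C * (A * B * D)).
Proof.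
move=> hr; have [C C0 hC] := tle_hss hr; exists C => // a b c A B D ha hb hc J L uJ uL.
have := hC b a c B A D hb ha hc L J uL uJ.
rewrite (_ : B * A * D = A * B * D); last by ring.
congr l2le; apply/funext => k; congr (_ * _); rewrite exchange_big/=.
by apply: eq_bigr => j _; apply: eq_bigr => l _; rewrite /nc3 [l + j]addrC [nc (b l) * _]mulrC.
Qed.

(** The conjugated factor is not interchangeable with the others, so the weight is split around its
    frequency j + l - k instead. *)
Lemma tle_ssh r : 0 <= r <= s0 -> exists2 C : R, 0 < C &
  forall a b c A B D, hle s0 a A -> hle s0 b B -> hle r c D ->
    tle r (nc3 a b c) (C * (A * B * D)).
Proof.
move=> hr; have [K K0 hK] := hle_l1 d0 hs0.
exists (9 `^ (r / 2) * (K * K + K * K + K * K)).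
  by rewrite mulr_gt0 ?powR_gt0// !addr_gt0// mulr_gt0.
move=> a b c A B D ha hb hc.
have hc' := hK _ _ _ hc; have := hK _ _ _ hb; have := hK _ _ _ ha; rewrite subrr => ha' hb'.
have -> : 9 `^ (r / 2) * (K * K + K * K + K * K) * (A * B * D) =
  9 `^ (r / 2) * (K * A * (K * B * D) + A * (K * B * (K * D)) + K * A * (B * (K * D))) by ring.
apply: (@tle_products _ _ _ (wn 0 a) (wn 0 b) (wn r c)
   (wn s0 a) (wn 0 b) (wn (r - s0) c) (wn 0 a) (wn s0 b) (wn (r - s0) c)).
- exact: powR_ge0.
- exact: nc3_ge0.
- move=> k j l.
  have /andP[p0 p1] := om_out k j l.
  have hp : 0 <= om k <= 3 * (om (j + l - k) + om j + om l) by rewrite p0/=; lra.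
  have := out_weight (om_ge1 (j + l - k)) (om_ge1 j) (om_ge1 l) hp hr.
  move=> /(ler_wpM2r (nc3_ge0 a b c k j l)) /le_trans; apply.
  by rewrite /nc3 /wn mul0r !powRr0 le_eqVlt; apply/orP; left; apply/eqP; ring.
- by move=> J L uJ uL; apply: ftri_l112 => // k; exact: wn_ge0.
- by move=> J L uJ uL; apply: ftri_l211 => // k; exact: wn_ge0.
- by move=> J L uJ uL; apply: ftri_l121 => // k; exact: wn_ge0.
Qed.

(* [phase k j l - 2 |m|^2] costs half a power of two of the three weights, and
   [|phase| ^ theta] a power theta of the largest one. *)
Definition kw (theta : R) k j l :=
  om j `^ (1 / 2) * om l `^ (1 / 2) * om (j + l - k) `^ (1 / 2) *
  Num.max (om j) (Num.max (om l) (om (j + l - k))) `^ theta.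

(** The largest of the three weights absorbs the output power r / 2, its own half power and theta,
    together at most (s0 + 1) / 2; the other two keep one derivative each. *)
Lemma max_weight (x y z p r theta : R) : 1 <= x -> 1 <= y -> 1 <= z ->
  0 <= p <= 3 * (x + y + z) -> 0 <= r -> 0 <= theta -> r + 2 * theta + 1 <= s0 + 1 ->
  p `^ (r / 2) * (x `^ (1 / 2) * y `^ (1 / 2) * z `^ (1 / 2) * Num.max x (Num.max y z) `^ theta) <=
  9 `^ (r / 2) * (x `^ ((s0 + 1) / 2) * y `^ (1 / 2) * z `^ (1 / 2) +
    x `^ (1 / 2) * y `^ ((s0 + 1) / 2) * z `^ (1 / 2) +
    x `^ (1 / 2) * y `^ (1 / 2) * z `^ ((s0 + 1) / 2)).
Proof.
move=> x1 y1 z1 /andP[p0 pb] r0 t0 hrt.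
have hm t : 1 <= t -> p <= 9 * t ->
    p `^ (r / 2) * (t `^ (1 / 2) * t `^ theta) <= 9 `^ (r / 2) * t `^ ((s0 + 1) / 2).
  move=> t1 pt.
  have tn0 : t != 0 by rewrite gt_eqF//; lra.
  apply: (@le_trans _ _ (9 `^ (r / 2) * t `^ (r / 2) * (t `^ (1 / 2) * t `^ theta))).
    rewrite ler_wpM2r ?mulr_ge0 ?powR_ge0// -powRM//; last by lra.
    by apply: ge0_ler_powR; rewrite ?nnegrE//; lra.
  rewrite -mulrA ler_wpM2l ?powR_ge0// -!powRD ?tn0 ?implybT// ler_powR//; lra.
have px : y <= x -> z <= x -> p <= 9 * x by move=> *; lra.
have py : x <= y -> z <= y -> p <= 9 * y by move=> *; lra.
have pz : x <= z -> y <= z -> p <= 9 * z by move=> *; lra.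
have X0 := powR_ge0 x (1 / 2).
have Y0 := powR_ge0 y (1 / 2).
have Z0 := powR_ge0 z (1 / 2).
have n0 := powR_ge0 9 (r / 2).
have X1 := powR_ge0 x ((s0 + 1) / 2).
have Y1 := powR_ge0 y ((s0 + 1) / 2).
have Z1 := powR_ge0 z ((s0 + 1) / 2).
have P1 := mulr_ge0 n0 (mulr_ge0 (mulr_ge0 X1 Y0) Z0).
have P2 := mulr_ge0 n0 (mulr_ge0 (mulr_ge0 X0 Y1) Z0).
have P3 := mulr_ge0 n0 (mulr_ge0 (mulr_ge0 X0 Y0) Z1).
rewrite !mulrDr.
have cx : p <= 9 * x -> p `^ (r / 2) * (x `^ (1 / 2) * y `^ (1 / 2) * z `^ (1 / 2) * x `^ theta) <=
    9 `^ (r / 2) * (x `^ ((s0 + 1) / 2) * y `^ (1 / 2) * z `^ (1 / 2)).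
  move=> /(hm x x1) /(ler_wpM2r (mulr_ge0 Y0 Z0)) h; apply: (eq_ler h); ring.
have cy : p <= 9 * y -> p `^ (r / 2) * (x `^ (1 / 2) * y `^ (1 / 2) * z `^ (1 / 2) * y `^ theta) <=
    9 `^ (r / 2) * (x `^ (1 / 2) * y `^ ((s0 + 1) / 2) * z `^ (1 / 2)).
  move=> /(hm y y1) /(ler_wpM2r (mulr_ge0 X0 Z0)) h; apply: (eq_ler h); ring.
have cz : p <= 9 * z -> p `^ (r / 2) * (x `^ (1 / 2) * y `^ (1 / 2) * z `^ (1 / 2) * z `^ theta) <=
    9 `^ (r / 2) * (x `^ (1 / 2) * y `^ (1 / 2) * z `^ ((s0 + 1) / 2)).
  move=> /(hm z z1) /(ler_wpM2r (mulr_ge0 X0 Y0)) h; apply: (eq_ler h); ring.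
have [yz|yz] := leP y z.
  have [xz|xz] := leP x z.
    by apply: le_trans (cz (pz xz yz)) _; rewrite lerDr addr_ge0.
  apply: le_trans (cx (px (ltW (le_lt_trans yz xz)) (ltW xz))) _.
  by rewrite -addrA lerDl addr_ge0.
have [xy|xy] := leP x y.
  by apply: le_trans (cy (py xy (ltW yz))) _; rewrite -addrA addrCA lerDl addr_ge0.
apply: le_trans (cx (px (ltW xy) (ltW (lt_trans yz xy)))) _.
by rewrite -addrA lerDl addr_ge0.
Qed.

(** The factor with the largest frequency uses its full regularity in l^2; the others spend one
    derivative, and the remaining s0 embeds them into l^1. *)
Lemma tle_kernel r theta : 0 <= r -> 0 <= theta -> r + 2 * theta + 1 <= s0 + 1 ->
  exists2 C : R, 0 < C &
  forall a b c A B D, hle (s0 + 1) a A -> hle (s0 + 1) b B -> hle (s0 + 1) c D ->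
    tle r (fun k j l => kw theta k j l * nc3 a b c k j l) (C * (A * B * D)).
Proof.
move=> r0 t0 hrt; have [K K0 hK] := hle_l1 d0 hs0.
exists (9 `^ (r / 2) * (K * K + K * K + K * K)).
  by rewrite mulr_gt0 ?powR_gt0// !addr_gt0// mulr_gt0.
move=> a b c A B D ha hb hc.
have := hK _ _ _ ha; have := hK _ _ _ hb; have := hK _ _ _ hc.
rewrite (_ : s0 + 1 - s0 = 1); last by lra.
move=> hc' hb' ha'.
have -> : 9 `^ (r / 2) * (K * K + K * K + K * K) * (A * B * D) =
  9 `^ (r / 2) * (A * (K * B * (K * D)) + K * A * (B * (K * D)) + K * A * (K * B * D)) by ring.
apply: (@tle_products _ _ _ (wn (s0 + 1) a) (wn 1 b) (wn 1 c)
   (wn 1 a) (wn (s0 + 1) b) (wn 1 c) (wn 1 a) (wn 1 b) (wn (s0 + 1) c)).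
- exact: powR_ge0.
- by move=> k j l; rewrite mulr_ge0 ?nc3_ge0// !mulr_ge0 ?powR_ge0.
- move=> k j l; rewrite mulrA.
  have := max_weight (om_ge1 j) (om_ge1 l) (om_ge1 (j + l - k)) (om_out k j l) r0 t0 hrt.
  move=> /(ler_wpM2r (nc3_ge0 a b c k j l)) /le_trans; apply.
  by rewrite /nc3 /wn le_eqVlt; apply/orP; left; apply/eqP; ring.
- by move=> J L uJ uL; apply: ftri_l211 => // k; exact: wn_ge0.
- by move=> J L uJ uL; apply: ftri_l121 => // k; exact: wn_ge0.
- by move=> J L uJ uL; apply: ftri_l112 => // k; exact: wn_ge0.
Qed.

End trilinear.

(** * The resonance function *)

Section phases.
Context {R : realType} {d : nat}.
Local Notation I := 'rV[int]_d.
Implicit Types (j k l m : I).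
Local Notation om := (@om R d).

(* Frequencies are written k = j + l - m, with m = j + l - k carried by the
   conjugated factor. *)
Definition phase k j l : R := freq_sq k - freq_sq j - freq_sq l + freq_sq (j + l - k).

Definition cross k j l : R :=
  2 * (dot j l - dot j (j + l - k) - dot l (j + l - k)).

Lemma phaseE k j l : phase k j l = 2 * freq_sq (j + l - k) + cross k j l.
Proof.
rewrite /phase /cross; set m := j + l - k.
have -> : k = j + l - m by rewrite /m opprB addrC subrK.
rewrite freq_sq_tri; ring.
Qed.

Lemma one_le_powR (x p : R) : 1 <= x -> 0 <= p -> 1 <= x `^ p.
Proof. by move=> x1 p0; rewrite -(powRr0 x) ler_powR. Qed.

(** Three inner products, each bounded by two of the weights; the missing third weight is at least
    1. *)
Lemma cross_le k j l : `|cross k j l| <=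
  6 * (om j `^ (1 / 2) * om l `^ (1 / 2) * om (j + l - k) `^ (1 / 2)).
Proof.
rewrite /cross; set m := j + l - k.
have := dot_le (R := R) j l; have := dot_le (R := R) j m; have := dot_le (R := R) l m.
have := one_le_powR (om_ge1 (R := R) j) (_ : 0 <= 1 / 2 :> R).
have := one_le_powR (om_ge1 (R := R) l) (_ : 0 <= 1 / 2 :> R).
have := one_le_powR (om_ge1 (R := R) m) (_ : 0 <= 1 / 2 :> R).
move: (om j `^ _) (om l `^ _) (om m `^ _) => x y z.
have h : 0 <= 1 / 2 :> R by [].
move=> /(_ h) z1 /(_ h) y1 /(_ h) x1 h1 h2 h3.
have e1 : x * y <= x * y * z by rewrite ler_peMr// mulr_ge0//; lra.
have e2 : x * z <= x * y * z by rewrite mulrAC ler_peMr// mulr_ge0//; lra.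
have e3 : y * z <= x * y * z by rewrite -mulrA ler_peMl// mulr_ge0//; lra.
move: h1 h2 h3; rewrite !ler_norml; lra.
Qed.

(** The last bound is for the sum of the exact and the replaced phase, which appears when a
    difference of cosines is written as a product of sines. *)
Lemma phase_max k j l : let M := Num.max (om j) (Num.max (om l) (om (j + l - k))) in
  [/\ 1 <= M, `|phase k j l| <= 12 * M & `|phase k j l + 2 * freq_sq (j + l - k)| <= 14 * M].
Proof.
set m := j + l - k; set M := Num.max _ _ => /=.
have mj : om j <= M by rewrite le_max lexx.
have ml : om l <= M by rewrite !le_max lexx orbT.
have mm : om m <= M by rewrite !le_max lexx !orbT.
have M1 : 1 <= M := le_trans (om_ge1 (R := R) j) mj.
have /andP[_ hk] := @om_out R d k j l; rewrite -/m in hk.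
have := @freq_sq_ge0 R _ j; have := @freq_sq_ge0 R _ k.
have := @freq_sq_ge0 R _ l; have := @freq_sq_ge0 R _ m.
move: mj ml mm hk; rewrite /phase -/m /om => *; split=> //; rewrite ler_norml; lra.
Qed.

Lemma kw_ge k j l (theta : R) : 0 <= theta ->
  Num.max (om j) (Num.max (om l) (om (j + l - k))) `^ theta <= kw theta k j l.
Proof.
move=> t0; rewrite /kw ler_peMl ?powR_ge0//.
have h : 0 <= 1 / 2 :> R by [].
have x1 := one_le_powR (om_ge1 (R := R) j) h.
have y1 := one_le_powR (om_ge1 (R := R) l) h.
have z1 := one_le_powR (om_ge1 (R := R) (j + l - k)) h.
by rewrite mulr_ege1// mulr_ege1.
Qed.

Lemma kw_ge0 k j l (theta : R) : 0 <= kw theta k j l.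
Proof. by rewrite !mulr_ge0 ?powR_ge0. Qed.

Lemma powR_le_lin (x theta : R) : 1 <= x -> 0 <= theta <= 1 -> x `^ theta <= x.
Proof. by move=> x1 /andP[_ t1]; exact: ler1_powR. Qed.

Lemma sin_phase (s theta : R) k j l : 0 <= s -> 0 <= theta <= 1 ->
  `|sin (s * phase k j l)| <= 12 * s `^ theta * kw theta k j l.
Proof.
move=> s0 ht; have /andP[t0 t1] := ht; have [M1 h1 _] := phase_max k j l.
apply: le_trans (abs_sin_powR _ ht) _.
rewrite normrM (ger0_norm s0) powRM// -mulrA mulrCA ler_wpM2l ?powR_ge0//.
apply: (@le_trans _ _ (12 * Num.max (om j) (Num.max (om l) (om (j + l - k))) `^ theta)).
  apply: (@le_trans _ _ ((12 * Num.max (om j) (Num.max (om l) (om (j + l - k)))) `^ theta)).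
    by apply: ge0_ler_powR; rewrite ?nnegrE ?normr_ge0//; lra.
  by rewrite powRM//; [rewrite ler_wpM2r ?powR_ge0// powR_le_lin//; lra|lra].
by rewrite ler_wpM2l// kw_ge.
Qed.

Lemma eix_phase (s theta : R) k j l : 0 <= s -> 0 <= theta <= 1 ->
  nc (eix (s * phase k j l) - eix (- (s * phase k j l))) <= 24 * s `^ theta * kw theta k j l.
Proof.
move=> s0 ht; rewrite eix_subN ncM nci mulr1 ncR normrM ger0_norm//.
have := sin_phase k j l s0 ht; lra.
Qed.

(** In the product formula the difference of the phases is [cross], which gives a full power of s
    for one derivative per factor; the sum of the phases is interpolated and gives s^theta. *)
Lemma cos_phase (s theta : R) k j l : 0 <= s -> 0 <= theta <= 1 ->
  `|cos (s * phase k j l) - cos (s * (2 * freq_sq (j + l - k)))| <=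
  84 * s `^ (1 + theta) * kw theta k j l.
Proof.
move=> s0 ht; have /andP[t0 t1] := ht; have [M1 _ h2] := phase_max k j l.
rewrite cosB_prod normrN !normrM (ger0_norm (_ : 0 <= 2))//.
have -> : (s * phase k j l - s * (2 * freq_sq (j + l - k))) / 2 = s * cross k j l / 2.
  by rewrite phaseE; lra.
rewrite -mulrDr.
set P := phase k j l + _ in h2 *.
have a1 : `|sin (s * cross k j l / 2)| <= s * (3 * (om j `^ (1 / 2) * om l `^ (1 / 2) * om (j + l - k) `^ (1 / 2))).
  apply: le_trans (abs_sin_le _) _; rewrite -mulrA normrM (ger0_norm s0) ler_wpM2l// normrM.
  by rewrite [`|2^-1|]ger0_norm//; have := cross_le k j l; lra.
have a2 : `|sin (s * P / 2)| <= s `^ theta * (14 * Num.max (om j) (Num.max (om l) (om (j + l - k))) `^ theta).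
  apply: le_trans (abs_sin_powR _ ht) _.
  rewrite -mulrA normrM (ger0_norm s0) powRM// ler_wpM2l ?powR_ge0//.
  apply: (@le_trans _ _ ((14 * Num.max (om j) (Num.max (om l) (om (j + l - k)))) `^ theta)).
    apply: ge0_ler_powR; rewrite ?nnegrE ?normr_ge0//; first by lra.
    rewrite normrM [`|2^-1|]ger0_norm//; have := normr_ge0 P; lra.
  by rewrite powRM//; [rewrite ler_wpM2r ?powR_ge0// powR_le_lin//; lra|lra].
have [->|sn0] := eqVneq s 0.
  by rewrite !mul0r sin0 normr0 mulr0 mulr_ge0 ?kw_ge0// mulr_ge0 ?powR_ge0.
rewrite powRD ?sn0 ?implybT// powRr1// /kw.
have := ler_pM (normr_ge0 _) (normr_ge0 _) a2 a1; lra.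
Qed.

(** For exponentials the sum of the phases enters only through a unimodular factor, so the gain
    stops at one power of s. This is the bound behind the one-sided first step. *)
Lemma eix_phase2 (s : R) k j l : 0 <= s ->
  nc (eix (s * phase k j l) - eix (s * (2 * freq_sq (j + l - k)))) <= 6 * s * kw 0 k j l.
Proof.
move=> s0; rewrite eixB ncM nc_eix mul1r ncM nci mulr1 ncR normrM (ger0_norm (_ : 0 <= 2))//.
have -> : (s * phase k j l - s * (2 * freq_sq (j + l - k))) / 2 = s * cross k j l / 2.
  by rewrite phaseE; lra.
apply: (@le_trans _ _ (2 * (s * (`|cross k j l| / 2)))).
  rewrite ler_wpM2l//; apply: le_trans (abs_sin_le _) _.
  by rewrite -mulrA normrM (ger0_norm s0) normrM [`|2^-1|]ger0_norm.
have := ler_wpM2l s0 (cross_le k j l); rewrite /kw powRr0 mulr1; lra.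
Qed.

End phases.

(** * Derivatives of complex-valued and coefficient-valued functions *)

Section cderive.
Context {R : realType}.
Implicit Types (f g : R -> R[i]) (t s c : R) (z w : R[i]).

Lemma is_cderive_cst z t : is_cderive (fun=> z) t 0.
Proof. by split; exact: is_derive_cst. Qed.

Lemma is_cderive_eq f t z w : is_cderive f t z -> z = w -> is_cderive f t w.
Proof. by move=> h <-. Qed.

Lemma is_cderiveD f g t z w : is_cderive f t z -> is_cderive g t w ->
  is_cderive (fun s => f s + g s) t (z + w).
Proof.
move=> [h1 h2] [h3 h4]; split; rewrite complexRIE.
  by under eq_fun do rewrite cReD; exact: is_deriveD.
by under eq_fun do rewrite cImD; exact: is_deriveD.
Qed.

Lemma is_cderiveM f g t z w : is_cderive f t z -> is_cderive g t w ->
  is_cderive (fun s => f s * g s) t (z * g t + f t * w).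
Proof.
move=> [h1 h2] [h3 h4]; split.
  under eq_fun do rewrite cReM.
  apply: (is_derive_eq (is_deriveB (is_deriveM h1 h3) (is_deriveM h2 h4))).
  by rewrite !complexRIE /GRing.scale/=; ring.
under eq_fun do rewrite cImM.
apply: (is_derive_eq (is_deriveD (is_deriveM h1 h4) (is_deriveM h2 h3))).
by rewrite !complexRIE /GRing.scale/=; ring.
Qed.

Lemma is_cderiveZ w f t z : is_cderive f t z -> is_cderive (fun s => w * f s) t (w * z).
Proof.
by move=> h; have := is_cderiveM (is_cderive_cst w t) h; rewrite mul0r add0r.
Qed.

Lemma is_cderive_affine f (a b t : R) z : is_cderive f (a + b * t) z ->
  is_cderive (fun s => f (a + b * s)) t (b%:C * z).
Proof.
have dab : is_derive t (1 : R) (fun s => a + b * s) b.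
  apply: (is_derive_eq (is_deriveD (is_derive_cst a t 1) (is_deriveZ b (is_derive_id t 1)))).
  by rewrite add0r /GRing.scale/= mulr1.
move=> [h1 h2]; split.
  have h := @is_derive1_comp R (fun s => Re (f s)) (fun s => a + b * s) t _ _ h1 dab.
  refine (is_derive_eq h _).
  by rewrite !complexRIE /GRing.scale/=; ring.
have h := @is_derive1_comp R (fun s => Im (f s)) (fun s => a + b * s) t _ _ h2 dab.
refine (is_derive_eq h _).
by rewrite !complexRIE /GRing.scale/=; ring.
Qed.

Lemma is_cderive_eix_id t : is_cderive eix t ('i * eix t).
Proof.
split; rewrite !complexRIE !(mul0r, mul1r, sub0r, add0r); [exact: is_derive_cos|exact: is_derive_sin].
Qed.

Lemma is_cderive_eix c t : is_cderive (fun s => eix (s * c)) t ('i * c%:C * eix (t * c)).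
Proof.
have := @is_cderive_affine eix 0 c t ('i * eix (0 + c * t)) (is_cderive_eix_id _).
rewrite add0r mulrA [c%:C * _]mulrC [c * t]mulrC.
by under eq_fun do rewrite add0r mulrC.
Qed.

Lemma is_cderive_real (f : R -> R) t (x : R) : is_derive t (1 : R) f x -> is_cderive (fun s => (f s)%:C) t x%:C.
Proof. by move=> h; split => //=; exact: is_derive_cst. Qed.

Lemma continuous_withinP (f : R -> R) (a b : R) :
  {within `[a, b], continuous f} <->
  forall x, a <= x <= b -> forall e, 0 < e -> exists2 dl, 0 < dl &
    forall y, a <= y <= b -> `|x - y| < dl -> `|f x - f y| <= e.
Proof.
split=> [cf x xab e e0|h].
  have /subspace_continuousP /(_ x) := cf; rewrite /= in_itv/= => /(_ xab).
  move=> /cvgrPdist_le /(_ _ e0) H.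
  have /nbhs_ballP[dl /= dl0 hd] : nbhs x [set y | y \in `[a, b] -> `|f x - f y| <= e] by exact: H.
  exists dl => // y yab xy.
  by apply: (hd y xy); rewrite /= in_itv.
apply/subspace_continuousP => x; rewrite /= in_itv/= => xab.
apply/cvgrPdist_le => e e0; have [dl dl0 hd] := h x xab e e0.
suff : nbhs x [set y | y \in `[a, b] -> `|f x - f y| <= e] by [].
apply/nbhs_ballP; exists dl => // y xy.
rewrite /= in_itv/= => yab; exact: hd.
Qed.

Lemma within_sum (T : Type) (A : set R) (K : seq T) (F : T -> R -> R) :
  (forall k, {within A, continuous (F k)}) ->
  {within A, continuous (fun s => \sum_(k <- K) F k s)}.
Proof.
move=> h; elim: K => [|k K ih].
  rewrite (_ : (fun s => _) = (fun=> 0)); first by move=> x; exact: cvg_cst.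
  by apply/funext => s; rewrite big_nil.
rewrite (_ : (fun s => _) = (fun s => F k s + \sum_(k <- K) F k s)).
  by move=> x; apply: cvgD; [exact: h|exact: ih].
by apply/funext => s; rewrite big_cons.
Qed.

Lemma within_affine (f : R -> R) (a b a' b' p q : R) :
  {within `[a', b'], continuous f} ->
  (forall x, a <= x <= b -> a' <= p + q * x <= b') ->
  {within `[a, b], continuous (fun x => f (p + q * x))}.
Proof.
move=> /continuous_withinP cf h; apply/continuous_withinP => x xab e e0.
have [dl dl0 hd] := cf _ (h x xab) e e0.
exists (dl / (`|q| + 1)); first by rewrite divr_gt0// ltr_wpDl.
move=> y yab xy; apply: hd; first exact: h.
rewrite (_ : p + q * x - (p + q * y) = q * (x - y)); last by ring.
rewrite normrM; move: xy; rewrite ltr_pdivlMr ?ltr_wpDl//.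
have := normr_ge0 (x - y); lra.
Qed.

Lemma ccw_affine f (a b a' b' p q : R) :
  ccontinuous_within `[a', b'] f -> (forall x, a <= x <= b -> a' <= p + q * x <= b') ->
  ccontinuous_within `[a, b] (fun x => f (p + q * x)).
Proof.
move=> [h1 h2] h; split.
  exact: (within_affine (f := fun x => Re (f x)) h1 h).
exact: (within_affine (f := fun x => Im (f x)) h2 h).
Qed.

Lemma ccwD A f g : ccontinuous_within A f -> ccontinuous_within A g ->
  ccontinuous_within A (fun s => f s + g s).
Proof.
move=> [h1 h2] [h3 h4]; split.
  by under eq_fun do rewrite cReD; move=> x; apply: cvgD; [exact: h1|exact: h3].
by under eq_fun do rewrite cImD; move=> x; apply: cvgD; [exact: h2|exact: h4].
Qed.

Lemma ccwM A f g : ccontinuous_within A f -> ccontinuous_within A g ->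
  ccontinuous_within A (fun s => f s * g s).
Proof.
move=> [h1 h2] [h3 h4]; split.
  by under eq_fun do rewrite cReM; move=> x; apply: cvgB; apply: cvgM; [exact: h1|exact: h3|exact: h2|exact: h4].
by under eq_fun do rewrite cImM; move=> x; apply: cvgD; apply: cvgM; [exact: h1|exact: h4|exact: h2|exact: h3].
Qed.

Lemma ccw_derivable (A : set R) f f' : (forall t, is_cderive f t (f' t)) -> ccontinuous_within A f.
Proof.
move=> h; split; apply: continuous_subspaceT => x; have [h1 h2] := h x;
  by apply/differentiable_continuous/derivable1_diffP; exact: ex_derive.
Qed.

Lemma ccw_cst (A : set R) z : ccontinuous_within A (fun=> z).
Proof. by apply: (@ccw_derivable _ _ (fun=> 0)) => t; exact: is_cderive_cst. Qed.

Lemma ccw_eix (A : set R) c : ccontinuous_within A (fun s => eix (s * c)).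
Proof. exact: (@ccw_derivable _ _ (fun t => 'i * c%:C * eix (t * c)) (is_cderive_eix c)). Qed.

End cderive.

(** * Mean value inequality in weighted l^2 *)

Section vector_mvt.
Context {R : realType} {d : nat}.
Local Notation I := 'rV[int]_d.

(* Pairing the increment with itself reduces the vector-valued mean value
   inequality to the scalar mean value theorem. *)
Lemma hle_mvt (r : R) (g g' : I -> R -> R[i]) (tau B : R) : 0 <= tau -> 0 <= B ->
  (forall k, ccontinuous_within `[0, tau] (g k)) ->
  (forall k s, 0 < s < tau -> is_cderive (g k) s (g' k s)) ->
  (forall s, 0 < s < tau -> hle r (g'^~ s) B) ->
  hle r (fun k => g k tau - g k 0) (tau * B).
Proof.
move=> t0 B0 cg dg hg'.
have [te|tn0] := eqVneq tau 0.
  split=> [|K uK]; first by rewrite te mul0r.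
  by rewrite te mul0r expr0n/= big1// => k _; rewrite subrr nc0 mulr0 expr0n.
have tp : 0 < tau by rewrite lt_def tn0.
split=> [|K uK]; first exact: mulr_ge0.
pose W k := g k tau - g k 0; pose u (k : I) := (om k `^ (r / 2)) ^+ 2 : R.
pose G s := \sum_(k <- K) u k * (Re (W k) * Re (g k s) + Im (W k) * Im (g k s)).
pose G' s := \sum_(k <- K) u k * (Re (W k) * Re (g' k s) + Im (W k) * Im (g' k s)).
have dG s : s \in `]0, tau[ -> is_derive s (1 : R) G (G' s).
  rewrite in_itv/= => hs; rewrite /G /G'; elim: K {uK G G'} => [|k K ih].
    by under eq_fun do rewrite big_nil; rewrite big_nil; exact: is_derive_cst.
  under eq_fun do rewrite big_cons; rewrite big_cons; apply: is_deriveD => //.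
  have [h1 h2] := dg k s hs.
  by apply: is_deriveZ; apply: is_deriveD; apply: is_deriveZ.
have cG : {within `[0, tau], continuous G}.
  apply: within_sum => k; have [h1 h2] := cg k => x.
  by apply: cvgMr; apply: cvgD; apply: cvgMr; [exact: h1|exact: h2].
have [c hc e] := MVT tp dG cG.
set S := \sum_(k <- K) _.
have S0 : 0 <= S by apply: sumr_ge0 => k _; rewrite sqr_ge0.
have eS : S = tau * G' c.
  move: e; rewrite subr0 [RHS]mulrC => <-; rewrite /G -sumrB; apply: eq_bigr => k _.
  by rewrite exprMn nc_sqr -/(W k) -/(u k) /W !complexRIE; ring.
have hG' : G' c ^+ 2 <= S * B ^+ 2.
  rewrite in_itv/= in hc; have [_ /(_ K uK)] := hg' c hc.
  set S' := \sum_(k <- K) _ => hS'.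
  apply: (@le_trans _ _ (S * S')); last by rewrite ler_wpM2l.
  apply: le_trans (sum_CS K (fun k => om k `^ (r / 2) * nc (W k)) (fun k => om k `^ (r / 2) * nc (g' k c))).
  have N0 k : 0 <= om k `^ (r / 2) * nc (W k) * (om k `^ (r / 2) * nc (g' k c)).
    by rewrite !mulr_ge0 ?powR_ge0 ?nc_ge0.
  have hh : `|G' c| <= \sum_(j <- K) om j `^ (r / 2) * nc (W j) * (om j `^ (r / 2) * nc (g' j c)).
    apply: le_trans (ler_norm_sum _ _ _) _; apply: ler_sum => k _.
    rewrite normrM ger0_norm ?sqr_ge0// [leRHS](_ : _ = u k * (nc (W k) * nc (g' k c))); last by rewrite /u; ring.
    rewrite ler_wpM2l ?sqr_ge0//.
    have := normRe_le (conjc (W k) * g' k c); rewrite !complexRIE ncM ncJ.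
    by rewrite mulNr opprK.
  rewrite -[leLHS]real_normK ?num_real// lerXn2r ?nnegrE// sumr_ge0//.
(* Since S = tau G'(c), Cauchy-Schwarz bounds S^2 by tau^2 S B^2, and one factor S is then divided
   out. *)
have : S ^+ 2 <= S * (tau * B) ^+ 2.
  by have := ler_wpM2l (sqr_ge0 tau) hG'; rewrite {2}eS !exprMn; lra.
have [->|Sn0] := eqVneq S 0; first by rewrite sqr_ge0.
by rewrite expr2 ler_pM2l// lt_def Sn0.
Qed.

End vector_mvt.

(** * Telescoping of cubic products *)

Section cubic.
Context {R : realType}.
Implicit Types (z : R[i]).

Lemma ncD_le (z w : R[i]) (x y : R) : nc z <= x -> nc w <= y -> nc (z + w) <= x + y.
Proof. by move=> h1 h2; apply: le_trans (ncD _ _) _; exact: lerD. Qed.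

Lemma cubic_diff_bound (E E' p1 p2 p3 q1 q2 q3 : R[i]) : nc E' = 1 ->
  nc (E * (p1 * (p2 * p3)) - E' * (q1 * (q2 * q3))) <=
  nc (E - E') * (nc p1 * nc p2 * nc p3) + nc (p1 - q1) * nc p2 * nc p3
    + nc q1 * nc (p2 - q2) * nc p3 + nc q1 * nc q2 * nc (p3 - q3).
Proof.
move=> e1.
have -> : E * (p1 * (p2 * p3)) - E' * (q1 * (q2 * q3)) =
  (E - E') * (p1 * p2 * p3) + E' * ((p1 - q1) * p2 * p3) + E' * (q1 * (p2 - q2) * p3)
  + E' * (q1 * q2 * (p3 - q3)) by ring.
by do 3 (apply: ncD_le; last by rewrite !ncM ?e1 ?mul1r); rewrite !ncM.
Qed.

(** Algebraic core of the time symmetry: every term contains [E + E' - c], a second difference, two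
    first differences, or [E - E'] together with a first difference, so no first-order term stands
    alone. *)
Lemma cubic_sym_bound (E E' c p1 p2 p3 q1 q2 q3 o1 o2 o3 : R[i]) : nc E' = 1 ->
  nc (E * (p1 * (p2 * p3)) + E' * (q1 * (q2 * q3)) - c * (o1 * (o2 * o3))) <=
  nc (E + E' - c) * (nc o1 * nc o2 * nc o3)
  + nc (E - E') * (nc (p1 - o1) * nc p2 * nc p3)
  + nc (E - E') * (nc o1 * nc (p2 - o2) * nc p3)
  + nc (E - E') * (nc o1 * nc o2 * nc (p3 - o3))
  + nc (p1 - o1) * nc (p2 - q2) * nc p3 + nc (p1 - o1) * nc q2 * nc (p3 - q3)
  + nc o1 * nc (p2 - o2) * nc (p3 - q3)
  + nc (p1 + q1 - 2 * o1) * nc q2 * nc q3 + nc o1 * nc (p2 + q2 - 2 * o2) * nc q3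
  + nc o1 * nc o2 * nc (p3 + q3 - 2 * o3).
Proof.
move=> e1.
have -> : E * (p1 * (p2 * p3)) + E' * (q1 * (q2 * q3)) - c * (o1 * (o2 * o3)) =
  (E + E' - c) * (o1 * o2 * o3)
  + (E - E') * ((p1 - o1) * p2 * p3) + (E - E') * (o1 * (p2 - o2) * p3)
  + (E - E') * (o1 * o2 * (p3 - o3))
  + E' * ((p1 - o1) * (p2 - q2) * p3) + E' * ((p1 - o1) * q2 * (p3 - q3))
  + E' * (o1 * (p2 - o2) * (p3 - q3))
  + E' * ((p1 + q1 - 2 * o1) * q2 * q3) + E' * (o1 * (p2 + q2 - 2 * o2) * q3)
  + E' * (o1 * o2 * (p3 + q3 - 2 * o3)) by ring.
by do 9 (apply: ncD_le; last by rewrite !ncM ?e1 ?mul1r); rewrite !ncM.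
Qed.

End cubic.

(** * Cubic sums with a frequency kernel *)

Section tri.
Context {R : realType} {d : nat}.
Local Notation I := 'rV[int]_d.
Implicit Types (a b c : I -> R[i]) (j k l m : I) (kap : I -> I -> I -> R[i]).

(** With kernel 1 the sum [tri] gives the coefficients of a b conj(c); the twisted exact flow has
    the kernel [rot], the scheme the kernels [psiK] and [psi1K]. *)
Definition triX kap a b c k j l := kap k j l * (a j * (b l * conjc (c (j + l - k)))).

Definition tri kap a b c k := csum2 (triX kap a b c k).

Lemma nc_triX kap a b c k j l : nc (triX kap a b c k j l) = nc (kap k j l) * nc3 a b c k j l.
Proof. by rewrite !ncM ncJ /nc3 mulrA [in LHS]mulrA !mulrA. Qed.

Lemma csummable2_triX kap C a b c k : (forall k j l, nc (kap k j l) <= C) ->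
  csummable a -> csummable b -> csummable c -> csummable2 (triX kap a b c k).
Proof.
move=> hk [A hA] [B hB] [D hD].
apply: (@csummable2M _ _ (fun j l => kap k j l) C) => //.
exists (A * (B * D)); split=> [|J L uJ uL].
  by rewrite mulr_ge0 ?mulr_ge0//; [case: hA|case: hB|case: hD].
have := @ftri_le_l1 R I J L (fun j => nc (a j)) (fun j => nc (b j)) (fun j => nc (c j)) A B D
  uJ uL (fun j => nc_ge0 (a j)) (fun j => nc_ge0 (b j)) k hA hB hD.
apply: le_trans; apply: ler_sum => j _; apply: ler_sum => l _.
by rewrite !ncM ncJ mulrA.
Qed.

Variable s0 : R.
Hypotheses (d0 : (0 < d)%N) (hs0 : d%:R / 2 < s0).
Local Notation sigma := (s0 + 1).

(** One constant for all estimates at the pair (r, theta), so that the same argument can be run in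
    H^{s0} and in H^1. In the first three names the letter h marks the factor bounded only in H^r,
    where the error will sit. *)
Record tri_consts (r theta K : R) : Prop := TriConsts {
  tc_hss : forall a b c A B D, hle r a A -> hle s0 b B -> hle s0 c D ->
    tle r (nc3 a b c) (K * (A * B * D));
  tc_shs : forall a b c A B D, hle s0 a A -> hle r b B -> hle s0 c D ->
    tle r (nc3 a b c) (K * (A * B * D));
  tc_ssh : forall a b c A B D, hle s0 a A -> hle s0 b B -> hle r c D ->
    tle r (nc3 a b c) (K * (A * B * D));
  tc_ker : forall a b c A B D, hle sigma a A -> hle sigma b B -> hle sigma c D ->
    tle r (fun k j l => kw theta k j l * nc3 a b c k j l) (K * (A * B * D));
  tc_alg : forall a b c A B D, hle sigma a A -> hle sigma b B -> hle sigma c D ->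
    tle sigma (nc3 a b c) (K * (A * B * D));
  tc_sss : forall a b c A B D, hle sigma a A -> hle sigma b B -> hle sigma c D ->
    tle r (nc3 a b c) (K * (A * B * D)) }.

Lemma hle_ge0 r a A : hle r a A -> 0 <= A. Proof. by case. Qed.

Lemma tri_consts_ex r theta : 0 <= r <= s0 -> 0 <= theta -> r + 2 * theta <= s0 ->
  exists2 K : R, 0 < K & tri_consts r theta K.
Proof.
move=> hr t0 hrt; have s00 := s0_ge0 hs0.
have [K1 K10 h1] := tle_hss d0 hs0 hr.
have [K2 K20 h2] := tle_shs d0 hs0 hr.
have [K3 K30 h3] := tle_ssh d0 hs0 hr.
have hr' : 0 <= r by case/andP: hr.
have [|K4 K40 h4] := @tle_kernel _ _ _ d0 hs0 r theta hr' t0; first by lra.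
have hs1 : d%:R / 2 < sigma by move: hs0; lra.
(* The algebra property of H^sigma is the product estimate with sigma in place of both r and s0. *)
have [|K5 K50 h5] := @tle_hss _ _ _ d0 hs1 sigma; first by rewrite lexx andbT; lra.
have mono A B D (x y : R) : 0 <= A -> 0 <= B -> 0 <= D -> x <= y -> x * (A * B * D) <= y * (A * B * D).
  by move=> A0 B0 D0 xy; rewrite ler_wpM2r// !mulr_ge0.
exists (K1 + K2 + K3 + K4 + K5); first by rewrite !addr_gt0.
split=> a b c A B D ha hb hc; have A0 := hle_ge0 ha; have B0 := hle_ge0 hb; have D0 := hle_ge0 hc.
- by apply: tle_mono (h1 _ _ _ _ _ _ ha hb hc); apply: mono => //; lra.
- by apply: tle_mono (h2 _ _ _ _ _ _ ha hb hc); apply: mono => //; lra.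
- by apply: tle_mono (h3 _ _ _ _ _ _ ha hb hc); apply: mono => //; lra.
- by apply: tle_mono (h4 _ _ _ _ _ _ ha hb hc); apply: mono => //; lra.
- by apply: tle_mono (h5 _ _ _ _ _ _ ha hb hc); apply: mono => //; lra.
- have hss : s0 <= sigma by lra.
  have hrs : r <= sigma by case/andP: hr; lra.
  apply: tle_mono (h1 _ _ _ _ _ _ (hle_mono hrs ha) (hle_mono hss hb) (hle_mono hss hc)).
  by apply: mono => //; lra.
Qed.

End tri.

(** * Local error *)

Section filter_functions.
Context {R : realType} {d : nat}.
Local Notation I := 'rV[int]_d.
Implicit Types (s c : R).

(* tau * phi_s(2 tau Delta), with c = 2 |m|^2; the integral of cos (x * c) over [0, s]. *)
Definition psi s c : R := if c == 0 then s else sin (s * c) / c.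

(* tau * phi_1(-2 i tau Delta), with c = 2 |m|^2; the integral of eix (x * c) over [0, s]. *)
Definition psi1 s c : R[i] := if c == 0 then s%:C else (eix (s * c) - 1) / ('i * c%:C).

Lemma psi0 c : psi 0 c = 0.
Proof. by rewrite /psi mul0r sin0 mul0r; case: eqP. Qed.

Lemma psi10 c : psi1 0 c = 0.
Proof. by rewrite /psi1 mul0r eix0 subrr mul0r; case: eqP. Qed.

Lemma is_derive_psi s c : is_derive s (1 : R) (psi^~ c) (cos (s * c)).
Proof.
rewrite /psi; have [e0|c0] := eqVneq c 0.
  by rewrite e0 mulr0 cos0; exact: is_derive_id.
have [_ h] := is_cderive_eix c s.
have h2 := is_deriveZ c^-1 h.
under eq_fun do rewrite mulrC.
refine (is_derive_eq h2 _).
by rewrite !complexRIE /eix /= /GRing.scale/=; field.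
Qed.

Lemma is_cderive_psi1 s c : is_cderive (psi1^~ c) s (eix (s * c)).
Proof.
rewrite /psi1; have [e0|c0] := eqVneq c 0.
  by rewrite e0 mulr0 eix0; apply: is_cderive_real; exact: is_derive_id.
have cc : c%:C != 0 :> R[i] by apply/eqP => -[] /eqP; rewrite (negbTE c0).
have i0 : 'i != 0 :> R[i] by exact: neq0Ci.
have := is_cderiveZ ('i * c%:C)^-1 (is_cderiveD (is_cderive_eix c s) (is_cderive_cst (-1) s)).
rewrite addr0 mulrA mulVf ?mul1r ?mulf_neq0//.
by under eq_fun do rewrite mulrC.
Qed.

Lemma nc_cos_le1 x : nc (cos x)%:C <= 1 :> R.
Proof. by rewrite ncR ler_norml cos_geN1 cos_le1. Qed.

Lemma nc_eix_le1 (x : R) : nc (eix x) <= 1.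
Proof. by rewrite nc_eix. Qed.

Lemma nc_psi_le s c : nc (psi s c)%:C <= `|s|.
Proof.
rewrite /psi; have [e0|c0] := eqVneq c 0; first by rewrite ncR.
rewrite ncR.
rewrite normrM normfV ler_pdivrMr ?normr_gt0//.
by apply: le_trans (abs_sin_le _) _; rewrite normrM.
Qed.

Lemma nc_psi1_le s c : nc (psi1 s c) <= `|s|.
Proof.
rewrite /psi1; have [e0|c0] := eqVneq c 0; first by rewrite ncR.
rewrite ncM ComplexField.Normc.normcV ncM nci mul1r ncR ler_pdivrMr ?normr_gt0//.
rewrite -eix0 eixB addr0 subr0 ncM nc_eix mul1r ncM nci mulr1 ncR normrM ger0_norm//.
have := abs_sin_le (s * c / 2); rewrite !normrM [`|2^-1|]ger0_norm//; lra.
Qed.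

Lemma tri_cderive (f f' : R -> R -> R[i]) (a b e : I -> R[i]) k s :
  (forall t c, is_cderive (f^~ c) t (f' t c)) -> (forall t c, nc (f' t c) <= 1) ->
  (forall t c, nc (f t c) <= `|t|) -> csummable a -> csummable b -> csummable e ->
  is_cderive (fun t => tri (fun k j l => f t (2 * freq_sq (j + l - k))) a b e k) s
    (tri (fun k j l => f' s (2 * freq_sq (j + l - k))) a b e k).
Proof.
move=> df bf' bf sa sb se.
apply: (@is_cderive_csum2 R d (fun j l t => triX (fun k j l => f t (2 * freq_sq (j + l - k))) a b e k j l)
  (fun j l t => triX (fun k j l => f' t (2 * freq_sq (j + l - k))) a b e k j l)
  (fun j l => triX (fun _ _ _ => 1) a b e k j l)).
- move=> j l t; rewrite /triX.
  have := is_cderiveM (df t (2 * freq_sq (j + l - k))) (is_cderive_cst (a j * (b l * conjc (e (j + l - k)))) t).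
  by rewrite mulr0 addr0.
- by move=> j l t; rewrite !nc_triX nc1 mul1r ler_piMl ?nc3_ge0.
- by apply: (@csummable2_triX _ _ _ 1) => // *; rewrite nc1.
- by move=> t; apply: (@csummable2_triX _ _ _ `|t|).
Qed.

Lemma tri0 (kap : I -> I -> I -> R[i]) (a b e : I -> R[i]) k :
  (forall k j l, kap k j l = 0) -> tri kap a b e k = 0.
Proof.
move=> h; have z : freq_sum (fun=> 0 : R[i]) = 0 :> R[i].
  move=> d'; apply: freq_sum_unique; rewrite (_ : cubesum _ = fun=> 0).
    by split; exact: cvg_cst.
  by apply/funext => N; rewrite /cubesum big1.
rewrite /tri /csum2 (_ : (fun j => _) = (fun=> 0)) ?z//.
apply/funext => j; rewrite (_ : (fun l => _) = (fun=> 0)) ?z//.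
by apply/funext => l; rewrite /triX h mul0r.
Qed.

End filter_functions.

Section local_error.
Context {R : realType} {d : nat}.
Local Notation I := 'rV[int]_d.
Implicit Types (j k l m : I).
Variables (s0 mu T M : R).
Hypotheses (d0 : (0 < d)%N) (hs0 : d%:R / 2 < s0).
Local Notation sigma := (s0 + 1).

Definition nls_coef (w : R -> I -> R[i]) := [/\
  forall t, 0 <= t <= T -> hle sigma (w t) M,
  forall k, ccontinuous_within `[0, T] (fun t => w t k) &
  forall t k, 0 < t < T -> is_cderive (fun s => w s k) t
    (- 'i * ((freq_sq k)%:C * w t k + mu%:C * tri (fun _ _ _ => 1) (w t) (w t) (w t) k))].

(* The interaction picture around the time t0, run forwards (e = 1) or
   backwards (e = -1). *)
Definition twist (w : R -> I -> R[i]) (t0 e s : R) k : R[i] :=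
  eix (s * (e * freq_sq k)) * w (t0 + e * s) k.

Definition rot (x : R) k j l : R[i] := eix (x * phase k j l).

Lemma twist0 w t0 e k : twist w t0 e 0 k = w t0 k.
Proof. by rewrite /twist mul0r eix0 mul1r mulr0 addr0. Qed.

Lemma hle_sigma_csummable (a : I -> R[i]) A : hle sigma a A -> csummable a.
Proof. by apply: hle_csummable => //; move: hs0; lra. Qed.

Section one_solution.
Variables (w : R -> I -> R[i]) (t0 : R).
Hypotheses (hw : nls_coef w) (ht0 : 0 <= t0 <= T).

Lemma twist_hle e s : 0 <= t0 + e * s <= T -> hle sigma (twist w t0 e s) M.
Proof.
move=> h; have [h1 _ _] := hw; apply: hle_nc (h1 _ h) => k.
by rewrite ncM nc_eix mul1r.
Qed.

(** Differentiating the twisting phase cancels the Laplacian. In the cubic term |k|^2 equals [phase]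
    plus |j|^2 + |l|^2 - |m|^2, so each factor receives its own twist and only [rot] remains. *)
Lemma twist_cderive e s k : 0 < t0 + e * s < T ->
  is_cderive (fun s => twist w t0 e s k) s
    (e%:C * (- 'i * mu%:C) * tri (rot (s * e)) (twist w t0 e s) (twist w t0 e s) (twist w t0 e s) k).
Proof.
move=> h; have [_ _ dw] := hw.
have := is_cderiveM (is_cderive_eix (e * freq_sq k) s) (is_cderive_affine (dw _ k h)).
set W := w (t0 + e * s).
have sW : csummable W.
  by have [h1 _ _] := hw; apply: hle_sigma_csummable (h1 (t0 + e * s) _); case/andP: h => *; rewrite !ltW.
have -> : tri (rot (s * e)) (twist w t0 e s) (twist w t0 e s) (twist w t0 e s) k =
    eix (s * (e * freq_sq k)) * tri (fun _ _ _ => 1) W W W k.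
  rewrite /tri -csum2Z; last by apply: (@csummable2_triX _ _ _ 1) => // *; rewrite nc1.
  congr csum2; apply/funext => j; apply/funext => l; rewrite /triX /rot /twist -/W mul1r.
  set m := j + l - k.
  have -> : s * (e * freq_sq k) = s * e * phase k j l + (s * (e * freq_sq j) + (s * (e * freq_sq l) + - (s * (e * freq_sq m)))).
    by rewrite /phase -/m; ring.
  rewrite 3!eixD cJM eixJ; ring.
set F := tri _ _ _ _ k; congr is_cderive; rewrite rmorphM /=; ring.
Qed.

Lemma twist_ccw e tau k : e = 1 \/ e = -1 -> 0 <= t0 + e * tau <= T ->
  ccontinuous_within `[0, tau] (fun s => twist w t0 e s k).
Proof.
move=> he h; have [_ cw _] := hw; apply: ccwM; first exact: ccw_eix.
apply: (ccw_affine (cw k)) => x /andP[x0 x1].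
by case: he h => -> /andP[h1 h2]; case/andP: ht0 => *; apply/andP; split; lra.
Qed.

Lemma inner_time e s tau : e = 1 \/ e = -1 -> 0 <= t0 + e * tau <= T -> 0 < s < tau ->
  0 < t0 + e * s < T.
Proof.
move=> he h /andP[x0 x1].
by case: he h => -> /andP[h1 h2]; case/andP: ht0 => *; apply/andP; split; lra.
Qed.

Variables (r theta K : R).
Hypotheses (hth : 0 <= theta <= 1) (K0 : 0 < K) (hK : @tri_consts R d s0 r theta K)
  (hr : 0 <= r <= s0).

(** Lipschitz constant in time of the twisted solution: a bound for its cubic right-hand side in
    H^sigma. *)
Definition L1 := `|mu| * (K * (M * M * M)).

Lemma M_ge0 : 0 <= M. Proof. by have [h _ _] := hw; exact: hle_ge0 (h _ ht0). Qed.

Lemma L1_ge0 : 0 <= L1.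
Proof. by have M0 := M_ge0; rewrite mulr_ge0// mulr_ge0 ?(ltW K0)// !mulr_ge0. Qed.

Lemma nc_imu : nc (- 'i * mu%:C) = `|mu|.
Proof. by rewrite ncM ncN nci mul1r ncR. Qed.

Lemma nc_rot x k j l : nc (rot x k j l) = 1. Proof. exact: nc_eix. Qed.

Lemma sgn_abs e : e = 1 \/ e = -1 -> `|e| = 1 :> R.
Proof. by case=> ->; rewrite ?normrN normr1. Qed.

(** No derivative is lost: with the Laplacian removed the velocity is a cubic expression, and
    H^sigma is an algebra. *)
Lemma twist_lip e tau : e = 1 \/ e = -1 -> 0 <= tau -> 0 <= t0 + e * tau <= T ->
  hle sigma (fun k => twist w t0 e tau k - w t0 k) (tau * L1).
Proof.
move=> he tau0 h.
have := @hle_mvt R d sigma (fun k s => twist w t0 e s k)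
  (fun k s => e%:C * (- 'i * mu%:C) * tri (rot (s * e)) (twist w t0 e s) (twist w t0 e s) (twist w t0 e s) k)
  tau L1 tau0 L1_ge0.
under [in X in _ -> _ -> _ -> hle _ X _]eq_fun do rewrite twist0.
apply=> [k|k s hs|s hs].
- exact: twist_ccw.
- exact/twist_cderive/(inner_time he h hs).
- apply: hleM; first exact: normr_ge0.
    by move=> k; rewrite ncM ncR (sgn_abs he) mul1r nc_imu.
  have hs' := inner_time he h hs.
  have hp : hle sigma (twist w t0 e s) M by apply: twist_hle; case/andP: hs' => *; rewrite !ltW.
  apply: (csum2_hle _).2; apply: tle_le (tc_alg hK hp hp hp) => k j l.
  by rewrite nc_ge0 nc_triX nc_rot mul1r lexx.
Qed.

Variable tau : R.
Hypotheses (tau0 : 0 <= tau <= 1) (hf : t0 + tau <= T) (hb : 0 <= t0 - tau).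

Local Notation p := (twist w t0 1).
Local Notation q := (twist w t0 (-1)).
Local Notation o := (w t0).

Lemma fwd s : 0 <= s <= tau -> 0 <= t0 + 1 * s <= T.
Proof. by move=> /andP[? ?]; case/andP: ht0 => ? ?; rewrite mul1r; apply/andP; split; move: hf; lra. Qed.

Lemma bwd s : 0 <= s <= tau -> 0 <= t0 + -1 * s <= T.
Proof. by move=> /andP[? ?]; case/andP: ht0 => ? ?; rewrite mulN1r; apply/andP; split; move: hb; lra. Qed.

Lemma p_hle s : 0 <= s <= tau -> hle sigma (p s) M.
Proof. by move=> hs; apply: twist_hle; exact: fwd. Qed.
Lemma q_hle s : 0 <= s <= tau -> hle sigma (q s) M.
Proof. by move=> hs; apply: twist_hle; exact: bwd. Qed.
Lemma o_hle : hle sigma o M. Proof. by have [h _ _] := hw; exact: h. Qed.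

Lemma dp_hle s : 0 <= s <= tau -> hle sigma (fun k => p s k - o k) (s * L1).
Proof. by move=> hs; apply: twist_lip; [left|case/andP: hs|exact: fwd]. Qed.
Lemma dq_hle s : 0 <= s <= tau -> hle sigma (fun k => q s k - o k) (s * L1).
Proof. by move=> hs; apply: twist_lip; [right|case/andP: hs|exact: bwd]. Qed.
Lemma D_hle s : 0 <= s <= tau -> hle sigma (fun k => p s k - q s k) (2 * (s * L1)).
Proof.
move=> hs; rewrite (_ : 2 * _ = s * L1 + 1 * (s * L1)); last by ring.
apply: hle_nc (hleD (dp_hle hs) (hleM ler01 (m := fun=> -1) _ (dq_hle hs))) => k.
  by rewrite (_ : p s k - q s k = p s k - o k + -1 * (q s k - o k))//; ring.
by rewrite ncN nc1.
Qed.

Lemma le_powR_theta s : 0 <= s <= tau -> s <= s `^ theta.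
Proof.
case/andP: tau0 => _ t1; case/andP: hth => _ th1 /andP[s0' s1].
have [->|sn0] := eqVneq s 0; first exact: powR_ge0.
by rewrite ger1_powR// lt_def sn0 s0'/=; lra.
Qed.

(** 24 is the constant of [eix_phase]; the second term collects three occurrences of p - q, each of
    size 2 s [L1]. *)
Definition L2 := 24 * (K * (M * M * M)) + 3 * (K * (2 * L1 * M * M)).

Lemma L2_ge0 : 0 <= L2.
Proof. by have M0 := M_ge0; have := L1_ge0; have := ltW K0 => *; rewrite addr_ge0 ?mulr_ge0// mulr_ge0// mulr_ge0. Qed.

Lemma rotN s k j l : rot (s * -1) k j l = eix (- (s * phase k j l)).
Proof. by rewrite /rot mulrN1 mulNr. Qed.
Lemma rot1 s k j l : rot (s * 1) k j l = eix (s * phase k j l).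
Proof. by rewrite /rot mulr1. Qed.

(** Time reversal turns the derivative of p + q into a difference of two cubic sums that agree at s
    = 0: the phases differ by 2 i sin(s Phi) and the factors by O(s), which [le_powR_theta] absorbs
    into s^theta. *)
Lemma even_deriv_hle s : 0 <= s <= tau ->
  hle r (fun k => tri (rot (s * 1)) (p s) (p s) (p s) k - tri (rot (s * -1)) (q s) (q s) (q s) k)
    (s `^ theta * L2).
Proof.
move=> hs; have [s0' _] := andP hs; have hp := p_hle hs; have hq := q_hle hs; have hD := D_hle hs.
have M0 := M_ge0; have L10 := L1_ge0; have Kp := ltW K0.
have sp := hle_sigma_csummable hp; have sq := hle_sigma_csummable hq.
have -> : (fun k => tri (rot (s * 1)) (p s) (p s) (p s) k - tri (rot (s * -1)) (q s) (q s) (q s) k) =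
    (fun k => csum2 (fun j l => triX (rot (s * 1)) (p s) (p s) (p s) k j l
        + -1 * triX (rot (s * -1)) (q s) (q s) (q s) k j l)).
  apply/funext => k; rewrite csum2D ?csum2Z ?mulN1r//.
  - by apply: (@csummable2_triX _ _ _ 1) => // *; rewrite nc_rot.
  - by apply: (@csummable2_triX _ _ _ 1) => // *; rewrite nc_rot.
  - by apply: (@csummable2M _ _ (fun _ _ => -1) 1) => [*|]; rewrite ?ncN ?nc1//;
      apply: (@csummable2_triX _ _ _ 1) => // *; rewrite nc_rot.
apply: (csum2_hle _).2.
have h1 := tleZ (mulr_ge0 (ler0n R 24) (powR_ge0 s theta)) (tc_ker hK hp hp hp).
have h2 := tc_sss hK hD hp hp; have h3 := tc_sss hK hq hD hp; have h4 := tc_sss hK hq hq hD.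
apply: (tle_mono _ (tle_le _ (tleD (tleD (tleD h1 h2) h3) h4))) => [|k j l].
  have := le_powR_theta hs => st.
  have P0 : 0 <= K * (L1 * M * M) by rewrite !mulr_ge0.
  have := ler_wpM2r P0 st; rewrite /L2; lra.
rewrite nc_ge0/= mulN1r /triX rot1 rotN.
apply: le_trans (cubic_diff_bound _ _ _ _ _ _ _ (nc_eix _)) _.
rewrite -cJB !ncJ /nc3; do 3 rewrite lerD2r.
apply: (eq_ler (ler_wpM2r (nc3_ge0 (p s) (p s) (p s) k j l) (eix_phase k j l s0' hth))) => //.
by rewrite /nc3; ring.
Qed.

Definition L3 := `|mu| * L2.

Lemma L3_ge0 : 0 <= L3. Proof. by rewrite mulr_ge0 ?L2_ge0. Qed.

(** The second difference vanishes at s = 0, so integrating [even_deriv_hle] gains one more power of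
    s. *)
Lemma even_hle s : 0 <= s <= tau ->
  hle r (fun k => p s k + q s k - 2 * o k) (s * (s `^ theta * L3)).
Proof.
move=> hs; have [s0' s1] := andP hs.
have B0 : 0 <= s `^ theta * L3 by rewrite mulr_ge0 ?powR_ge0 ?L3_ge0.
have := @hle_mvt R d r (fun k s => p s k + q s k)
  (fun k s => - 'i * mu%:C * (tri (rot (s * 1)) (p s) (p s) (p s) k - tri (rot (s * -1)) (q s) (q s) (q s) k))
  s (s `^ theta * L3) s0' B0.
rewrite (_ : (fun k => p s k + q s k - (p 0 k + q 0 k)) = (fun k => p s k + q s k - 2 * o k)); last first.
  by apply/funext => k; rewrite !twist0; ring.
apply=> [k|k x hx|x hx].
- by apply: ccwD; apply: twist_ccw; [left|exact: fwd|right|exact: bwd].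
- have h1 := twist_cderive k (inner_time (or_introl erefl) (fwd hs) hx).
  have h2 := twist_cderive k (inner_time (or_intror erefl) (bwd hs) hx).
  apply: (is_cderive_eq (is_cderiveD h1 h2)).
  by rewrite rmorphN !rmorph1; set F := tri _ _ _ _ k; set G := tri _ _ _ _ k; ring.
- have hx' : 0 <= x <= tau by case/andP: hx => *; apply/andP; split; lra.
  rewrite (_ : s `^ theta * L3 = `|mu| * (s `^ theta * L2)); last by rewrite /L3; ring.
  apply: hleM => [//|k|]; first by rewrite nc_imu.
  apply: l2le_mono (even_deriv_hle hx').
  rewrite ler_wpM2r ?L2_ge0//; case/andP: hx => x0 xs; case/andP: hth => th0 _.
  by apply: ge0_ler_powR; rewrite ?nnegrE; lra.
Qed.

Definition psiK (x : R) k j l : R[i] := (psi x (2 * freq_sq (j + l - k)))%:C.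
Definition cosK (x : R) k j l : R[i] := (cos (x * (2 * freq_sq (j + l - k))))%:C.
Definition psi1K (x : R) k j l : R[i] := psi1 x (2 * freq_sq (j + l - k)).
Definition eixK (x : R) k j l : R[i] := eix (x * (2 * freq_sq (j + l - k))).

(** Contributions of [cubic_sym_bound]: 168 is twice the 84 of [cos_phase], 72 is three times the 24
    of [eix_phase] with a first difference, 6 comes from three products of first differences of
    sizes s [L1] and 2 s [L1], and 3 from the second differences. *)
Definition L4 := 168 * (K * (M * M * M)) + 72 * (K * (L1 * M * M)) + 6 * (K * (L1 * L1 * M))
  + 3 * (K * (L3 * M * M)).

Lemma L4_ge0 : 0 <= L4.
Proof.
have M0 := M_ge0; have := L1_ge0; have := L3_ge0; have := ltW K0 => *.
have KM : 0 <= K * (M * M * M) by rewrite !mulr_ge0.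
have KL : 0 <= K * (L1 * M * M) by rewrite !mulr_ge0.
have KLL : 0 <= K * (L1 * L1 * M) by rewrite !mulr_ge0.
have KL3 : 0 <= K * (L3 * M * M) by rewrite mulr_ge0// mulr_ge0// mulr_ge0.
by rewrite /L4; lra.
Qed.

(* Expanding around s = 0 symmetrically, terms of first order in p - o are
   paired with q - o: what is left is p + q - 2 o, or carries a factor
   sin (s * phase) or p - q. *)
Lemma odd_deriv_hle s : 0 <= s <= tau ->
  hle r (fun k => tri (rot (s * 1)) (p s) (p s) (p s) k + tri (rot (s * -1)) (q s) (q s) (q s) k
    - 2 * tri (cosK s) o o o k) (s * s `^ theta * L4).
Proof.
move=> hs; have [s0' _] := andP hs; have hp := p_hle hs; have hq := q_hle hs; have hD := D_hle hs.
have ho := o_hle; have hd := dp_hle hs; have hh := even_hle hs.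
have M0 := M_ge0; have L10 := L1_ge0; have L30 := L3_ge0; have Kp := ltW K0.
have sp := hle_sigma_csummable hp; have sq := hle_sigma_csummable hq.
have so := hle_sigma_csummable ho.
have ss : s0 <= sigma by lra.
have ncos k j l : nc (cosK s k j l) <= 1.
  by rewrite ncR ler_norml cos_geN1 cos_le1.
have -> : (fun k => tri (rot (s * 1)) (p s) (p s) (p s) k + tri (rot (s * -1)) (q s) (q s) (q s) k
      - 2 * tri (cosK s) o o o k) =
    (fun k => csum2 (fun j l => triX (rot (s * 1)) (p s) (p s) (p s) k j l
        + triX (rot (s * -1)) (q s) (q s) (q s) k j l + - 2 * triX (cosK s) o o o k j l)).
  apply/funext => k.
  have c1 : csummable2 (triX (rot (s * 1)) (p s) (p s) (p s) k).
    by apply: (@csummable2_triX _ _ _ 1) => // *; rewrite nc_rot.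
  have c2 : csummable2 (triX (rot (s * -1)) (q s) (q s) (q s) k).
    by apply: (@csummable2_triX _ _ _ 1) => // *; rewrite nc_rot.
  have c3 : csummable2 (triX (cosK s) o o o k) by apply: (@csummable2_triX _ _ _ 1).
  have c4 : csummable2 (fun j l => - 2 * triX (cosK s) o o o k j l).
    by apply: (@csummable2M _ _ (fun _ _ => - 2) (nc (- 2 : R[i]))).
  by rewrite csum2D ?csum2D ?csum2Z ?mulNr//; exact: csummable2D.
apply: (csum2_hle _).2.
have st0 : 0 <= 24 * s `^ theta by rewrite mulr_ge0 ?powR_ge0.
have st1 : 0 <= 168 * (s * s `^ theta) by rewrite !mulr_ge0 ?powR_ge0.
have h1 := tleZ st1 (tc_ker hK ho ho ho).
have h2 := tleZ st0 (tc_ker hK hd hp hp).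
have h3 := tleZ st0 (tc_ker hK ho hd hp).
have h4 := tleZ st0 (tc_ker hK ho ho hd).
have h5 := tc_sss hK hd hD hp.
have h6 := tc_sss hK hd hq hD.
have h7 := tc_sss hK ho hd hD.
have hq' := hle_mono ss hq; have ho' := hle_mono ss ho.
have h8 := tc_hss hK hh hq' hq'.
have h9 := tc_shs hK ho' hh hq'.
have h10 := tc_ssh hK ho' ho' hh.
apply: (tle_mono _ (tle_le _ (tleD (tleD (tleD (tleD (tleD (tleD (tleD (tleD (tleD h1 h2) h3) h4) h5) h6) h7) h8) h9) h10))) => [|k j l].
  have := le_powR_theta hs => st.
  have P0 : 0 <= s * (K * (L1 * L1 * M)) by rewrite !mulr_ge0.
  have := ler_wpM2r P0 st; rewrite /L4; lra.
rewrite nc_ge0/= /triX rot1 rotN mulNr.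
rewrite [2 * (_ * _)]mulrA.
apply: le_trans (cubic_sym_bound _ _ _ _ _ _ _ _ _ _ _ (nc_eix _)) _.
rewrite -!cJB [2 * conjc (o _)](_ : _ = conjc (2 * o (j + l - k))); last by rewrite cJM conjc_nat.
rewrite -cJD -cJB !ncJ /nc3; do 6 rewrite lerD2r.
have e1 := ler_wpM2r (nc3_ge0 (p s) (p s) (p s) k j l) (eix_phase k j l s0' hth).
have kk (a b c : I -> R[i]) : nc (eix (s * phase k j l) - eix (- (s * phase k j l))) *
   (nc (a j) * nc (b l) * nc (c (j + l - k))) <=
    24 * s `^ theta * (kw theta k j l * (nc (a j) * nc (b l) * nc (c (j + l - k)))).
  apply: (eq_ler (ler_wpM2r (nc3_ge0 a b c k j l) (eix_phase k j l s0' hth))) => //.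
  by rewrite /nc3; ring.
apply: lerD; last exact: (kk o o (fun k => p s k - o k)).
apply: lerD; last exact: (kk o (fun k => p s k - o k) (p s)).
apply: lerD; last exact: (kk (fun k => p s k - o k) (p s) (p s)).
rewrite eix_addN.
have -> : (2 * cos (s * phase k j l))%:C - 2 * cosK s k j l =
   (2 * (cos (s * phase k j l) - cos (s * (2 * freq_sq (j + l - k)))))%:C :> R[i].
  by apply: complex_ext; rewrite /cosK !complexRIE /=; ring.
rewrite ncR normrM ger0_norm//.
apply: (@le_trans _ _ (2 * (84 * s `^ (1 + theta) * kw theta k j l) * (nc (o j) * nc (o l) * nc (o (j + l - k))))).
  by rewrite ler_wpM2r ?mulr_ge0 ?nc_ge0// ler_wpM2l// cos_phase.
have -> : s `^ (1 + theta) = s * s `^ theta.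
  have [->|sn0] := eqVneq s 0; last by rewrite powRD ?sn0 ?implybT// powRr1.
  by rewrite mul0r powR0// gt_eqF//; case/andP: hth => *; lra.
by rewrite le_eqVlt; apply/orP; left; apply/eqP; ring.
Qed.

(** With s in place of tau the expression vanishes at s = 0 and has derivative -i mu times the
    quantity of [odd_deriv_hle], so the mean value inequality supplies the last power of tau. *)
Lemma step_error :
  hle r (fun k => p tau k - q tau k + 2 * 'i * mu%:C * tri (psiK tau) o o o k)
    (tau * (tau * (tau `^ theta * (`|mu| * L4)))).
Proof.
have [t0' t1'] := andP tau0; have hs : 0 <= tau <= tau by rewrite t0' lexx.
have ho := o_hle; have so := hle_sigma_csummable ho.
have B0 : 0 <= tau * (tau `^ theta * (`|mu| * L4)) by rewrite !mulr_ge0 ?powR_ge0 ?L4_ge0.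
have := @hle_mvt R d r (fun k s => p s k + (-1) * q s k + 2 * 'i * mu%:C * tri (psiK s) o o o k)
  (fun k s => - 'i * mu%:C * (tri (rot (s * 1)) (p s) (p s) (p s) k + tri (rot (s * -1)) (q s) (q s) (q s) k
     - 2 * tri (cosK s) o o o k))
  tau _ t0' B0.
have dpsi k s : is_cderive (fun s => tri (psiK s) o o o k) s (tri (cosK s) o o o k).
  exact: (@tri_cderive R d (fun s c => (psi s c)%:C) (fun s c => (cos (s * c))%:C) o o o k s
    (fun s c => is_cderive_real (is_derive_psi s c)) (fun s c => nc_cos_le1 _) (@nc_psi_le R) so so so).
rewrite (_ : (fun k => _ - _) = (fun k => p tau k - q tau k + 2 * 'i * mu%:C * tri (psiK tau) o o o k)); last first.
  apply/funext => k; rewrite !twist0 [tri (psiK 0) _ _ _ _](_ : _ = 0); first by ring.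
  by apply: tri0 => k' j l; rewrite /psiK psi0.
apply=> [k|k x hx|x hx].
- apply: ccwD; last first.
    by apply: ccwM; [exact: ccw_cst|apply: (@ccw_derivable _ _ _ (fun s => tri (cosK s) o o o k)) => s; exact: dpsi].
  apply: ccwD; first by apply: twist_ccw; [left|exact: fwd].
  by apply: ccwM; [exact: ccw_cst|apply: twist_ccw; [right|exact: bwd]].
- have h1 := twist_cderive k (inner_time (or_introl erefl) (fwd hs) hx).
  have h2 := twist_cderive k (inner_time (or_intror erefl) (bwd hs) hx).
  apply: (is_cderive_eq (is_cderiveD (is_cderiveD h1 (is_cderiveZ (-1) h2))
    (is_cderiveZ (2 * 'i * mu%:C) (dpsi k x)))).
  by rewrite rmorphN !rmorph1; set F := tri _ _ _ _ k; set G := tri _ _ _ _ k; set H := tri _ _ _ _ k; ring.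
- have hx' : 0 <= x <= tau by case/andP: hx => *; apply/andP; split; lra.
  rewrite (_ : tau * (tau `^ theta * (`|mu| * L4)) = `|mu| * (tau * (tau `^ theta) * L4)); last by ring.
  apply: hleM => [//|k|]; first by rewrite nc_imu.
  apply: l2le_mono (odd_deriv_hle hx').
  rewrite ler_wpM2r ?L4_ge0//; case/andP: hx => x0 xs; case/andP: hth => th0 _.
  apply: ler_pM; rewrite ?powR_ge0//; [lra|lra|].
  by apply: ge0_ler_powR; rewrite ?nnegrE; lra.
Qed.

Definition L5 := 6 * (K * (M * M * M)) + 3 * (K * (L1 * M * M)).

Lemma L5_ge0 : 0 <= L5.
Proof.
have M0 := M_ge0; have := L1_ge0; have := ltW K0 => *.
have KM : 0 <= K * (M * M * M) by rewrite !mulr_ge0.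
have KL : 0 <= K * (L1 * M * M) by rewrite !mulr_ge0.
by rewrite /L5; lra.
Qed.

(** One-sided, so only the first order in s is gained; the weight [kw 0] is raised to [kw theta] so
    that the constant of the pair (r, theta) applies. *)
Lemma start_deriv_hle s : 0 <= s <= tau ->
  hle r (fun k => tri (rot (s * 1)) (p s) (p s) (p s) k - tri (eixK s) o o o k) (s * L5).
Proof.
move=> hs; have [s0' _] := andP hs; have hp := p_hle hs.
have ho := o_hle; have hd := dp_hle hs.
have M0 := M_ge0; have L10 := L1_ge0; have Kp := ltW K0.
have sp := hle_sigma_csummable hp; have so := hle_sigma_csummable ho.
have -> : (fun k => tri (rot (s * 1)) (p s) (p s) (p s) k - tri (eixK s) o o o k) =
    (fun k => csum2 (fun j l => triX (rot (s * 1)) (p s) (p s) (p s) k j l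
        + -1 * triX (eixK s) o o o k j l)).
  apply/funext => k.
  have c1 : csummable2 (triX (rot (s * 1)) (p s) (p s) (p s) k).
    by apply: (@csummable2_triX _ _ _ 1) => // *; rewrite nc_rot.
  have c3 : csummable2 (triX (eixK s) o o o k).
    by apply: (@csummable2_triX _ _ _ 1) => // *; rewrite nc_eix.
  have c4 : csummable2 (fun j l => - 1 * triX (eixK s) o o o k j l).
    by apply: (@csummable2M _ _ (fun _ _ => - 1) (nc (- 1 : R[i]))).
  by rewrite csum2D ?csum2Z ?mulN1r.
apply: (csum2_hle _).2.
have st : 0 <= 6 * s by rewrite mulr_ge0.
have h1 := tleZ st (tc_ker hK hp hp hp).
have h2 := tc_sss hK hd hp hp; have h3 := tc_sss hK ho hd hp; have h4 := tc_sss hK ho ho hd.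
apply: (tle_mono _ (tle_le _ (tleD (tleD (tleD h1 h2) h3) h4))) => [|k j l].
  by rewrite /L5; lra.
rewrite nc_ge0/= mulN1r /triX rot1 /eixK.
apply: le_trans (cubic_diff_bound _ _ _ _ _ _ _ (nc_eix _)) _.
rewrite -cJB !ncJ /nc3; do 3 rewrite lerD2r.
apply: le_trans (ler_wpM2r (nc3_ge0 (p s) (p s) (p s) k j l) (eix_phase2 k j l s0')) _.
have hk : kw 0 k j l <= kw theta k j l :> R.
  rewrite /kw ler_wpM2l ?mulr_ge0 ?powR_ge0// ler_powR//; last by case/andP: hth.
  by have [h _ _] := @phase_max R d k j l.
apply: (eq_ler (ler_wpM2r (nc3_ge0 (p s) (p s) (p s) k j l) (ler_wpM2l st hk))) => //.
by rewrite /nc3; ring.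
Qed.

Lemma start_error :
  hle r (fun k => p tau k - o k + 'i * mu%:C * tri (psi1K tau) o o o k)
    (tau * (tau * (`|mu| * L5))).
Proof.
have [t0' t1'] := andP tau0; have hs : 0 <= tau <= tau by rewrite t0' lexx.
have ho := o_hle; have so := hle_sigma_csummable ho.
have B0 : 0 <= tau * (`|mu| * L5) by rewrite !mulr_ge0 ?L5_ge0.
have := @hle_mvt R d r (fun k s => p s k + 'i * mu%:C * tri (psi1K s) o o o k)
  (fun k s => - 'i * mu%:C * (tri (rot (s * 1)) (p s) (p s) (p s) k - tri (eixK s) o o o k))
  tau _ t0' B0.
have dpsi k s : is_cderive (fun s => tri (psi1K s) o o o k) s (tri (eixK s) o o o k).
  exact: (@tri_cderive R d psi1 (fun s c => eix (s * c)) o o o k s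
    (@is_cderive_psi1 R) (fun s c => nc_eix_le1 _) (@nc_psi1_le R) so so so).
rewrite (_ : (fun k => _ - _) = (fun k => p tau k - o k + 'i * mu%:C * tri (psi1K tau) o o o k)); last first.
  apply/funext => k; rewrite !twist0 [tri (psi1K 0) _ _ _ _](_ : _ = 0); first by ring.
  by apply: tri0 => k' j l; rewrite /psi1K psi10.
apply=> [k|k x hx|x hx].
- apply: ccwD; last first.
    by apply: ccwM; [exact: ccw_cst|apply: (@ccw_derivable _ _ _ (fun s => tri (eixK s) o o o k)) => s; exact: dpsi].
  by apply: twist_ccw; [left|exact: fwd].
- have h1 := twist_cderive k (inner_time (or_introl erefl) (fwd hs) hx).
  apply: (is_cderive_eq (is_cderiveD h1 (is_cderiveZ ('i * mu%:C) (dpsi k x)))).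
  by rewrite !rmorph1; set F := tri _ _ _ _ k; set G := tri _ _ _ _ k; ring.
- have hx' : 0 <= x <= tau by case/andP: hx => *; apply/andP; split; lra.
  rewrite (_ : tau * (`|mu| * L5) = `|mu| * (tau * L5)); last by ring.
  apply: hleM => [//|k|]; first by rewrite nc_imu.
  apply: l2le_mono (start_deriv_hle hx').
  by rewrite ler_wpM2r ?L5_ge0//; case/andP: hx => x0 xs; lra.
Qed.

End one_solution.
End local_error.

(** * Stability and convergence for coefficients *)

Section stability.
Context {R : realType} {d : nat}.
Local Notation I := 'rV[int]_d.
Implicit Types (k : I) (a b : I -> R[i]).

Lemma nc_rotl (x : R) (z : R[i]) : nc z = nc (eix x * z).
Proof. by rewrite ncM nc_eix mul1r. Qed.

Lemma hleB r a b A B : hle r a A -> hle r b B -> hle r (fun k => a k - b k) (A + B).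
Proof.
move=> ha hb.
have hb' : hle r (fun k => - b k) B by apply: hle_nc hb => k; rewrite ncN.
exact: hleD ha hb'.
Qed.

Lemma hle_le r a A B : A <= B -> hle r a A -> hle r a B.
Proof. exact: l2le_mono. Qed.

(** Telescoping puts the error in each of the three slots in turn, with H^{s0} bounds on the other
    two; the kernel is uniformly bounded by c and costs no derivative. *)
Lemma tri_lip s0 r theta K (kap : I -> I -> I -> R[i]) c a b A E :
  (0 < d)%N -> d%:R / 2 < s0 -> @tri_consts R d s0 r theta K -> 0 <= c ->
  (forall k j l, nc (kap k j l) <= c) ->
  hle s0 a A -> hle s0 b A -> hle r (fun k => a k - b k) E ->
  hle r (fun k => tri kap a a a k - tri kap b b b k) (c * (3 * (K * (E * A * A)))).
Proof.
move=> d0 hs0 hK c0 hc ha hb he.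
have sa := hle_csummable d0 hs0 ha; have sb := hle_csummable d0 hs0 hb.
have -> : (fun k => tri kap a a a k - tri kap b b b k) =
    (fun k => csum2 (fun j l => triX kap a a a k j l + -1 * triX kap b b b k j l)).
  apply/funext => k.
  have c1 : csummable2 (triX kap a a a k) by exact: csummable2_triX hc _ _ _.
  have c2 : csummable2 (triX kap b b b k) by exact: csummable2_triX hc _ _ _.
  have c3 : csummable2 (fun j l => - 1 * triX kap b b b k j l).
    by apply: (@csummable2M _ _ (fun _ _ => - 1) (nc (- 1 : R[i]))).
  by rewrite csum2D ?csum2Z ?mulN1r.
apply: (csum2_hle _).2.
have h1 := tc_hss hK he ha ha; have h2 := tc_shs hK hb he ha; have h3 := tc_ssh hK hb hb he.
apply: (tle_mono _ (tle_le _ (tleZ c0 (tleD (tleD h1 h2) h3)))) => [|k j l].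
  by rewrite le_eqVlt; apply/orP; left; apply/eqP; ring.
rewrite nc_ge0/= mulN1r /triX -mulrBr ncM.
apply: ler_pM; rewrite ?nc_ge0 ?hc//.
have := cubic_diff_bound 1 (a j) (a l) (conjc (a (j + l - k))) (b j) (b l) (conjc (b (j + l - k))) (@nc1 R).
by rewrite !mul1r subrr nc0 mul0r add0r -cJB !ncJ.
Qed.

(** The step size in front of the nonlinear terms is absorbed into [psi1K] and [psiK]. *)
Record scheme_coef (mu tau : R) (w0 : I -> R[i]) (b : nat -> I -> R[i]) : Prop := SchemeCoef {
  sc_sum : forall n, csummable (b n);
  sc_0 : b 0%N = w0;
  sc_1 : forall k, b 1%N k = eix (- (tau * freq_sq k)) * (b 0%N k
    - 'i * mu%:C * tri (psi1K tau) (b 0%N) (b 0%N) (b 0%N) k);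
  sc_n : forall n k, b n.+2 k = eix (- (2 * tau * freq_sq k)) * b n k
    - 2 * 'i * mu%:C * (eix (- (tau * freq_sq k))
        * tri (psiK tau) (b n.+1) (b n.+1) (b n.+1) k) }.

Section errors.
Variables (s0 mu T M : R).
Hypotheses (d0 : (0 < d)%N) (hs0 : d%:R / 2 < s0).
Variables (w : R -> I -> R[i]) (tau : R) (b : nat -> I -> R[i]).
Hypotheses (hw : nls_coef s0 mu T M w) (htau : 0 < tau <= 1) (hb : scheme_coef mu tau (w 0) b).
Variables (r theta K A : R).
Hypotheses (hth : 0 <= theta <= 1) (K0 : 0 < K) (hK : @tri_consts R d s0 r theta K) (MA : M <= A).
Hypothesis (hT : 0 <= T).

Definition err (n : nat) k := w (n%:R * tau) k - b n k.

Lemma w_hle t : 0 <= t <= T -> hle s0 (w t) A.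
Proof.
move=> ht; have [h _ _] := hw; apply: hle_le MA _; apply: hle_mono (h t ht).
by lra.
Qed.

Lemma err0 : hle r (err 0) 0.
Proof.
apply: (@hle_nc _ _ r _ (fun k => 0 * w 0 k)) => [k|].
  by rewrite mul0r /err mul0r (sc_0 hb) subrr.
split=> // L uL; rewrite expr0n/= big1// => k _.
by rewrite mul0r nc0 mulr0 expr0n.
Qed.

Lemma err1 : tau <= T -> hle r (err 1) (tau * (tau * (`|mu| * L5 mu M K))).
Proof.
move=> tT; have [tp t1] := andP htau.
have h0 : (0 : R) <= 0 <= T by rewrite lexx hT.
have ht : 0 <= tau <= 1 by rewrite ltW.
have hT' : 0 + tau <= T by rewrite add0r.
apply: hle_nc (start_error d0 hs0 hw h0 hth K0 hK ht hT') => k.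
rewrite [leRHS](nc_rotl (- (tau * freq_sq k))) le_eqVlt; apply/orP; left; apply/eqP.
congr nc; rewrite /err (sc_1 hb) (sc_0 hb) /twist !mul1r add0r.
set F := tri _ _ _ _ _.
transitivity (eix (- (tau * freq_sq k)) * eix (tau * freq_sq k) * w tau k
    - eix (- (tau * freq_sq k)) * (w 0 k - 'i * mu%:C * F)); last by ring.
by rewrite eixNK mul1r.
Qed.

Definition Lerr := 6 * `|mu| * (K * (A * A)).

(** Undoing the twist turns [step_error] into the consistency error. The error two steps back keeps
    the coefficient 1 because the propagator is unitary; only the latest error meets the
    nonlinearity. *)
Lemma error_recursion n x y : n.+2%:R * tau <= T ->
  hle r (err n) x -> hle r (err n.+1) y -> hle s0 (b n.+1) A ->
  hle r (err n.+2) (tau * (tau * (tau `^ theta * (`|mu| * L4 mu M K))) + x + tau * Lerr * y).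
Proof.
move=> hn hx hy hbA; have [tp t1] := andP htau.
pose t0 := n.+1%:R * tau.
have tn : n.+2%:R * tau = t0 + tau by rewrite /t0 -[n.+2%:R]natr1 mulrDl mul1r.
have tm : n%:R * tau = t0 - tau by rewrite /t0 -[n.+1%:R]natr1 mulrDl mul1r addrK.
have n0 : 0 <= n%:R * tau by rewrite mulr_ge0// ltW.
have h0 : 0 <= t0 <= T by apply/andP; split; lra.
have ht : 0 <= tau <= 1 by rewrite ltW.
have hf : t0 + tau <= T by rewrite -tn.
have hbk : 0 <= t0 - tau by rewrite -tm.
have h1 := step_error d0 hs0 hw h0 hth K0 hK ht hf hbk.
have npsi k j l : nc (psiK tau k j l) <= tau by rewrite -[leRHS]ger0_norm ?(ltW tp)//; exact: nc_psi_le.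
have h2 := tri_lip d0 hs0 hK (ltW tp) npsi (w_hle h0) hbA hy.
have -> : tau * (tau * (tau `^ theta * (`|mu| * L4 mu M K))) + x + tau * Lerr * y =
   1 * (tau * (tau * (tau `^ theta * (`|mu| * L4 mu M K)))) + 1 * x
     + (2 * `|mu|) * (tau * (3 * (K * (y * A * A)))).
  by rewrite /Lerr; ring.
have h1' := @hleM _ _ r (fun k => eix (- (tau * freq_sq k))) 1 _ _ ler01 _ h1.
have hx' := @hleM _ _ r (fun k => eix (- (2 * tau * freq_sq k))) 1 _ _ ler01 _ hx.
have m0 : 0 <= 2 * `|mu| by rewrite mulr_ge0.
have h2' := @hleM _ _ r (fun k => 2 * 'i * mu%:C * eix (- (tau * freq_sq k))) (2 * `|mu|) _ _ m0 _ h2.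
have e1 k : nc (eix (- (tau * freq_sq k))) <= 1 by rewrite nc_eix.
have e2 k : nc (eix (- (2 * tau * freq_sq k))) <= 1 by rewrite nc_eix.
have e3 k : nc (2 * 'i * mu%:C * eix (- (tau * freq_sq k))) <= 2 * `|mu|.
  by rewrite !ncM nc_eix nci ncR !mulr1 ler_wpM2r// -[2 : R[i]]/((2:nat)%:R) -(rmorph_nat (real_complex R)) ncR normr_nat.
apply: hle_nc (hleB (hleD (h1' e1) (hx' e2)) (h2' e3)) => k.
rewrite le_eqVlt; apply/orP; left; apply/eqP; congr nc.
rewrite /err (sc_n hb) tn tm -/t0 /twist !mul1r mulN1r !mulN1r.
set F := tri _ _ _ _ _; set G := tri _ _ _ _ _.
have ee : eix (- (tau * freq_sq k)) * eix (tau * - freq_sq k) = eix (- (2 * tau * freq_sq k)) :> R[i].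
  by rewrite -eixD; congr eix; ring.
transitivity (eix (- (tau * freq_sq k)) * eix (tau * freq_sq k) * w (t0 + tau) k
    - eix (- (2 * tau * freq_sq k)) * b n k + 2 * 'i * mu%:C * eix (- (tau * freq_sq k)) * F).
  by rewrite eixNK; ring.
by rewrite -ee; ring.
Qed.

(* The bound on b is only needed at indices where the error estimate is already
   known, which is what the bootstrap in H^{s0} requires. *)
Lemma gronwall X rho :
  0 <= X -> 0 <= rho -> 0 <= A ->
  tau * (tau `^ theta * (`|mu| * L4 mu M K)) <= rho ->
  tau * (tau * (`|mu| * L5 mu M K)) <= X ->
  (forall n, n%:R * tau <= T -> hle r (err n) (expR (Lerr * T) * (X + T * rho)) -> hle s0 (b n) A) ->
  forall n, n%:R * tau <= T -> hle r (err n) (expR (Lerr * T) * (X + T * rho)).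
Proof.
move=> X0 rho0 A0 hrho hX hbA.
have [tp t1] := andP htau.
have L0 : 0 <= Lerr by rewrite !mulr_ge0// ltW.
(* [B n] dominates both [err n] and [err n.+1], which turns the two-step recursion into the one-step
   inequality [BS]. *)
pose B n := (1 + Lerr * tau) ^+ n * (X + n%:R * (tau * rho)).
have g1 : 1 <= 1 + Lerr * tau by rewrite lerDl mulr_ge0// ltW.
have B0 n : 0 <= B n.
  by rewrite mulr_ge0 ?exprn_ge0//; [lra|rewrite addr_ge0// !mulr_ge0// ltW].
have BZ n : n%:R * tau <= T -> B n <= expR (Lerr * T) * (X + T * rho).
  move=> hn; have q0 : 0 <= 1 + Lerr * tau by lra.
  apply: ler_pM; [exact: exprn_ge0| |..].
  - by rewrite addr_ge0// !mulr_ge0// ltW.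
  - apply: (@le_trans _ _ (expR (Lerr * tau) ^+ n)).
      by apply: lerXn2r; rewrite ?nnegrE ?expR_ge0//; exact: expR_ge1Dx.
    by rewrite -expRM_natl ler_expR mulrCA ler_wpM2l.
  - by rewrite lerD2l mulrA ler_wpM2r.
have BS n : tau * rho + B n + tau * Lerr * B n <= B n.+1.
  rewrite /B exprS -natr1.
  have : 1 <= (1 + Lerr * tau) ^+ n.+1 by rewrite exprn_ege1.
  rewrite exprS; move: ((1 + Lerr * tau) ^+ n) => g hg.
  have : 0 <= tau * rho by rewrite mulr_ge0// ltW.
  move: (tau * rho) => x x0; have := ler_wpM2r x0 hg; lra.
have Bmono n : B n <= B n.+1.
  have := BS n; have := B0 n; have : 0 <= tau * rho by rewrite mulr_ge0// ltW.
  have : 0 <= tau * Lerr * B n by exact: mulr_ge0 (mulr_ge0 (ltW tp) L0) (B0 n).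
  lra.
have main n : n.+1%:R * tau <= T -> hle r (err n) (B n) /\ hle r (err n.+1) (B n).
  elim: n => [|n ih] hn.
    have B0X : B 0%N = X by rewrite /B expr0 mul1r mul0r addr0.
    rewrite B0X; split; first exact: hle_le X0 err0.
    by apply: hle_le hX _; apply: err1; rewrite mul1r in hn.
  have hn1 : n.+1%:R * tau <= T.
    by apply: le_trans hn; rewrite (ler_wpM2r (ltW tp))// ler_nat.
  have [h1 h2] := ih hn1; split; first exact: hle_le (Bmono n) h2.
  have hn0 : n%:R * tau <= T by apply: le_trans hn1; rewrite (ler_wpM2r (ltW tp))// ler_nat.
  have hb1 : hle s0 (b n.+1) A by apply: hbA => //; exact: hle_le (BZ n hn0) h2.
  apply: hle_le (error_recursion hn h1 h2 hb1).
  apply: le_trans (BS n); rewrite !lerD2r.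
  by rewrite ler_wpM2l// ltW.
case=> [_|n hn].
  apply: hle_le err0; rewrite mulr_ge0 ?expR_ge0// addr_ge0// mulr_ge0//.
have [_ h] := main n hn; apply: hle_le h; apply: BZ.
by apply: le_trans hn; rewrite (ler_wpM2r (ltW tp))// ler_nat.
Qed.

End errors.

Theorem coef_convergence (s0 gamma mu T M : R) :
  (0 < d)%N -> d%:R / 2 < s0 -> 1 <= s0 -> 0 <= gamma <= 1 -> 1 + 2 * gamma <= s0 ->
  0 < T -> 0 <= M ->
  exists C tau0 : R, [/\ 0 < C, 0 < tau0 &
    forall w, nls_coef s0 mu T M w ->
    forall tau, 0 < tau <= tau0 ->
    forall b : nat -> I -> R[i], scheme_coef mu tau (w 0) b ->
    forall n, n%:R * tau <= T ->
      hle 1 (fun k => w (n%:R * tau) k - b n k) (C * tau `^ (1 + gamma))].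
Proof.
move=> d0 hs0 s1 hg hgs T0 M0; have [g0 g1] := andP hg.
(* Measuring the error in H^{s0} itself forces theta = 0, since r + 2 theta may not exceed s0; rate
   tau is still left. *)
have [||K1 K10 hK1] := @tri_consts_ex R d s0 d0 hs0 s0 0 _ (lexx _); [by rewrite lexx andbT; lra|lra|].
have [|K2 K20 hK2] := @tri_consts_ex R d s0 d0 hs0 1 gamma _ g0 hgs; first by rewrite ler01.
have L4p K : 0 < K -> 0 <= L4 mu M K.
  by move=> /ltW Kp; rewrite /L4 /L3 /L2 /L1; rewrite ?addr_ge0 ?mulr_ge0 ?addr_ge0 ?mulr_ge0 ?addr_ge0 ?mulr_ge0.
have L5p K : 0 < K -> 0 <= L5 mu M K.
  by move=> /ltW Kp; rewrite /L5 /L1; rewrite ?addr_ge0 ?mulr_ge0.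
pose A := M + 1.
have A0 : 0 <= A by rewrite addr_ge0.
have MA : M <= A by rewrite lerDl.
pose C1 := expR (Lerr mu K1 A * T) * (`|mu| * L5 mu M K1 + T * (`|mu| * L4 mu M K1)).
pose C2 := expR (Lerr mu K2 A * T) * (`|mu| * L5 mu M K2 + T * (`|mu| * L4 mu M K2)).
have C1p : 0 <= C1 by rewrite mulr_ge0 ?expR_ge0// addr_ge0 ?mulr_ge0 ?L4p ?L5p// ltW.
have C2p : 0 <= C2 by rewrite mulr_ge0 ?expR_ge0// addr_ge0 ?mulr_ge0 ?L4p ?L5p// ltW.
(* This threshold gives tau C1 <= 1, so the H^{s0} error stays below 1 and the iterates below A = M
   + 1. The 1 added to C2 makes the constant positive. *)
exists (C2 + 1), (1 + C1)^-1; split; first by rewrite ltr_wpDl.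
  by rewrite invr_gt0 ltr_pwDl.
move=> w hw tau /andP[tp ht] b hb.
have tC : tau * C1 <= 1.
  move: ht; rewrite -[_^-1]mul1r ler_pdivlMr ?ltr_pwDl//.
  have : 0 <= tau * C1 by rewrite mulr_ge0// ltW.
  lra.
have t1 : tau <= 1.
  by apply: le_trans ht _; rewrite invf_le1 ?ltr_pwDl// lerDl.
have htau : 0 < tau <= 1 by rewrite tp.
have T0' := ltW T0.
have h01 : 0 <= (0 : R) <= 1 by rewrite lexx ler01.
have bA : forall n, n%:R * tau <= T -> hle s0 (b n) A.
  have hZ n : n%:R * tau <= T -> hle s0 (err w tau b n) (tau * C1) -> hle s0 (b n) A.
    move=> hn he; have hn' : 0 <= n%:R * tau <= T by rewrite hn mulr_ge0// ltW.
    have hwn : hle s0 (w (n%:R * tau)) M by exact: (w_hle hw (lexx M) hn').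
    apply: hle_le (_ : M + tau * C1 <= A) _; first by rewrite lerD2l.
    apply: hle_nc (hleB hwn he) => k.
    by rewrite /err opprB addrC subrK.
  have eZ : tau * C1 = expR (Lerr mu K1 A * T) * (tau * (`|mu| * L5 mu M K1) + T * (tau * (`|mu| * L4 mu M K1))).
    by rewrite /C1; ring.
  move=> n hn; apply: (hZ) => //; move: n hn; rewrite eZ.
  apply: (gronwall d0 hs0 hw htau hb h01 K10 hK1 MA T0') => //.
  - by rewrite !mulr_ge0 ?L5p// ltW.
  - by rewrite !mulr_ge0 ?L4p// ltW.
  - by rewrite powRr0 mul1r.
  - have x0 : 0 <= tau * (`|mu| * L5 mu M K1) by rewrite !mulr_ge0 ?L5p// ltW.
    by rewrite ler_piMl.
  - by move=> n hn; rewrite -eZ; exact: hZ.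
(* Lets the start error tau^2 be counted as tau^(1 + gamma). *)
have tg : tau <= tau `^ gamma by rewrite ger1_powR// tp.
have tg0 : 0 <= tau `^ gamma by exact: powR_ge0.
have tpow : tau `^ (1 + gamma) = tau * tau `^ gamma.
  by rewrite powRD ?powRr1 ?(ltW tp)// (gt_eqF tp) implybT.
have eZ : tau * tau `^ gamma * C2 = expR (Lerr mu K2 A * T) * (tau * tau `^ gamma * (`|mu| * L5 mu M K2)
    + T * (tau * (tau `^ gamma * (`|mu| * L4 mu M K2)))).
  by rewrite /C2; ring.
move=> n hn; apply: (@hle_le _ _ (tau * tau `^ gamma * C2)).
  by rewrite tpow [leRHS]mulrC ler_wpM2l ?mulr_ge0 ?(ltW tp)// lerDl.
have nn := hn.
move: n nn {hn}; rewrite eZ.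
apply: (gronwall d0 hs0 hw htau hb hg K20 hK2 MA T0') => //.
- by rewrite !mulr_ge0 ?L5p// ltW.
- by rewrite !mulr_ge0 ?L4p// ltW.
- by rewrite mulrA ler_wpM2r ?mulr_ge0 ?L5p// ler_wpM2l// ltW.
- by move=> n hn _; exact: bA.
Qed.

End stability.

(** * Integrals over the torus *)

Section continuity.
Context {R : realType}.

Lemma continuous_pair (T U V : topologicalType) (f : T -> U) (g : T -> V) :
  continuous f -> continuous g -> continuous (fun x => (f x, g x)).
Proof.
move=> cf cg x; exact: (@cvg_pair T U V (nbhs x) (nbhs (f x)) (nbhs (g x)) _ _ _ f g (cf x) (cg x)).
Qed.

Lemma continuous_rV (T : topologicalType) n (g : T -> 'rV[R]_n) :
  (forall j, continuous (fun t => g t 0 j)) -> continuous g.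
Proof.
move=> cg t A [P hP hA].
have h : \forall y \near t, forall j, P 0 j (g y 0 j).
  by apply: filter_forall => j; exact: (cg j t _ (hP 0 j)).
apply: filterS h => y hy; apply: hA => i j; rewrite (ord1 i); exact: hy.
Qed.

Lemma continuous_row_mx (T : topologicalType) n (f : T -> R) (g : T -> 'rV[R]_n) :
  continuous f -> continuous g ->
  continuous (fun t => row_mx (const_mx (f t) : 'rV[R]_1) (g t) : 'rV[R]_n.+1).
Proof.
move=> cf cg; apply: continuous_rV => j.
have [i e|i e] := splitP (j : 'I_(1 + n)).
  rewrite (_ : (fun t => _) = f)//; apply/funext => t.
  have -> : j = lshift n i :> 'I_(1 + n) by apply/val_inj.
  by transitivity ((const_mx (f t) : 'rV[R]_1) 0 i); [exact: row_mxEl|rewrite mxE].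
rewrite (_ : (fun t => _) = (fun t => g t 0 i)).
  move=> t; apply: (@continuous_comp _ _ _ g (fun M : 'rV[R]_n => M 0 i)); first exact: cg.
  exact: coord_continuous.
apply/funext => t; have -> : j = rshift 1 i :> 'I_(1 + n) by apply/val_inj.
exact: row_mxEr.
Qed.

End continuity.

Section segment_integral.
Context {R : realType}.
Implicit Types (f g : R -> R) (a b : R).
Local Notation mu := (@lebesgue_measure R).

Lemma segment_integrable f a b : continuous f -> mu.-integrable `[a, b] (EFin \o f).
Proof.
move=> cf; apply: continuous_compact_integrable; first exact: segment_compact.
exact: continuous_subspaceT.
Qed.

Lemma seg_intD f g a b : continuous f -> continuous g ->
  \int[mu]_(t in `[a, b]) (f t + g t) = \int[mu]_(t in `[a, b]) f t + \int[mu]_(t in `[a, b]) g t.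
Proof. by move=> cf cg; rewrite RintegralD//; exact: segment_integrable. Qed.

Lemma seg_intZ c f a b : continuous f ->
  \int[mu]_(t in `[a, b]) (c * f t) = c * \int[mu]_(t in `[a, b]) f t.
Proof. by move=> cf; rewrite RintegralZl//; exact: segment_integrable. Qed.

Lemma seg_int_cst c a b : a <= b -> \int[mu]_(t in `[a, b]) c = c * (b - a).
Proof.
move=> ab; rewrite Rintegral_cst//= lebesgue_measure_itv/= lte_fin.
by move: ab; rewrite le_eqVlt => /predU1P[->|->//]; rewrite ltxx subrr.
Qed.

Lemma seg_int_le f g a b : continuous f -> continuous g ->
  (forall t, a <= t <= b -> f t <= g t) ->
  \int[mu]_(t in `[a, b]) f t <= \int[mu]_(t in `[a, b]) g t.
Proof.
move=> cf cg h; apply: le_Rintegral => //; exact: segment_integrable.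
Qed.

Lemma seg_int_bound f a b B : a <= b -> continuous f -> (forall t, a <= t <= b -> `|f t| <= B) ->
  `|\int[mu]_(t in `[a, b]) f t| <= B * (b - a).
Proof.
move=> ab cf h.
have h1 := @le_normr_Rintegral _ (measurableTypeR R) R mu `[a, b] f (measurable_itv _) (segment_integrable a b cf).
apply: (le_trans h1).
rewrite -seg_int_cst//; apply: seg_int_le => //; last by move=> ?; exact: cst_continuous.
by move=> t; apply: continuous_comp; [exact: cf|exact: norm_continuous].
Qed.

(** Compactness of the segment makes G(q, t) close to G(p, t) uniformly in t for q near p. *)
Lemma cont_seg_int (P : topologicalType) (G : P * R -> R) a b : a <= b -> continuous G ->
  continuous (fun p => \int[mu]_(t in `[a, b]) G (p, t)).
Proof.
move=> ab cG p.
have cGp q : continuous (fun t => G (q, t)).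
  move=> t; apply: (@continuous_comp _ _ _ (fun t => (q, t)) G); last exact: cG.
  by apply: continuous_pair => x; [exact: cvg_cst|exact: cvg_id].
apply/cvgrPdist_le => e e0.
have e'0 : 0 < e / (b - a + 1) by rewrite divr_gt0// ltr_wpDl// subr_ge0.
set e' := e / _ in e'0.
have /compact_near_coveringP/near_covering_withinP H := @segment_compact R a b.
have {H} := H P (nbhs p) (fun q t => `|G (p, t) - G (q, t)| <= e') _.
have cc : forall x, [set` `[a, b]] x -> \forall x' \near x & i \near nbhs p,
    [set` `[a, b]] x' -> `|G (p, x') - G (i, x')| <= e'.
  move=> t _.
  have e2 : 0 < e' / 2 by rewrite divr_gt0.
  have /cvgrPdist_le /(_ _ e2) [[/= U V] [pU tV] hUV] := cG (p, t).
  exists (V, U); first by split.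
  move=> [t' q] [/= Vt' Uq] _.
  have h1 := hUV (p, t') (conj (nbhs_singleton pU) Vt').
  have h2 := hUV (q, t') (conj Uq Vt').
  rewrite (_ : G (p, t') - G (q, t') = (G (p, t) - G (q, t')) - (G (p, t) - G (p, t'))); last by ring.
  apply: le_trans (ler_normB _ _) _; move: h1 h2; rewrite /=; lra.
move=> /(_ _ cc); apply: filterS => q hq.
have -> : \int[mu]_(t in `[a, b]) G (p, t) - \int[mu]_(t in `[a, b]) G (q, t) =
    \int[mu]_(t in `[a, b]) (G (p, t) - G (q, t)).
  by rewrite RintegralB//; exact: segment_integrable.
apply: (@le_trans _ _ (e' * (b - a))).
  have cd : continuous (fun t => G (p, t) - G (q, t)) by move=> t; apply: cvgB; exact: cGp.
  apply: seg_int_bound => // t tab; apply: hq; rewrite /= in_itv.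
rewrite /e' mulrAC ler_pdivrMr ?ltr_wpDl ?subr_ge0// ler_wpM2l ?(ltW e0)//; lra.
Qed.

End segment_integral.

Section torus_integral.
Context {R : realType}.
Local Notation mu := (@lebesgue_measure R).
Local Notation row t y := (row_mx (const_mx t : 'rV[R]_1) y).

Lemma two_pi_ge0 : 0 <= 2 * pi :> R. Proof. by rewrite mulr_ge0 ?pi_ge0. Qed.

(** The parameter space is arbitrary because the induction on d turns each integrated coordinate
    into a new parameter. *)
Lemma continuous_torus_int_param d (P : topologicalType) (f : P -> 'rV[R]_d -> R) :
  continuous (fun z : P * 'rV[R]_d => f z.1 z.2) -> continuous (fun p => torus_int (f p)).
Proof.
elim: d P f => [|d ih] P f cf.
  move=> p /=; apply: (@continuous_comp _ _ _ (fun p => (p, 0 : 'rV[R]_0)) (fun z => f z.1 z.2)).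
    by apply: continuous_pair => x; [exact: cvg_id|exact: cvg_cst].
  exact: cf.
apply: (@cont_seg_int _ _ (fun z => torus_int (fun y => f z.1 (row z.2 y)))).
  exact: two_pi_ge0.
apply: (ih (P * R)%type (fun z y => f z.1 (row z.2 y))) => z.
apply: (@continuous_comp _ _ _ (fun z : P * R * 'rV[R]_d => (z.1.1, row z.1.2 z.2 : 'rV[R]_d.+1))
   (fun z => f z.1 z.2)); last exact: cf.
apply: continuous_pair => {}z.
  by apply: (@continuous_comp _ _ _ fst fst); exact: cvg_fst.
apply: continuous_row_mx => {}z; last exact: cvg_snd.
by apply: (@continuous_comp _ _ _ fst snd); [exact: cvg_fst|exact: cvg_snd].
Qed.

Lemma continuous_slice d (f : 'rV[R]_d.+1 -> R) : continuous f ->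
  continuous (fun z : R * 'rV[R]_d => f (row z.1 z.2)).
Proof.
move=> cf z; apply: (@continuous_comp _ _ _ (fun z : R * 'rV[R]_d => row z.1 z.2 : 'rV[R]_d.+1) f); last exact: cf.
by apply: continuous_row_mx => {}z; [exact: cvg_fst|exact: cvg_snd].
Qed.

Lemma continuous_slice1 d (f : 'rV[R]_d.+1 -> R) t : continuous f ->
  continuous (fun y : 'rV[R]_d => f (row t y)).
Proof.
move=> cf y; apply: (@continuous_comp _ _ _ (fun y : 'rV[R]_d => row t y : 'rV[R]_d.+1) f); last exact: cf.
by apply: (@continuous_row_mx R _ d (fun=> t) id) => {}y; [exact: cst_continuous|exact: cvg_id].
Qed.

Lemma continuous_torus_slice d (f : 'rV[R]_d.+1 -> R) : continuous f ->
  continuous (fun t => torus_int (fun y => f (row t y))).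
Proof. by move=> cf; apply: continuous_torus_int_param; exact: continuous_slice. Qed.

Lemma torus_intD d (f g : 'rV[R]_d -> R) : continuous f -> continuous g ->
  torus_int (fun x => f x + g x) = torus_int f + torus_int g.
Proof.
elim: d f g => [//|d ih] f g cf cg /=.
rewrite -seg_intD; [|exact: continuous_torus_slice..].
by apply: eq_Rintegral => t _; rewrite ih//; exact: continuous_slice1.
Qed.

Lemma torus_intZ d c (f : 'rV[R]_d -> R) : continuous f ->
  torus_int (fun x => c * f x) = c * torus_int f.
Proof.
elim: d f => [//|d ih] f cf /=.
rewrite -seg_intZ; last exact: continuous_torus_slice.
by apply: eq_Rintegral => t _; rewrite ih//; exact: continuous_slice1.
Qed.

Lemma torus_int_bound d (f : 'rV[R]_d -> R) B : continuous f -> (forall x, `|f x| <= B) ->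
  `|torus_int f| <= B * (2 * pi) ^+ d.
Proof.
elim: d f => [|d ih] f cf h /=; first by rewrite expr0 mulr1.
have := @seg_int_bound R (fun t => torus_int (fun y => f (row t y))) 0 (2 * pi) (B * (2 * pi) ^+ d)
  two_pi_ge0 (continuous_torus_slice cf).
rewrite subr0 -mulrA -exprSr; apply => t _.
by apply: ih => //; exact: continuous_slice1.
Qed.

End torus_integral.

Section complex_continuity.
Context {R : realType} {T : topologicalType}.
Implicit Types (f g : T -> R[i]).

Lemma contZ (c : R) (f : T -> R) : continuous f -> continuous (fun x => c * f x).
Proof. by move=> cf x; apply: cvgMr; exact: cf. Qed.

Lemma uniform_limit_continuous (F : T -> R) (S : nat -> T -> R) (e : nat -> R) :
  (forall N x, `|F x - S N x| <= e N) -> e @ \oo --> (0 : R) ->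
  (forall N, continuous (S N)) -> continuous F.
Proof.
move=> h he cS x; apply/cvgrPdist_le => eps eps0.
have e3 : 0 < eps / 3 by rewrite divr_gt0.
have /cvgrPdist_le /(_ _ e3) [N _ hN] := he.
have {hN} hN : e N <= eps / 3.
  by have := hN N (leqnn N); rewrite sub0r normrN; exact/le_trans/ler_norm.
have /cvgrPdist_le /(_ _ e3) := cS N x; apply: filterS => y hy.
have t z : `|F z - S N z| <= eps / 3 by exact: le_trans (h N z) hN.
have := t x; have := t y; move: hy; rewrite !ler_norml; lra.
Qed.

Lemma contD (f g : T -> R) : continuous f -> continuous g -> continuous (fun x => f x + g x).
Proof. by move=> cf cg x; apply: cvgD; [exact: cf|exact: cg]. Qed.

Lemma ccont_cst (z : R[i]) : ccontinuous (fun _ : T => z).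
Proof. by split=> x; exact: cst_continuous. Qed.

Lemma ccontD f g : ccontinuous f -> ccontinuous g -> ccontinuous (fun x => f x + g x).
Proof.
move=> [f1 f2] [g1 g2]; split.
  by under eq_fun do rewrite cReD; move=> x; apply: cvgD; [exact: f1|exact: g1].
by under eq_fun do rewrite cImD; move=> x; apply: cvgD; [exact: f2|exact: g2].
Qed.

Lemma ccontM f g : ccontinuous f -> ccontinuous g -> ccontinuous (fun x => f x * g x).
Proof.
move=> [f1 f2] [g1 g2]; split.
  under eq_fun do rewrite cReM; move=> x.
  by apply: cvgB; apply: cvgM; [exact: f1|exact: g1|exact: f2|exact: g2].
under eq_fun do rewrite cImM; move=> x.
by apply: cvgD; apply: cvgM; [exact: f1|exact: g2|exact: f2|exact: g1].
Qed.

Lemma ccontJ f : ccontinuous f -> ccontinuous (fun x => conjc (f x)).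
Proof.
move=> [f1 f2]; split; first by under eq_fun do rewrite cReJ.
by under eq_fun do rewrite cImJ; move=> x; apply: cvgN; exact: f2.
Qed.

Lemma ccont_eix (h : T -> R) : continuous h -> ccontinuous (fun x => eix (h x)).
Proof.
move=> ch; split=> x /=.
  by apply: (@continuous_comp _ _ _ h cos); [exact: ch|exact: continuous_cos].
by apply: (@continuous_comp _ _ _ h sin); [exact: ch|exact: continuous_sin].
Qed.

Lemma ccont_sum (J : Type) (K : seq J) (F : J -> T -> R[i]) :
  (forall j, ccontinuous (F j)) -> ccontinuous (fun x => \sum_(j <- K) F j x).
Proof.
move=> h; elim: K => [|j K ih].
  rewrite (_ : (fun x => _) = (fun=> 0)); first exact: ccont_cst.
  by apply/funext => x; rewrite big_nil.
rewrite (_ : (fun x => _) = (fun x => F j x + \sum_(j <- K) F j x)); first exact: ccontD.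
by apply/funext => x; rewrite big_cons.
Qed.

End complex_continuity.

(** * One-variable integrals of trigonometric functions *)

Section seg_ftc.
Context {R : realType}.
Local Notation mu := (@lebesgue_measure R).

Lemma seg_FTC (F f : R -> R) (a b : R) : a < b -> continuous f ->
  (forall t, is_derive t (1 : R) F (f t)) -> \int[mu]_(t in `[a, b]) f t = F b - F a.
Proof.
move=> ab cf dF; have cF : continuous F.
  by move=> t; apply/differentiable_continuous/derivable1_diffP; have := dF t => ?; exact: ex_derive.
rewrite /Rintegral (@continuous_FTC2 _ f F a b ab)//.
- exact: continuous_subspaceT.
- split; first by move=> t _; have := dF t => ?; exact: ex_derive.
  + exact: cvg_at_right_filter (cF a).
  + exact: cvg_at_left_filter (cF b).
- by move=> t _; rewrite derive1E; have := dF t => ?; exact: derive_val.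
Qed.

Lemma eix_2pi_int (n : int) : eix (2 * pi * n%:~R) = 1 :> R[i].
Proof.
have e1 : eix (2 * pi) = 1 :> R[i].
  by rewrite /eix mulr_natl cos2pi sin2pi.
have en (m : nat) : eix (2 * pi * m%:R) = 1 :> R[i].
  elim: m => [|m ih]; first by rewrite mulr0 eix0.
  by rewrite -[m.+1%:R]natr1 mulrDr mulr1 eixD ih e1 mulr1.
case: n => m; first exact: en.
by have := eixNK (2 * pi * m.+1%:R : R); rewrite en mulr1 NegzE rmorphN mulrN.
Qed.

Lemma seg_int_cos_sin (n : int) : n != 0 ->
  \int[mu]_(t in `[0, 2 * pi]) cos (t * n%:~R) = 0 /\
  \int[mu]_(t in `[0, 2 * pi]) sin (t * n%:~R) = 0.
Proof.
move=> n0; have c0 : n%:~R != 0 :> R by rewrite intr_eq0.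
have p0 : 0 < 2 * pi :> R by rewrite mulr_gt0 ?pi_gt0.
set c := n%:~R in c0 *.
have ec : eix (2 * pi * c) = 1 :> R[i] by exact: eix_2pi_int.
have [cc cs] : continuous (fun t : R => cos (t * c)) /\ continuous (fun t : R => sin (t * c)).
  have ct : continuous (fun t : R => t * c) by move=> t; apply: cvgM; [exact: cvg_id|exact: cvg_cst].
  by have := ccont_eix ct.
have d1 t : is_derive t (1 : R) (fun t => cos (t * c)) (- c * sin (t * c)).
  by have [h _] := is_cderive_eix c t; refine (is_derive_eq h _); rewrite !complexRIE /eix /=; ring.
have d2 t : is_derive t (1 : R) (fun t => sin (t * c)) (c * cos (t * c)).
  by have [_ h] := is_cderive_eix c t; refine (is_derive_eq h _); rewrite !complexRIE /eix /=; ring.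
have [e1 e2] : cos (2 * pi * c) = 1 :> R /\ sin (2 * pi * c) = 0 :> R by case: ec.
have z1 : continuous (fun t : R => c * cos (t * c)) by move=> t; apply: cvgMr; exact: cc.
have z2 : continuous (fun t : R => - c * sin (t * c)) by move=> t; apply: cvgMr; exact: cs.
split; apply/eqP.
  have /eqP := seg_FTC p0 z1 d2.
  by rewrite seg_intZ// e2 mul0r sin0 subrr mulf_eq0 (negbTE c0).
have /eqP := seg_FTC p0 z2 d1.
by rewrite seg_intZ// e1 mul0r cos0 subrr mulf_eq0 oppr_eq0 (negbTE c0).
Qed.

End seg_ftc.

(** * Fourier coefficients and Fourier series *)

Section complex_torus.
Context {R : realType} {d : nat}.
Local Notation I := 'rV[int]_d.
Local Notation X := 'rV[R]_d.
Implicit Types (f g : X -> R[i]) (k j : I).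

Lemma torus_cintD f g : ccontinuous f -> ccontinuous g ->
  torus_cint (fun x => f x + g x) = torus_cint f + torus_cint g.
Proof.
move=> [f1 f2] [g1 g2]; apply: complex_ext; rewrite !complexRIE /torus_cint /= -torus_intD//;
  by congr torus_int; apply/funext => x; rewrite ?cReD ?cImD.
Qed.

Lemma torus_cintZ z f : ccontinuous f -> torus_cint (fun x => z * f x) = z * torus_cint f.
Proof.
move=> [f1 f2].
have c1 (c : R) := @contZ _ _ c _ f1; have c2 (c : R) := @contZ _ _ c _ f2.
apply: complex_ext; rewrite !complexRIE /torus_cint /= -!torus_intZ//.
  rewrite -[X in _ + X]mulN1r -torus_intZ// -torus_intD//; last exact: contZ.
  by congr torus_int; apply/funext => x; rewrite cReM mulN1r.
rewrite -torus_intD//.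
by congr torus_int; apply/funext => x; rewrite cImM.
Qed.

(** The factor 2 comes from bounding the real and imaginary parts separately. *)
Lemma torus_cint_bound f B : ccontinuous f -> (forall x, nc (f x) <= B) ->
  nc (torus_cint f) <= 2 * B * (2 * pi) ^+ d.
Proof.
move=> [f1 f2] h; apply: le_trans (nc_le _) _; rewrite /torus_cint /=.
have h1 := torus_int_bound f1 (fun x => le_trans (normRe_le _) (h x)).
have h2 := torus_int_bound f2 (fun x => le_trans (normIm_le _) (h x)).
by apply: le_trans (lerD h1 h2) _; rewrite -mulrA; lra.
Qed.

Definition efun k (x : X) : R[i] := eix (freq_dot k x).

Lemma continuous_freq_dot k : continuous (freq_dot k : X -> R).
Proof.
rewrite /freq_dot; elim: (index_enum _) => [|i s ih].
  rewrite (_ : (fun x => _) = (fun=> 0)); first by move=> x; exact: cst_continuous.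
  by apply/funext => x; rewrite big_nil.
rewrite (_ : (fun x : X => _) = (fun x : X => (k 0 i)%:~R * x 0 i + \sum_(i <- s) (k 0 i)%:~R * x 0 i)).
  by apply: contD => //; apply: contZ; exact: coord_continuous.
by apply/funext => x; rewrite big_cons.
Qed.

Lemma ccont_efun k : ccontinuous (efun k).
Proof. by apply: ccont_eix; exact: continuous_freq_dot. Qed.

Lemma nc_efun k x : nc (efun k x) = 1. Proof. exact: nc_eix. Qed.

Lemma freq_dotD k j x : freq_dot (k + j) x = freq_dot k x + freq_dot j x :> R.
Proof.
by rewrite /freq_dot -big_split/=; apply: eq_bigr => i _; rewrite mxE rmorphD mulrDl.
Qed.

Lemma freq_dotN k x : freq_dot (- k) x = - freq_dot k x :> R.
Proof.
by rewrite /freq_dot -sumrN; apply: eq_bigr => i _; rewrite mxE rmorphN mulNr.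
Qed.

Lemma efunD k j x : efun (k + j) x = efun k x * efun j x.
Proof. by rewrite /efun freq_dotD eixD. Qed.

Lemma efunJ k x : conjc (efun k x) = efun (- k) x.
Proof. by rewrite /efun eixJ freq_dotN. Qed.

Lemma fourierE f k : fourier f k = ((2 * pi) ^- d)%:C * torus_cint (fun x => f x * efun (- k) x).
Proof.
rewrite /fourier; congr (_ * torus_cint _); apply/funext => x.
by rewrite cexp_i /efun freq_dotN.
Qed.

Lemma two_pi_expn_gt0 : 0 < (2 * pi) ^+ d :> R.
Proof. by rewrite exprn_gt0// mulr_gt0// pi_gt0. Qed.

Lemma fourierD f g k : ccontinuous f -> ccontinuous g ->
  fourier (fun x => f x + g x) k = fourier f k + fourier g k.
Proof.
move=> cf cg; rewrite !fourierE -mulrDr -torus_cintD.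
- by congr (_ * torus_cint _); apply/funext => x; rewrite mulrDl.
- by apply: ccontM => //; exact: ccont_efun.
- by apply: ccontM => //; exact: ccont_efun.
Qed.

Lemma fourierZ z f k : ccontinuous f -> fourier (fun x => z * f x) k = z * fourier f k.
Proof.
move=> cf; rewrite !fourierE mulrCA -(torus_cintZ z); last by apply: ccontM => //; exact: ccont_efun.
by congr (_ * torus_cint _); apply/funext => x; rewrite mulrA.
Qed.

Lemma fourierB f g k : ccontinuous f -> ccontinuous g ->
  fourier (fun x => f x - g x) k = fourier f k - fourier g k.
Proof.
move=> cf cg; rewrite -[RHS]/(_ + - _) -[X in _ + X]mulN1r -fourierZ// -fourierD//.
  by congr fourier; apply/funext => x; rewrite mulN1r.
by apply: ccontM => //; exact: ccont_cst.
Qed.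

Lemma fourier_sum (K : seq I) (F : I -> X -> R[i]) k : (forall j, ccontinuous (F j)) ->
  fourier (fun x => \sum_(j <- K) F j x) k = \sum_(j <- K) fourier (F j) k.
Proof.
move=> cF; elim: K => [|j K ih].
  rewrite big_nil (_ : (fun x => _) = (fun x => 0 * 1)); last by apply/funext => x; rewrite big_nil mul0r.
  by rewrite fourierZ ?mul0r//; exact: ccont_cst.
rewrite big_cons -ih -fourierD//; last exact: ccont_sum.
by congr fourier; apply/funext => x; rewrite big_cons.
Qed.

Lemma fourier_bound f B k : ccontinuous f -> (forall x, nc (f x) <= B) -> nc (fourier f k) <= 2 * B.
Proof.
move=> cf h; rewrite fourierE ncM ncR ger0_norm; last by rewrite invr_ge0 ltW// two_pi_expn_gt0.
rewrite mulrC ler_pdivrMr ?two_pi_expn_gt0//; apply: torus_cint_bound.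
  by apply: ccontM => //; exact: ccont_efun.
by move=> x; rewrite ncM nc_efun mulr1.
Qed.

Lemma fourier_shift f j k : fourier (fun x => efun j x * f x) k = fourier f (k - j).
Proof.
rewrite !fourierE; congr (_ * torus_cint _); apply/funext => x.
by rewrite opprB efunD; ring.
Qed.

Lemma fourier_conj f k : ccontinuous f -> fourier (fun x => conjc (f x)) k = conjc (fourier f (- k)).
Proof.
move=> [f1 f2]; rewrite !fourierE opprK cJM; congr (_ * _); first by rewrite conjc_real.
have [e1 e2] : ccontinuous (fun x => f x * efun k x) by apply: ccontM; [split|exact: ccont_efun].
apply: complex_ext; rewrite ?cReJ ?cImJ /torus_cint /=.
  by congr torus_int; apply/funext => x; rewrite -efunJ -cJM cReJ.
rewrite -[RHS]mulN1r -torus_intZ//.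
by congr torus_int; apply/funext => x; rewrite -efunJ -cJM cImJ mulN1r.
Qed.

Definition Fser (a : I -> R[i]) (x : X) : R[i] := freq_sum (fun k => a k * efun k x).

Lemma nc_term (a : I -> R[i]) x k : nc (a k * efun k x) <= nc (a k).
Proof. by rewrite ncM nc_efun mulr1. Qed.

Lemma csummable_term (a : I -> R[i]) x : csummable a -> csummable (fun k => a k * efun k x).
Proof. by move=> [B hB]; exists B; apply: l1le_le hB => k; exact: nc_term. Qed.

Lemma nc_Fser (a : I -> R[i]) x : csummable a -> nc (Fser a x) <= rsum (fun k => nc (a k)).
Proof.
move=> sa; apply: le_trans (nc_freq_sum (csummable_term x sa)) _.
apply: rsum_le => [||k]; last exact: nc_term.
  exact/csummable_rsummable/csummable_term.
exact: csummable_rsummable.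
Qed.

Definition tail (a : I -> R[i]) N := 2 * (rsum (fun k => nc (a k)) - cubesum (fun k => nc (a k)) N).

Lemma tail_cvg0 (a : I -> R[i]) : csummable a -> tail a @ \oo --> (0 : R).
Proof.
move=> sa; have h := rsum_cvg (csummable_rsummable sa).
rewrite /tail -[0 in X in _ --> X](mulr0 2); apply: cvgMr.
by rewrite -[0 in X in _ --> X](subrr (rsum (fun k => nc (a k)))); apply: cvgB => //; exact: cvg_cst.
Qed.

Lemma Fser_tail (a : I -> R[i]) x N : csummable a ->
  nc (Fser a x - cubesum (fun k => a k * efun k x) N) <= tail a N.
Proof.
by move=> sa; apply: nc_freq_sum_tail; [exact: csummable_rsummable|move=> k; exact: nc_term].
Qed.

Lemma ccont_partial (a : I -> R[i]) N : ccontinuous (fun x => cubesum (fun k => a k * efun k x) N).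
Proof. by apply: ccont_sum => k; apply: ccontM; [exact: ccont_cst|exact: ccont_efun]. Qed.

Lemma ccont_Fser (a : I -> R[i]) : csummable a -> ccontinuous (Fser a).
Proof.
move=> sa.
split.
  apply: (@uniform_limit_continuous _ _ _ (fun N x => Re (cubesum (fun k => a k * efun k x) N))
    (tail a) _ (tail_cvg0 sa)) => [N x|N]; last by have [] := ccont_partial a N.
  by rewrite -cReN -cReD; exact: le_trans (normRe_le _) (Fser_tail x N sa).
apply: (@uniform_limit_continuous _ _ _ (fun N x => Im (cubesum (fun k => a k * efun k x) N))
  (tail a) _ (tail_cvg0 sa)) => [N x|N]; last by have [] := ccont_partial a N.
by rewrite -cImN -cImD; exact: le_trans (normIm_le _) (Fser_tail x N sa).
Qed.

(** Each term of a partial sum only shifts the coefficients of [g]; since [g] is bounded, the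
    partial sums times [g] converge uniformly, and so do their coefficients. *)
Lemma fourier_Fser_mul (a : I -> R[i]) g B k : csummable a -> ccontinuous g ->
  (forall x, nc (g x) <= B) ->
  fourier (fun x => Fser a x * g x) k = freq_sum (fun j => a j * fourier g (k - j)).
Proof.
move=> sa cg hg; apply/esym/freq_sum_unique.
apply: (@ccvg_dist _ _ _ (fun N => 2 * B * tail a N)) => [N|]; last first.
  by rewrite -[0 in X in _ --> X](mulr0 (2 * B)); apply: cvgMr; exact: tail_cvg0.
have cP : ccontinuous (fun x => cubesum (fun k => a k * efun k x) N * g x).
  by apply: ccontM => //; exact: ccont_partial.
have cF : ccontinuous (fun x => Fser a x * g x) by apply: ccontM => //; exact: ccont_Fser.
have -> : cubesum (fun j => a j * fourier g (k - j)) N =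
    fourier (fun x => cubesum (fun k => a k * efun k x) N * g x) k.
  rewrite (_ : (fun x => _) = (fun x => \sum_(j <- cube N) a j * (efun j x * g x))); last first.
    by apply/funext => x; rewrite /cubesum big_distrl/=; apply: eq_bigr => j _; rewrite mulrA.
  have ce j : ccontinuous (fun x => efun j x * g x) by apply: ccontM => //; exact: ccont_efun.
  rewrite fourier_sum; last by move=> j; apply: ccontM => //; exact: ccont_cst.
  by apply: eq_bigr => j _; rewrite fourierZ// fourier_shift.
rewrite -fourierB//.
have -> : 2 * B * tail a N = 2 * (tail a N * B) by ring.
apply: fourier_bound.
  rewrite (_ : (fun x => _) = (fun x => Fser a x * g x + -1 * (cubesum (fun k => a k * efun k x) N * g x))).
    by apply: ccontD => //; apply: ccontM => //; exact: ccont_cst.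
  by apply/funext => x; rewrite mulN1r.
move=> x; rewrite -mulrBl ncM; apply: ler_pM; rewrite ?nc_ge0//.
exact: Fser_tail.
Qed.

End complex_torus.

(** * Uniqueness of Fourier coefficients *)

Section one_dim_uniqueness.
Context {R : realType}.
Local Notation mu := (@lebesgue_measure R).

Lemma seg_int_split (f : R -> R) a b c : a <= b -> b <= c -> continuous f ->
  \int[mu]_(t in `[a, c]) f t = \int[mu]_(t in `[a, b]) f t + \int[mu]_(t in `[b, c]) f t.
Proof.
move=> ab bc cf.
have ab' : (BLeft a <= BRight b)%O by rewrite bnd_simp.
have bc' : (BRight b <= BRight c)%O by rewrite bnd_simp.
have h := @Rintegral_itvB R f (BLeft a) (BRight c) b (segment_integrable a c cf) ab' bc'.
have fi : mu.-integrable `]b, c] (EFin \o f).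
  apply: integrableS (segment_integrable b c cf) => //.
  by apply: subset_itvr; rewrite bnd_simp.
have e := @Rintegral_itv_obnd_cbnd R b (BRight c) f fi.
move: h; rewrite e => <-; by rewrite addrC subrK.
Qed.

Definition null_int (f : R -> R) := continuous f /\ \int[mu]_(t in `[0, 2 * pi]) f t = 0.

Lemma null_intD f g : null_int f -> null_int g -> null_int (fun t => f t + g t).
Proof.
by move=> [cf f0] [cg g0]; split; [exact: contD|rewrite seg_intD// f0 g0 addr0].
Qed.

Lemma null_intZ c f : null_int f -> null_int (fun t => c * f t).
Proof. by move=> [cf f0]; split; [exact: contZ|rewrite seg_intZ// f0 mulr0]. Qed.

(** Vanishing of all Fourier coefficients in real form, bundled with continuity so that linear
    combinations need no separate integrability argument. *)
Definition null_coefs (f : R -> R) := forall k : int,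
  null_int (fun t => f t * cos (t * k%:~R)) /\ null_int (fun t => f t * sin (t * k%:~R)).

(** Product-to-sum formulas shift the frequency by one, so the class is stable under multiplication
    by trigonometric polynomials of degree one, hence by their powers. *)
Lemma null_coefs_mul f (c0 c1 c2 : R) : null_coefs f ->
  null_coefs (fun t => f t * (c0 + c1 * cos t + c2 * sin t)).
Proof.
move=> h k; have [hc hs] := h k; have [pc ps] := h (k + 1); have [mc ms] := h (k - 1).
have ep t : t * (k + 1)%:~R = t * k%:~R + t by rewrite rmorphD /= mulrDr mulr1.
have em t : t * (k - 1)%:~R = t * k%:~R - t by rewrite rmorphD rmorphN /= mulrDr mulrN1.
split.
  rewrite (_ : (fun t => _) = (fun t => c0 * (f t * cos (t * k%:~R)) +
      c1 / 2 * (f t * cos (t * (k + 1)%:~R)) + c1 / 2 * (f t * cos (t * (k - 1)%:~R)) +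
      c2 / 2 * (f t * sin (t * (k + 1)%:~R)) + - (c2 / 2) * (f t * sin (t * (k - 1)%:~R)))).
    by do 4 (apply: null_intD; last exact: null_intZ); exact: null_intZ.
  by apply/funext => t; rewrite ep em cosD cosB sinD sinB; field.
rewrite (_ : (fun t => _) = (fun t => c0 * (f t * sin (t * k%:~R)) +
    c1 / 2 * (f t * sin (t * (k + 1)%:~R)) + c1 / 2 * (f t * sin (t * (k - 1)%:~R)) +
    - (c2 / 2) * (f t * cos (t * (k + 1)%:~R)) + c2 / 2 * (f t * cos (t * (k - 1)%:~R)))).
  by do 4 (apply: null_intD; last exact: null_intZ); exact: null_intZ.
by apply/funext => t; rewrite ep em cosD cosB sinD sinB; field.
Qed.

Lemma cos_le_far (x dl : R) : 0 <= dl -> dl <= x <= 2 * pi - dl -> cos x <= cos dl.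
Proof.
move=> d0 /andP[h1 h2]; rewrite -subr_le0 cosB_prod oppr_le0.
rewrite !mulr_ge0// sin_ge0_pi//; apply/andP; split; lra.
Qed.

Lemma cos_ge_near (x dl : R) : 0 <= dl <= 1 -> - dl <= x <= dl -> cos dl <= cos x.
Proof.
move=> /andP[d0 d1] /andP[h1 h2]; rewrite -subr_ge0 cosB_prod.
have p2 := pi_ge2 R.
have -> : (x - dl) / 2 = - ((dl - x) / 2) by lra.
rewrite sinN mulrN opprK !mulr_ge0// sin_ge0_pi//; apply/andP; split; lra.
Qed.

Lemma bernoulli_exp (x : R) n : 0 <= x -> 1 + n%:R * x <= (1 + x) ^+ n.
Proof.
move=> x0; elim: n => [|n ih]; first by rewrite mul0r addr0 expr0.
rewrite exprS -natr1; apply: le_trans (ler_wpM2l _ ih); last by lra.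
have : 0 <= n%:R * x * x by rewrite !mulr_ge0.
lra.
Qed.

(* If h t0 > 0, the trigonometric polynomials (1 + cos (t - t0) - cos dl) ^ n are
   bounded by 1 away from t0 and grow geometrically near t0. *)
Lemma null_coefs_le0 (h : R -> R) t0 : continuous h -> null_coefs h -> 0 < t0 < 2 * pi ->
  h t0 <= 0.
Proof.
move=> ch nh /andP[t00 t01]; rewrite leNgt; apply/negP => hp.
have c2 : 0 < h t0 / 2 by rewrite divr_gt0.
have /cvgrPdist_le /(_ _ c2) /nbhs_ballP[dl0 /= dl00 hdl] := ch t0.
(* Within this radius h stays above half of [h t0] and the interval stays inside [0, 2 pi]; the cap
   1 keeps the half-angle sines nonnegative. *)
pose dl := Num.min (dl0 / 2) (Num.min 1 (Num.min (t0 / 2) ((2 * pi - t0) / 2))).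
have dp : 0 < dl by rewrite !lt_min !divr_gt0 ?subr_gt0 ?ltr01.
have d1 : dl <= dl0 / 2 by rewrite ge_min lexx.
have d2 : dl <= 1 by rewrite !ge_min lexx orbT.
have d3 : dl <= t0 / 2 by rewrite !ge_min lexx !orbT.
have d4 : dl <= (2 * pi - t0) / 2 by rewrite !ge_min lexx !orbT.
have {}hdl t : - dl <= t - t0 <= dl -> h t0 / 2 <= h t.
  move=> /andP[a1 a2]; have := hdl t; rewrite /ball/= distrC => hh.
  have : `|h t0 - h t| <= h t0 / 2 by apply: hh; rewrite ltr_norml; apply/andP; split; lra.
  by rewrite ler_norml; lra.
(* The peak function expanded in cos t and sin t, the shape to which [null_coefs_mul] applies. *)
pose q t : R := 1 - cos dl + cos t0 * cos t + sin t0 * sin t.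
have qE t : q t = 1 + cos (t - t0) - cos dl by rewrite /q cosB; ring.
pose hq n t := h t * q t ^+ n.
have nq n : null_coefs (hq n).
  elim: n => [|n ih].
    by rewrite (_ : hq 0%N = h)//; apply/funext => t; rewrite /hq expr0 mulr1.
  rewrite (_ : hq n.+1 = (fun t => hq n t * (1 - cos dl + cos t0 * cos t + sin t0 * sin t))).
    exact: null_coefs_mul.
  by apply/funext => t; rewrite /hq exprSr mulrA.
have [chq ihq] : (forall n, continuous (hq n)) /\ (forall n, \int[mu]_(t in `[0, 2 * pi]) hq n t = 0).
  have e n : null_int (hq n).
    have [e _] := nq n 0; rewrite (_ : hq n = (fun t => hq n t * cos (t * 0%:~R)))//.
    by apply/funext => t; rewrite mulr0 cos0 mulr1.
  by split=> n; have [] := e n.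
have [B hB] : exists B, forall t, 0 <= t <= 2 * pi -> `|h t| <= B.
  have /compact_bounded [B [_ hB]] := continuous_compact (continuous_subspaceT ch) (@segment_compact R 0 (2 * pi)).
  exists (B + 1) => t ht; apply: (hB (B + 1)); first by rewrite ltrDl.
  by exists t => //=; rewrite in_itv.
have B0 : 0 <= B by apply: le_trans (hB 0 _); rewrite ?lexx ?two_pi_ge0.
(* Lower bound of [q] on the half-width interval; it exceeds 1, so its powers grow. *)
pose q0 := 1 + (cos (dl / 2) - cos dl).
have q01 : 0 < cos (dl / 2) - cos dl.
  rewrite cosB_prod; have -> : (dl / 2 - dl) / 2 = - (dl / 4) by lra.
  have p2 := pi_ge2 R.
  by rewrite sinN mulrN opprK !mulr_gt0// sin_gt0_pi//; apply/andP; split; lra.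
have low n t : 0 <= t <= 2 * pi -> - B <= hq n t.
  move=> ht; have [near|far] := boolP (- dl <= t - t0 <= dl).
    have ct : cos dl <= cos (t - t0) by apply: cos_ge_near => //; rewrite ltW.
    apply: (@le_trans _ _ 0); first by rewrite oppr_le0.
    rewrite /hq mulr_ge0//; first by have := hdl t near; lra.
    by rewrite exprn_ge0// qE; lra.
  have ct : cos (t - t0) <= cos dl.
    have [tt|tt] := leP t0 t.
      apply: cos_le_far; first exact: ltW.
      by move: far; rewrite negb_and -!ltNge => /orP[]; case/andP: ht => *; apply/andP; split; lra.
    rewrite -cosN; apply: cos_le_far; first exact: ltW.
    by move: far; rewrite negb_and -!ltNge => /orP[]; case/andP: ht => *; apply/andP; split; lra.
  have q1 : `|q t| <= 1.
    by rewrite qE ler_norml; have := cos_geN1 (t - t0); have := cos_le1 dl; lra.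
  have : `|hq n t| <= B.
    rewrite /hq normrM normrX -[B]mulr1; apply: ler_pM => //; first exact: hB.
    by rewrite exprn_ile1.
  by rewrite ler_norml => /andP[].
have high n t : - (dl / 2) <= t - t0 <= dl / 2 -> h t0 / 2 * q0 ^+ n <= hq n t.
  move=> ht; apply: ler_pM.
  - exact: ltW.
  - by rewrite exprn_ge0// addr_ge0// ltW.
  - by apply: hdl; case/andP: ht => *; apply/andP; split; lra.
  - have q00 : 0 <= q0 by rewrite addr_ge0// ltW.
    have q0q : q0 <= q t.
      have : cos (dl / 2) <= cos (t - t0) by apply: cos_ge_near => //; apply/andP; split; lra.
      by rewrite qE /q0; lra.
    by rewrite lerXn2r ?nnegrE// (le_trans q00).
(* The vanishing integral is split at the ends of the half-width interval: the outer pieces are at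
   least -B times their lengths, so the middle piece is bounded uniformly in n. *)
have bound n : h t0 / 2 * q0 ^+ n * dl <= B * (2 * pi).
  have l1 : 0 <= t0 - dl / 2 by lra.
  have l2 : t0 - dl / 2 <= t0 + dl / 2 by lra.
  have l3 : t0 + dl / 2 <= 2 * pi by lra.
  have := ihq n; rewrite (seg_int_split l1 (le_trans l2 l3) (chq n)) (seg_int_split l2 l3 (chq n)).
  have cc (c : R) : continuous (fun _ : R => c) by move=> x; exact: cst_continuous.
  have i1 : - B * (t0 - dl / 2 - 0) <= \int[mu]_(t in `[0, t0 - dl / 2]) hq n t.
    rewrite -seg_int_cst//; apply: seg_int_le => // t /andP[? ?].
    by apply: low; apply/andP; split; lra.
  have i2 : h t0 / 2 * q0 ^+ n * (t0 + dl / 2 - (t0 - dl / 2)) <= \int[mu]_(t in `[t0 - dl / 2, t0 + dl / 2]) hq n t.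
    rewrite -seg_int_cst//; apply: seg_int_le => // t /andP[? ?].
    by apply: high; apply/andP; split; lra.
  have i3 : - B * (2 * pi - (t0 + dl / 2)) <= \int[mu]_(t in `[t0 + dl / 2, 2 * pi]) hq n t.
    rewrite -seg_int_cst//; apply: seg_int_le => // t /andP[? ?].
    by apply: low; apply/andP; split; lra.
  rewrite (_ : t0 + dl / 2 - (t0 - dl / 2) = dl) in i2; last by lra.
  have : 0 <= B * dl by rewrite mulr_ge0// ltW.
  lra.
set x := cos (dl / 2) - cos dl in q01 q0 bound high.
have cx : 0 < h t0 / 2 * x * dl by rewrite !mulr_gt0.
have B2 : 0 <= B * (2 * pi) / (h t0 / 2 * x * dl) by rewrite divr_ge0 ?mulr_ge0 ?pi_ge0// ltW.
(* By Bernoulli's inequality the left side of [bound] grows at least linearly in n; this n already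
   violates it. *)
pose n := (Num.truncn (B * (2 * pi) / (h t0 / 2 * x * dl))).+1.
have hn : B * (2 * pi) / (h t0 / 2 * x * dl) < n%:R by exact: truncnS_gt.
have := bound n; apply/negP; rewrite -ltNge.
move: hn; rewrite ltr_pdivrMr// => hn; apply: (lt_le_trans hn).
rewrite [leLHS](_ : _ = h t0 / 2 * (n%:R * x) * dl); last by ring.
rewrite ler_wpM2r ?(ltW dp)// ler_wpM2l ?(ltW c2)//.
by apply: le_trans (bernoulli_exp n (ltW q01)); lra.
Qed.

Lemma null_coefsN h : null_coefs h -> null_coefs (fun t => - h t).
Proof.
move=> nh k; have [hc hs] := nh k.
split; [rewrite (_ : (fun t => _) = (fun t => -1 * (h t * cos (t * k%:~R))))|
        rewrite (_ : (fun t => _) = (fun t => -1 * (h t * sin (t * k%:~R))))].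
- exact: null_intZ.
- by apply/funext => t; ring.
- exact: null_intZ.
- by apply/funext => t; ring.
Qed.

(** The sign argument for h and -h covers the open period; the endpoint 0 follows by continuity, and
    every other point by a shift found with [Num.floor]. *)
Lemma null_coefs_eq0 (h : R -> R) : continuous h -> (forall t, h (t + 2 * pi) = h t) ->
  null_coefs h -> forall t, h t = 0.
Proof.
move=> ch ph nh.
have inner t : 0 < t < 2 * pi -> h t = 0.
  move=> ht; apply/eqP; rewrite eq_le (null_coefs_le0 ch nh ht)/= -oppr_le0.
  apply: (@null_coefs_le0 (fun t => - h t)) => //; last exact: null_coefsN.
  by move=> x; apply: cvgN; exact: ch.
have p0 : 0 < 2 * pi :> R by rewrite mulr_gt0// pi_gt0.
have h0 : h 0 = 0.
  apply/eqP/negP => /negP hn.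
  have hp : 0 < `|h 0| / 2 by rewrite divr_gt0// normr_gt0.
  have /cvgrPdist_le /(_ _ hp) /nbhs_ballP[dl /= dl0 hdl] := ch 0.
  pose x := Num.min (dl / 2) pi.
  have x0 : 0 < x by rewrite lt_min divr_gt0//= pi_gt0.
  have xd : x <= dl / 2 by rewrite ge_min lexx.
  have xp : x <= pi by rewrite ge_min lexx orbT.
  have xdl : ball 0 dl x by rewrite /ball/= sub0r normrN gtr0_norm//; lra.
  have hx : h x = 0 by apply: inner; rewrite x0/=; have := pi_gt0 R; lra.
  have := hdl x xdl; rewrite hx subr0.
  by move: hp; lra.
have pn (n : nat) t : h (t + n%:R * (2 * pi)) = h t.
  elim: n t => [|n ih] t; first by rewrite mul0r addr0.
  by rewrite -natr1 mulrDl mul1r addrA ph ih.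
have pz (n : int) t : h (t + n%:~R * (2 * pi)) = h t.
  case: n => n; first exact: pn.
  by rewrite NegzE -(pn n.+1) rmorphN mulNr addrNK.
move=> t; pose n := Num.floor (t / (2 * pi)).
have hn1 : n%:~R <= t / (2 * pi) by exact: floor_le_tmp.
have hn2 : t / (2 * pi) < (n + 1)%:~R by exact: floorD1_gt.
rewrite ler_pdivlMr// in hn1; rewrite ltr_pdivrMr// rmorphD /= mulrDl mul1r in hn2.
rewrite -(pz (- n)) rmorphN mulNr.
have [e|e] := eqVneq (t - n%:~R * (2 * pi)) 0; first by rewrite e.
apply: inner; rewrite lt_def e /=; apply/andP; split; lra.
Qed.

End one_dim_uniqueness.

(** * Slicing the torus along the first coordinate *)

Section slices.
Context {R : realType}.
Local Notation mu := (@lebesgue_measure R).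
Local Notation row t y := (row_mx (const_mx t : 'rV[R]_1) y).

Lemma row_mx_ord0 (T : Type) d (t : T) (y : 'rV[T]_d) :
  (row_mx (const_mx t : 'rV[T]_1) y : 'rV[T]_d.+1) 0 ord0 = t.
Proof.
have -> : ord0 = lshift d 0 :> 'I_(1 + d) by apply/val_inj.
by transitivity ((const_mx t : 'rV[T]_1) 0 0); [exact: row_mxEl|rewrite mxE].
Qed.

Lemma row_mx_lift0 (T : Type) d (t : T) (y : 'rV[T]_d) i :
  (row_mx (const_mx t : 'rV[T]_1) y : 'rV[T]_d.+1) 0 (lift ord0 i) = y 0 i.
Proof.
have -> : lift ord0 i = rshift 1 i :> 'I_(1 + d) by apply/val_inj.
exact: row_mxEr.
Qed.

Lemma torus_cint_slice d (f : 'rV[R]_d.+1 -> R[i]) :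
  torus_cint f = (\int[mu]_(t in `[0, 2 * pi]) Re (torus_cint (fun y => f (row t y))))
    +i* (\int[mu]_(t in `[0, 2 * pi]) Im (torus_cint (fun y => f (row t y)))).
Proof. by []. Qed.

Definition cons_freq d (n : int) (k : 'rV[int]_d) : 'rV[int]_d.+1 := row_mx (const_mx n : 'rV[int]_1) k.

Lemma efun_row d n (k : 'rV[int]_d) t y :
  efun (cons_freq n k) (row t y) = eix (t * n%:~R) * efun k y :> R[i].
Proof.
rewrite /efun -eixD; congr eix; rewrite /freq_dot /cons_freq.
rewrite big_ord_recl !row_mx_ord0 mulrC; congr (_ + _).
by apply: eq_bigr => i _; rewrite !row_mx_lift0.
Qed.

Lemma cons_freqP d (k : 'rV[int]_d.+1) : exists n k', k = cons_freq n k'.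
Proof.
exists (k 0 ord0), (\row_i k 0 (lift ord0 i)); apply/rowP => i.
by case: (unliftP ord0 i) => [j|] ->; rewrite /cons_freq ?row_mx_lift0 ?row_mx_ord0 ?mxE.
Qed.

Lemma rowP_split d (x : 'rV[R]_d.+1) : exists t y, x = row t y.
Proof.
exists (x 0 ord0), (\row_i x 0 (lift ord0 i)); apply/rowP => i.
by case: (unliftP ord0 i) => [j|] ->; rewrite ?row_mx_lift0 ?row_mx_ord0 ?mxE.
Qed.

Lemma rV0_eq (V : nmodType) (x : 'rV[V]_0) : x = 0.
Proof. by apply/rowP => -[]. Qed.

Lemma row_shift_hd d t (y : 'rV[R]_d) :
  row (t + 2 * pi) y = row t y + (2 * pi) *: delta_mx 0 ord0 :> 'rV[R]_d.+1.
Proof.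
apply/rowP => i; rewrite [RHS]mxE.
by case: (unliftP ord0 i) => [j|] ->; rewrite ?row_mx_lift0 ?row_mx_ord0 !mxE ?mulr0 ?addr0 ?mulr1.
Qed.

Lemma row_shift_tl d t (y : 'rV[R]_d) (i : 'I_d) :
  row t (y + (2 * pi) *: delta_mx 0 i) = row t y + (2 * pi) *: delta_mx 0 (lift ord0 i) :> 'rV[R]_d.+1.
Proof.
apply/rowP => l; rewrite [RHS]mxE.
case: (unliftP ord0 l) => [j|] ->; rewrite ?row_mx_lift0 ?row_mx_ord0 !mxE ?mulr0 ?addr0//.
Qed.

(** Pairing f with [efun k] in the last coordinates leaves a function [H k] of the first one; its
    one-variable coefficients vanish, so [H k] is zero, and each slice satisfies the induction
    hypothesis. *)
Lemma torus_cint_unique d (f : 'rV[R]_d -> R[i]) : torus_fun f ->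
  (forall k, torus_cint (fun x => f x * efun k x) = 0) -> forall x, f x = 0.
Proof.
elim: d f => [|d ih] f [pf cf] hf x.
  have := hf 0; rewrite /torus_cint /= => -[h1 h2].
  rewrite (rV0_eq x); apply: complex_ext; move: h1 h2;
    by rewrite /efun /freq_dot big_ord0 eix0 mulr1.
have cslice t : ccontinuous (fun y : 'rV[R]_d => f (row t y)).
  by case: cf => c1 c2; split; [exact: (@continuous_slice1 R d _ t c1)|exact: (@continuous_slice1 R d _ t c2)].
pose H (k : 'rV[int]_d) t := torus_cint (fun y => f (row t y) * efun k y).
have cH k : ccontinuous (H k : R -> R[i]).
  have cfe : ccontinuous (fun x : 'rV[R]_d.+1 => f x * efun (cons_freq 0 k) x).
    by apply: ccontM => //; exact: ccont_efun.
  have e : H k = fun t => torus_cint (fun y => f (row t y) * efun (cons_freq 0 k) (row t y)).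
    by apply/funext => t; congr torus_cint; apply/funext => y; rewrite efun_row mulr0 eix0 mul1r.
  by rewrite e; case: cfe => c1 c2; split; [exact: (continuous_torus_slice c1)|exact: (continuous_torus_slice c2)].
have pH k t : H k (t + 2 * pi) = H k t.
  by congr torus_cint; apply/funext => y; rewrite row_shift_hd pf.
have intH k n : \int[mu]_(t in `[0, 2 * pi]) Re (H k t * eix (t * n%:~R)) = 0 /\
    \int[mu]_(t in `[0, 2 * pi]) Im (H k t * eix (t * n%:~R)) = 0.
  have := hf (cons_freq n k); rewrite torus_cint_slice => -[h1 h2].
  have e t : torus_cint (fun y => f (row t y) * efun (cons_freq n k) (row t y)) = H k t * eix (t * n%:~R).
    rewrite mulrC -torus_cintZ; last by apply: ccontM => //; exact: ccont_efun.
    by congr torus_cint; apply/funext => y; rewrite efun_row; ring.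
  by split; [apply: etrans h1|apply: etrans h2]; apply: eq_Rintegral => t _; rewrite -e.
have ct (n : int) : continuous (fun t : R => t * n%:~R).
  by move=> t; apply: cvgM; [exact: cvg_id|exact: cvg_cst].
have nH k : null_coefs (fun t => Re (H k t)) /\ null_coefs (fun t => Im (H k t)).
  have [c1 c2] := cH k.
  have cc n : continuous (fun t : R => cos (t * n%:~R)) by have [] := ccont_eix (ct n).
  have cs n : continuous (fun t : R => sin (t * n%:~R)) by have [] := ccont_eix (ct n).
  have cm (g1 g2 : R -> R) : continuous g1 -> continuous g2 -> continuous (fun t => g1 t * g2 t).
    by move=> h1 h2 t; apply: cvgM; [exact: h1|exact: h2].
  have main n : [/\ \int[mu]_(t in `[0, 2 * pi]) (Re (H k t) * cos (t * n%:~R)) = 0,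
      \int[mu]_(t in `[0, 2 * pi]) (Re (H k t) * sin (t * n%:~R)) = 0,
      \int[mu]_(t in `[0, 2 * pi]) (Im (H k t) * cos (t * n%:~R)) = 0 &
      \int[mu]_(t in `[0, 2 * pi]) (Im (H k t) * sin (t * n%:~R)) = 0].
    have rc := cm _ _ c1 (cc n); have rs := cm _ _ c1 (cs n).
    have ic := cm _ _ c2 (cc n); have js := cm _ _ c2 (cs n).
    (* A single frequency mixes the real and imaginary parts of [H k]; adding and subtracting the
       equations at n and -n isolates the four integrals. *)
    have [p1 p2] := intH k n; have [m1 m2] := intH k (- n).
    set A := \int[mu]_(t in _) (Re (H k t) * cos _); set B := \int[mu]_(t in _) (Re (H k t) * sin _).
    set A' := \int[mu]_(t in _) (Im (H k t) * cos _); set B' := \int[mu]_(t in _) (Im (H k t) * sin _).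
    have e1 : A + -1 * B' = 0.
      rewrite /A /B' -[RHS]p1 -seg_intZ// -seg_intD//; last exact: contZ.
      by apply: eq_Rintegral => t _; rewrite cReM /eix /=; ring.
    have e2 : B + A' = 0.
      rewrite /B /A' -[RHS]p2 -seg_intD//.
    have e3 : A + B' = 0.
      rewrite /A /B' -[RHS]m1 -seg_intD//.
      by apply: eq_Rintegral => t _; rewrite cReM rmorphN mulrN /eix cosN sinN /=; ring.
    have e4 : -1 * B + A' = 0.
      rewrite /B /A' -[RHS]m2 -seg_intZ// -seg_intD//; last exact: contZ.
      by apply: eq_Rintegral => t _; rewrite cImM rmorphN mulrN /eix cosN sinN /=; ring.
    by split; lra.
  by split=> n; have [m1 m2 m3 m4] := main n; split; split=> //; exact: cm.
have H0 k t : H k t = 0.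
  have [c1 c2] := cH k; have [n1 n2] := nH k; apply: complex_ext.
    by apply: (null_coefs_eq0 c1) => // t'; rewrite pH.
  by apply: (null_coefs_eq0 c2) => // t'; rewrite pH.
have [t [y ->]] := rowP_split x.
apply: (ih (fun y => f (row t y))) => [|k]; last exact: H0.
split; last exact: cslice.
by move=> z i; rewrite row_shift_tl pf.
Qed.

Lemma torus_cint_efun d (k : 'rV[int]_d) :
  torus_cint (efun k) = (if k == 0 then (2 * pi) ^+ d else 0)%:C :> R[i].
Proof.
elim: d k => [|d ih] k.
  rewrite (rV0_eq k) eqxx expr0 /torus_cint /=; apply: complex_ext;
    by rewrite /efun /eix /freq_dot /= big_ord0 ?cos0 ?sin0.
have [n [k' ->]] := cons_freqP k.
have e t : torus_cint (fun y => efun (cons_freq n k') (row t y)) =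
    eix (t * n%:~R) * (if k' == 0 then (2 * pi) ^+ d else 0)%:C :> R[i].
  rewrite -ih -torus_cintZ; last exact: ccont_efun.
  by congr torus_cint; apply/funext => y; rewrite efun_row.
have k0 : (cons_freq n k' == 0) = (n == 0) && (k' == 0).
  apply/eqP/andP => [h|[/eqP -> /eqP ->]].
    have h2 : cons_freq n k' = cons_freq 0 0.
      by rewrite h; apply/rowP => i; rewrite /cons_freq;
        case: (unliftP ord0 i) => [j|] ->; rewrite ?row_mx_lift0 ?row_mx_ord0 !mxE.
    split; first by move/rowP: h2 => /(_ ord0); rewrite /cons_freq !row_mx_ord0 => ->.
    apply/eqP/rowP => i; move/rowP: h2 => /(_ (lift ord0 i)).
    by rewrite /cons_freq !row_mx_lift0.
  by apply/rowP => i; rewrite /cons_freq; case: (unliftP ord0 i) => [j|] ->;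
    rewrite ?row_mx_lift0 ?row_mx_ord0 !mxE.
rewrite torus_cint_slice k0.
set c := (if k' == 0 then _ else _) in e *.
have ct : continuous (fun t : R => t * n%:~R).
  by move=> t; apply: cvgM; [exact: cvg_id|exact: cvg_cst].
have [cc cs] := ccont_eix ct.
have -> : (\int[mu]_(t in `[0, 2 * pi]) Re (torus_cint (fun y => efun (cons_freq n k') (row t y)))) =
    c * \int[mu]_(t in `[0, 2 * pi]) cos (t * n%:~R).
  by rewrite -seg_intZ//; apply: eq_Rintegral => t _; rewrite e cReM /eix /=; ring.
have -> : (\int[mu]_(t in `[0, 2 * pi]) Im (torus_cint (fun y => efun (cons_freq n k') (row t y)))) =
    c * \int[mu]_(t in `[0, 2 * pi]) sin (t * n%:~R).
  by rewrite -seg_intZ//; apply: eq_Rintegral => t _; rewrite e cImM /eix /=; ring.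
have [->|n0] := eqVneq n 0; last first.
  by have [-> ->] := seg_int_cos_sin n0 (R := R); rewrite !mulr0.
rewrite /= (_ : (\int[mu]_(t in _) cos _) = 2 * pi); last first.
  under eq_Rintegral do rewrite mulr0 cos0.
  by rewrite seg_int_cst ?two_pi_ge0// mul1r subr0.
rewrite (_ : (\int[mu]_(t in _) sin _) = 0); last first.
  under eq_Rintegral do rewrite mulr0 sin0.
  by rewrite seg_int_cst ?two_pi_ge0// mul0r.
by rewrite mulr0 /c; case: eqP => _; rewrite ?mul0r// -exprSr.
Qed.

End slices.

(** * Fourier inversion *)

Section inversion.
Context {R : realType} {d : nat}.
Local Notation I := 'rV[int]_d.
Local Notation X := 'rV[R]_d.
Implicit Types (k : I) (f g : X -> R[i]) (a : I -> R[i]).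

Lemma fourier1 k : fourier (fun _ : X => 1) k = (if k == 0 then 1 else 0 : R[i]).
Proof.
rewrite fourierE (_ : (fun x => 1 * efun (- k) x) = efun (- k)); last first.
  by apply/funext => x; rewrite mul1r.
rewrite torus_cint_efun oppr_eq0; case: eqP => _; last by rewrite mulr0.
by rewrite -rmorphM/= mulVf// gt_eqF// two_pi_expn_gt0.
Qed.

(** The product formula with g = 1 leaves a sum whose only nonzero term is j = k. *)
Lemma fourier_Fser a k : csummable a -> fourier (Fser a : X -> R[i]) k = a k.
Proof.
move=> sa.
have -> : Fser a = fun x : X => Fser a x * 1 by apply/funext => x; rewrite mulr1.
rewrite (@fourier_Fser_mul _ _ a (fun=> 1) 1)//; last first.
- by move=> x; rewrite nc1.
- exact: ccont_cst.
apply: freq_sum_unique; have [N hN] := cube_cofinal [:: k].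
have ev M : (N <= M)%N -> cubesum (fun j => a j * fourier (fun _ : X => 1) (k - j)) M = a k.
  move=> NM; have kM : k \in cube M by apply: (cube_sub NM); apply: hN; rewrite mem_head.
  rewrite /cubesum (bigD1_seq k)//=; last exact: cube_uniq.
  rewrite subrr fourier1 eqxx mulr1 big1 ?addr0// => j jk.
  by rewrite fourier1 subr_eq0 eq_sym (negbTE jk) mulr0.
split; apply: cvg_near_cst; exists N => // M /= NM; by rewrite (ev M NM).
Qed.

Lemma efun_periodic k x (i : 'I_d) : efun k (x + (2 * pi) *: delta_mx 0 i) = efun k x :> R[i].
Proof.
rewrite /efun (_ : freq_dot k _ = freq_dot k x + 2 * pi * (k 0 i)%:~R).
  by rewrite eixD eix_2pi_int mulr1.
rewrite /freq_dot.
under eq_bigr do rewrite !mxE mulrDr.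
rewrite big_split/=; congr (_ + _); rewrite (bigD1 i)//= !eqxx/= mulr1 mulrC big1 ?addr0// => j ji.
by rewrite (negbTE ji) !mulr0.
Qed.

Lemma torus_fun_Fser a : csummable a -> torus_fun (Fser a : X -> R[i]).
Proof.
move=> sa; split; last exact: ccont_Fser.
by move=> x i; congr freq_sum; apply/funext => k; rewrite efun_periodic.
Qed.

(** The difference of the two sides is continuous and periodic with vanishing coefficients, so
    uniqueness applies. *)
Lemma Fser_fourier f : torus_fun f -> csummable (fourier f) -> f = Fser (fourier f).
Proof.
move=> [pf cf] sf; have [pF cF] := torus_fun_Fser sf.
have cg : ccontinuous (fun x => f x - Fser (fourier f) x).
  rewrite (_ : (fun x => _) = (fun x => f x + -1 * Fser (fourier f) x)).
    by apply: ccontD => //; apply: ccontM => //; exact: ccont_cst.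
  by apply/funext => x; rewrite mulN1r.
have tg : torus_fun (fun x => f x - Fser (fourier f) x).
  by split=> // x i; rewrite pf pF.
apply/funext => x; apply/eqP; rewrite -subr_eq0; apply/eqP.
apply: (torus_cint_unique tg) => k {x}.
have := fourierB (- k) cf cF; rewrite fourier_Fser// subrr fourierE opprK => /eqP.
rewrite mulf_eq0 => /orP[/eqP[] /eqP|/eqP//].
by rewrite invr_eq0 gt_eqF// two_pi_expn_gt0.
Qed.

End inversion.

(** * The scheme and the equation in terms of coefficients *)

Section sobolev.
Context {R : realType} {d : nat}.
Local Notation I := 'rV[int]_d.
Local Notation X := 'rV[R]_d.
Implicit Types (f g : X -> R[i]).

Lemma hle_weight (r : R) (a : I -> R[i]) k :
  (om k `^ (r / 2) * nc (a k)) ^+ 2 = (1 + freq_sq k) `^ r * nc (a k) ^+ 2.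
Proof.
rewrite exprMn -powR_mulrn ?powR_ge0// -powRrM; congr (_ `^ _ * _).
by rewrite divfK.
Qed.

Lemma sobolev_hle f r M : 0 <= M -> (sobolev_norm r f <= M%:E)%E -> hle r (fourier f) M.
Proof.
move=> M0 h; split=> // K uK.
rewrite (eq_bigr _ (fun k _ => hle_weight r (fourier f) k)).
move: h; rewrite /sobolev_norm.
set S := esum _ _ => h.
have hS : (S <= (M ^+ 2)%:E)%E.
  have S0 : (0 <= S)%E.
    by apply: esum_ge0 => k _; rewrite lee_fin mulr_ge0 ?powR_ge0 ?sqr_ge0.
  case: S S0 h => [s||]//; last by rewrite poweRyr// leye_eq.
  rewrite poweR_EFin !lee_fin => s0 h; rewrite powR12_sqrt// in h.
  by rewrite -(sqr_sqrtr s0) lerXn2r ?nnegrE ?sqrtr_ge0.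
rewrite -lee_fin; apply: le_trans hS; apply: esum_ge.
exists [set` K]; first by split; [exact: finite_seq|].
by rewrite -fsbig_seq// sumEFin.
Qed.

Lemma hle_sobolev f r M : hle r (fourier f) M -> (sobolev_norm r f <= M%:E)%E.
Proof.
move=> [M0 hM]; rewrite /sobolev_norm.
set S := esum _ _.
have hS : (S <= (M ^+ 2)%:E)%E.
  apply: ge_ereal_sup => _ [A [fA _] <-].
  rewrite fsbig_finite//= sumEFin lee_fin.
  apply: le_trans (hM _ (finmap.fset_uniq (fset_set A))).
  by rewrite (eq_bigr _ (fun k _ => hle_weight r (fourier f) k)).
have S0 : (0 <= S)%E.
  by apply: esum_ge0 => k _; rewrite lee_fin mulr_ge0 ?powR_ge0 ?sqr_ge0.
case: S S0 hS => [s||]//.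
rewrite poweR_EFin !lee_fin => s0 h; rewrite powR12_sqrt//.
by have := ler_wsqrtr h; rewrite sqrtr_sqr ger0_norm.
Qed.

End sobolev.

Section fourier_cubic.
Context {R : realType} {d : nat}.
Local Notation I := 'rV[int]_d.
Local Notation X := 'rV[R]_d.
Implicit Types (f g : X -> R[i]) (a b : I -> R[i]).

Lemma csummableJ a : csummable a -> csummable (fun k => conjc (a (- k))).
Proof.
move=> [A hA]; exists A.
have h : l1le ((fun k => nc (a k)) \o -%R) A by exact: l1le_shift oppr_inj hA.
by apply: l1le_le h => k; rewrite ncJ.
Qed.

(** Obtained by comparing coefficients and inverting, which avoids reindexing the limit of cube
    sums. *)
Lemma Fser_conj a (x : X) : csummable a -> conjc (Fser a x) = Fser (fun k => conjc (a (- k))) x.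
Proof.
move=> sa; have [pF cF] := torus_fun_Fser (d := d) sa.
have tJ : torus_fun (fun x : X => conjc (Fser a x)).
  by split; [move=> y i; rewrite pF|exact: ccontJ].
have fJ : fourier (fun x : X => conjc (Fser a x)) = (fun k => conjc (a (- k))).
  by apply/funext => k; rewrite fourier_conj// fourier_Fser.
have := Fser_fourier tJ; rewrite fJ => /(_ (csummableJ sa)) h.
by have := congr1 (fun F => F x) h.
Qed.

Lemma fourier_cubic a b k : csummable a -> csummable b ->
  fourier (fun x : X => Fser a x * (Fser a x * Fser b x)) k =
  csum2 (fun j l => a j * (a l * b (k - j - l))).
Proof.
move=> sa sb.
have ca := ccont_Fser sa; have cb := ccont_Fser sb.
have na := fun x : X => nc_Fser x sa; have nb := fun x : X => nc_Fser x sb.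
have nab (x : X) : nc (Fser a x * Fser b x) <= rsum (fun k => nc (a k)) * rsum (fun k => nc (b k)).
  by rewrite ncM ler_pM ?nc_ge0.
rewrite (fourier_Fser_mul k sa (ccontM ca cb) nab) /csum2; congr freq_sum; apply/funext => j.
rewrite (fourier_Fser_mul (k - j) sa cb nb).
have eb : (fun l => a l * fourier (Fser b : X -> R[i]) (k - j - l)) = (fun l => a l * b (k - j - l)).
  by apply/funext => l; rewrite fourier_Fser.
rewrite eb -freq_sumZ//.
have [B hB] := sb; have [A hA] := sa.
exists (B * A); apply: l1le_le (l1leZ (l1le_ge0 hB) hA) => l.
by rewrite ncM mulrC ler_wpM2r ?nc_ge0// (l1le_sup _ hB).
Qed.

Lemma nc_conj_flip a k j l : conjc (a (- (k - j - l))) = conjc (a (j + l - k)).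
Proof. by congr (conjc (a _)); rewrite !opprB addrA [l + j]addrC. Qed.

(** The conjugated factor is met at frequency k - j - l, where its coefficient has index j + l - k;
    evenness of [m], which holds for functions of |k|^2, moves the multiplier to j + l - k as
    well. *)
Lemma fourier_cubic_tri a (m : I -> R[i]) C k : csummable a -> (forall k, nc (m k) <= C) ->
  (forall k, m (- k) = m k) ->
  fourier (fun x : X => Fser a x ^+ 2 * Fser (fun k => m k * conjc (a (- k))) x) k =
  tri (fun k j l => m (j + l - k)) a a a k.
Proof.
move=> sa hm mN.
have sm : csummable (fun k => m k * conjc (a (- k))) by apply: csummableM hm _; exact: csummableJ.
rewrite (_ : (fun x => _) = (fun x : X => Fser a x * (Fser a x * Fser (fun k => m k * conjc (a (- k))) x))).
  rewrite (fourier_cubic k sa sm); apply: (f_equal csum2); apply/funext => j; apply/funext => l.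
  rewrite nc_conj_flip /triX (_ : m (k - j - l) = m (j + l - k)); first by ring.
  by rewrite -[in LHS]mN !opprB addrA [l + j]addrC.
by apply/funext => x; rewrite expr2 mulrA.
Qed.

Lemma l1le_lim (s : nat -> I -> R[i]) (z : I -> R[i]) B :
  (forall k, ccvg (s^~ k) (z k)) -> (forall N, l1le (fun k => nc (s N k)) B) ->
  l1le (fun k => nc (z k)) B.
Proof.
move=> h1 h2; split=> [|K uK]; first by have [] := h2 0%N.
have h : (\sum_(k <- K) nc (s N k)) @[N --> \oo] --> \sum_(k <- K) nc (z k).
  by apply: cvg_seq_sum => k; exact: ccvg_nc.
by apply: (cvg_le_bound h) => N; have [_ ->] := h2 N.
Qed.

(** Absolutely summable families are closed under convolution, so the iterates stay continuous and
    equal to their Fourier series without any Sobolev bound. *)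
Lemma csummable_tri (kap : I -> I -> I -> R[i]) C a : (forall k j l, nc (kap k j l) <= C) ->
  csummable a -> csummable (tri kap a a a).
Proof.
move=> hk sa; have sX k : csummable2 (triX kap a a a k) by exact: csummable2_triX hk _ _ _.
have [A hA] := sa.
have C0 : 0 <= C by apply: le_trans (hk 0 0 0); exact: nc_ge0.
exists (C * (A * (A * A))).
apply: (@l1le_lim (fun N k => cubesum (fun j => freq_sum (triX kap a a a k j)) N)) => [k|N].
  exact/freq_sum_ccvg/csummable2_outer.
apply: (@l1le_lim (fun M k => \sum_(j <- cube N) cubesum (triX kap a a a k j) M)) => [k|M].
  by apply: ccvg_sum => j; exact/freq_sum_ccvg/csummable2_inner.
pose n k := nc (a k).
have hF : l1le (fconv (cube N) n (fconv (cube M) n (n \o -%R))) (A * (A * A)).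
  apply: fconv_l1 => //; first exact: cube_uniq.
    by move=> j; exact: nc_ge0.
  apply: fconv_l1 => //; first exact: cube_uniq.
    by move=> j; exact: nc_ge0.
  exact: l1le_shift oppr_inj hA.
apply: l1le_le (l1leZ C0 hF) => k; rewrite -ftriE /ftri big_distrr/=.
apply: le_trans (nc_sum _ _ _) _; apply: ler_sum => j _; rewrite big_distrr/=.
apply: le_trans (nc_sum _ _ _) _; apply: ler_sum => l _.
rewrite nc_triX /nc3 ler_wpM2r// !mulr_ge0 ?nc_ge0//.
Qed.

Lemma FserB a b (z : R[i]) : csummable a -> csummable b ->
  (fun x : X => Fser a x - z * Fser b x) = Fser (fun k => a k - z * b k).
Proof.
move=> sa sb; apply/funext => x; rewrite /Fser.
have -> : (fun k => (a k - z * b k) * efun k x) = (fun k => a k * efun k x + - z * (b k * efun k x)).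
  by apply/funext => k; ring.
rewrite freq_sumD ?freq_sumZ ?mulNr//; [exact: csummable_term..|].
by apply: csummableZ; exact: csummable_term.
Qed.

Lemma csummableB a b (z : R[i]) : csummable a -> csummable b -> csummable (fun k => a k - z * b k).
Proof.
move=> sa sb; rewrite (_ : (fun k => _) = (fun k => a k + - z * b k)).
  by apply: csummableD => //; exact: csummableZ.
by apply/funext => k; rewrite mulNr.
Qed.

Lemma multiplierE (m : R -> R[i]) f : multiplier m f = Fser (fun k => m (- freq_sq k) * fourier f k).
Proof.
apply/funext => x; rewrite /multiplier /Fser; congr freq_sum; apply/funext => k.
by rewrite cexp_i.
Qed.

Lemma schrodingerE (t : R) f : schrodinger t f = Fser (fun k => eix (- (t * freq_sq k)) * fourier f k).
Proof.
rewrite /schrodinger multiplierE; congr Fser; apply/funext => k.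
by rewrite cexp_i mulrN.
Qed.

End fourier_cubic.

Section scheme_coefficients.
Context {R : realType} {d : nat}.
Local Notation I := 'rV[int]_d.
Local Notation X := 'rV[R]_d.
Variables (mu tau : R) (u0 : X -> R[i]).
Hypotheses (tu0 : torus_fun u0) (su0 : csummable (fourier u0)) (tau0 : 0 < tau).

Definition eprop (k : I) : R[i] := eix (- (tau * freq_sq k)).

(** The minus sign of the symbol -|k|^2 cancels the one in -2i, which leaves the argument 2 i tau
    |k|^2. *)
Lemma phi1_psi1 (x : R) : tau%:C * phi1 (- (2 * 'i) * (tau * - x)%:C) = psi1 tau (2 * x).
Proof.
have -> : - (2 * 'i) * (tau * - x)%:C = 'i * (tau * (2 * x))%:C :> R[i].
  by apply: complex_ext; rewrite !complexRIE /=; ring.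
have i0 : 'i != 0 :> R[i] by exact: neq0Ci.
rewrite /phi1 /psi1 mulf_eq0 (negbTE i0)/=.
have -> : ((tau * (2 * x))%:C == 0 :> R[i]) = (2 * x == 0).
  by rewrite (inj_eq (@complexI R) _ 0) mulf_eq0 (gt_eqF tau0).
have [e|e] := eqVneq (2 * x) 0; first by rewrite mulr1.
have t0 : tau%:C != 0 :> R[i] by rewrite (inj_eq (@complexI R) _ 0) gt_eqF.
have x0 : x%:C != 0 :> R[i].
  have : x != 0 by apply: contraNneq e => ->; rewrite mulr0.
  by rewrite -(inj_eq (@complexI R) _ 0).
by rewrite cexp_i rmorphM /=; field; rewrite x0 i0 t0.
Qed.

Lemma phis_psi (x : R) : tau * phis (2 * tau * - x) = psi tau (2 * x).
Proof.
rewrite /phis /psi (_ : 2 * tau * - x = - (tau * (2 * x))); last by ring.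
rewrite oppr_eq0 mulf_eq0 (gt_eqF tau0)/=.
have [e|e] := eqVneq (2 * x) 0; first by rewrite mulr1.
have x0 : x != 0 by apply: contraNneq e => ->; rewrite mulr0.
by rewrite sinN; field; rewrite x0 gt_eqF.
Qed.

Lemma conj_Fser_fourier a : csummable a ->
  fourier (fun x : X => conjc (Fser a x)) = (fun k => conjc (a (- k))).
Proof.
move=> sa; apply/funext => k; rewrite fourier_conj ?fourier_Fser//.
exact: ccont_Fser.
Qed.

Lemma start_Fser (a : I -> R[i]) : csummable a ->
  csummable (fun k => eprop k * (a k - 'i * mu%:C * tri (psi1K tau) a a a k)) /\
  sLRI1_start mu tau (Fser a) = Fser (fun k => eprop k * (a k - 'i * mu%:C * tri (psi1K tau) a a a k)).
Proof.
move=> sa.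
have npsi (k j l : I) : nc (psi1K tau k j l : R[i]) <= `|tau| by exact: nc_psi1_le.
have st := csummable_tri npsi sa.
have se : csummable (fun k => eprop k * (a k - 'i * mu%:C * tri (psi1K tau) a a a k)).
  by apply: (csummableM (C := 1)) (csummableB _ sa st) => k; rewrite nc_eix.
split=> //.
have s1 : csummable (fun k => eix (- (tau * freq_sq k)) * a k).
  by apply: (csummableM (C := 1)) sa => k; rewrite nc_eix.
pose m (k : I) := phi1 (- (2 * 'i) * (tau * - freq_sq k)%:C) : R[i].
have m_psi k : tau%:C * m k = psi1 tau (2 * freq_sq k) by exact: phi1_psi1.
have t0 : tau%:C != 0 :> R[i] by rewrite (inj_eq (@complexI R) _ 0) gt_eqF.
have hm k : nc (m k) <= 1.
  have := nc_psi1_le tau (2 * freq_sq k); rewrite -m_psi ncM ncR -[leRHS]mulr1 ler_pM2l//.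
  by rewrite normr_gt0 gt_eqF.
have mN k : m (- k) = m k by rewrite /m freq_sqN.
have hN k : fourier (fun y : X => Fser a y ^+ 2 *
     multiplier (fun l => phi1 (- (2 * 'i) * (tau * l)%:C)) (fun w => conjc (Fser a w)) y) k =
   tri (fun k j l => m (j + l - k)) a a a k.
  by rewrite -(fourier_cubic_tri k sa hm mN) multiplierE conj_Fser_fourier.
have s2 : csummable (fun k => eix (- (tau * freq_sq k)) * tri (fun k j l => m (j + l - k)) a a a k).
  apply: (csummableM (C := 1)) => [k|]; first by rewrite nc_eix.
  by apply: (csummable_tri (C := 1)) sa => k j l.
apply/funext => x; rewrite /sLRI1_start !schrodingerE.
rewrite (_ : (fun k => eix (- (tau * freq_sq k)) * fourier (Fser a) k) = (fun k => eix (- (tau * freq_sq k)) * a k)); last first.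
  by apply/funext => k; rewrite fourier_Fser.
rewrite (_ : (fun k => _ * fourier (fun y => Fser a y ^+ 2 * _) k) =
   (fun k => eix (- (tau * freq_sq k)) * tri (fun k j l => m (j + l - k)) a a a k)); last first.
  by apply/funext => k; rewrite hN.
have := congr1 (fun F => F x) (FserB ('i * (mu * tau)%:C) s1 s2); rewrite /= => ->.
apply: (f_equal (fun g => Fser g x)); apply/funext => k; rewrite /eprop.
have -> : tri (psi1K tau) a a a k = tau%:C * tri (fun k j l => m (j + l - k)) a a a k.
  rewrite /tri -csum2Z; last by apply: (csummable2_triX (C := 1)).
  by congr csum2; apply/funext => j; apply/funext => l; rewrite /triX /psi1K -m_psi -!mulrA.
by rewrite rmorphM /=; ring.
Qed.

Lemma step_Fser (a b : I -> R[i]) : csummable a -> csummable b ->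
  let c k := eix (- (2 * tau * freq_sq k)) * b k - 2 * 'i * mu%:C * (eprop k * tri (psiK tau) a a a k) in
  csummable c /\ sLRI1_step mu tau (Fser a) (Fser b) = Fser c.
Proof.
move=> sa sb c.
have npsi (k j l : I) : nc (psiK tau k j l : R[i]) <= `|tau| by exact: nc_psi_le.
have st := csummable_tri npsi sa.
have s1 : csummable (fun k => eix (- (2 * tau * freq_sq k)) * b k).
  by apply: (csummableM (C := 1)) sb => k; rewrite nc_eix.
have sc : csummable c.
  apply: csummableB => //; apply: (csummableM (C := 1)) st => k; by rewrite nc_eix.
split=> //.
pose m (k : I) := (phis (2 * tau * - freq_sq k))%:C : R[i].
have m_psi k : tau%:C * m k = (psi tau (2 * freq_sq k))%:C by rewrite /m -rmorphM /= phis_psi.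
have hm k : nc (m k) <= 1.
  have := nc_psi_le tau (2 * freq_sq k); rewrite -m_psi ncM ncR -[leRHS]mulr1 ler_pM2l//.
  by rewrite normr_gt0 gt_eqF.
have mN k : m (- k) = m k by rewrite /m freq_sqN.
have hN k : fourier (fun y : X => Fser a y ^+ 2 *
     multiplier (fun l => (phis (2 * tau * l))%:C) (fun w => conjc (Fser a w)) y) k =
   tri (fun k j l => m (j + l - k)) a a a k.
  by rewrite -(fourier_cubic_tri k sa hm mN) multiplierE conj_Fser_fourier.
have s2 : csummable (fun k => eix (- (tau * freq_sq k)) * tri (fun k j l => m (j + l - k)) a a a k).
  apply: (csummableM (C := 1)) => [k|]; first by rewrite nc_eix.
  by apply: (csummable_tri (C := 1)) sa => k j l.
apply/funext => x; rewrite /sLRI1_step !schrodingerE.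
rewrite (_ : (fun k => eix (- (2 * tau * freq_sq k)) * fourier (Fser b) k) = (fun k => eix (- (2 * tau * freq_sq k)) * b k)); last first.
  by apply/funext => k; rewrite fourier_Fser.
rewrite (_ : (fun k => _ * fourier (fun y => Fser a y ^+ 2 * _) k) =
   (fun k => eix (- (tau * freq_sq k)) * tri (fun k j l => m (j + l - k)) a a a k)); last first.
  by apply/funext => k; rewrite hN.
have := congr1 (fun F => F x) (FserB (2 * 'i * (mu * tau)%:C) s1 s2); rewrite /= => ->.
apply: (f_equal (fun g => Fser g x)); apply/funext => k; rewrite /c /eprop.
have -> : tri (psiK tau) a a a k = tau%:C * tri (fun k j l => m (j + l - k)) a a a k.
  rewrite /tri -csum2Z; last by apply: (csummable2_triX (C := 1)).
  by congr csum2; apply/funext => j; apply/funext => l; rewrite /triX /psiK -m_psi -!mulrA.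
by rewrite rmorphM /=; ring.
Qed.

Lemma sLRI1_Fser n : csummable (fourier (sLRI1 mu tau u0 n)) /\
  sLRI1 mu tau u0 n = Fser (fourier (sLRI1 mu tau u0 n)).
Proof.
have ext (v : X -> R[i]) a : csummable a -> v = Fser a -> csummable (fourier v) /\ v = Fser (fourier v).
  move=> sa ->; have -> : fourier (Fser a : X -> R[i]) = a by apply/funext => k; rewrite fourier_Fser.
  by split.
(* The recursion reaches back two steps, so the induction carries two consecutive iterates. *)
suff h : forall n, (csummable (fourier (sLRI1 mu tau u0 n)) /\
    sLRI1 mu tau u0 n = Fser (fourier (sLRI1 mu tau u0 n))) /\
    (csummable (fourier (sLRI1 mu tau u0 n.+1)) /\
    sLRI1 mu tau u0 n.+1 = Fser (fourier (sLRI1 mu tau u0 n.+1))) by have [] := h n.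
have e0 := Fser_fourier tu0 su0.
elim=> [|{}n [[s0 f0] [s1 f1]]].
  split; first by split.
  by have [sc ec] := start_Fser su0; apply: ext sc _; rewrite -ec -e0.
split; first by split.
by have [sc ec] := step_Fser s1 s0; apply: ext sc _; rewrite -ec -f1 -f0.
Qed.

Lemma sLRI1_coef : scheme_coef mu tau (fourier u0) (fun n => fourier (sLRI1 mu tau u0 n)).
Proof.
have h := sLRI1_Fser; split=> [n||k|n k] //; first by have [] := h n.
  have [sc ec] := start_Fser su0.
  by rewrite /= {1}(Fser_fourier tu0 su0) ec fourier_Fser.
have [s0 f0] := h n; have [s1 f1] := h n.+1.
have [sc ec] := step_Fser s1 s0.
have -> : sLRI1 mu tau u0 n.+2 = sLRI1_step mu tau (sLRI1 mu tau u0 n.+1) (sLRI1 mu tau u0 n) by [].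
by rewrite {1}f1 {1}f0 ec fourier_Fser.
Qed.

End scheme_coefficients.

Section solution_coefficients.
Context {R : realType} {d : nat}.
Local Notation I := 'rV[int]_d.
Local Notation X := 'rV[R]_d.

Lemma sobolev_norm_ge0 r (f : X -> R[i]) : (0 <= sobolev_norm r f)%E.
Proof. exact: poweR_ge0. Qed.

Lemma le_fine_sup (T s t : R) (u : R -> X -> R[i]) : 0 <= t <= T ->
  (sup_sobolev_norm T s u < +oo)%E ->
  (sobolev_norm s (u t) <= (fine (sup_sobolev_norm T s u))%:E)%E.
Proof.
move=> tT supoo.
have le : (sobolev_norm s (u t) <= sup_sobolev_norm T s u)%E.
  by apply: ereal_sup_ubound; exists t => //; rewrite /= in_itv.
rewrite fineK//; apply/fin_numPlt; rewrite supoo andbT.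
by apply: lt_le_trans le; apply: lt_le_trans (sobolev_norm_ge0 _ _); rewrite ltNye.
Qed.

Lemma fourier_cube_abs (a : I -> R[i]) k : csummable a ->
  fourier (fun x : X => `|Fser a x| ^+ 2 * Fser a x) k = tri (fun _ _ _ => 1) a a a k.
Proof.
move=> sa.
have h1 (j : I) : nc (1 : R[i]) <= 1 by rewrite nc1.
transitivity (fourier (fun x : X => Fser a x ^+ 2 * Fser (fun j => 1 * conjc (a (- j))) x) k); last first.
  exact: (fourier_cubic_tri (m := fun => 1) k sa h1).
apply: (f_equal (fun f => fourier f k)); apply/funext => x.
under [in RHS]eq_fun do rewrite mul1r.
by rewrite -Fser_conj// sqr_normc; set z := Fser a x; ring.
Qed.

Lemma nls_solution_coef (s mu T M : R) (u0 : X -> R[i]) u : (0 < d)%N -> d%:R / 2 < s -> 0 < T ->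
  nls_solution mu T u0 u ->
  (forall t, 0 <= t <= T -> hle (s + 1) (fourier (u t)) M) ->
  nls_coef s mu T M (fun t => fourier (u t)).
Proof.
move=> d0 ds T0 [_ tu cu du] hu; split=> // t k tT.
have tT' : 0 <= t <= T by case/andP: tT => *; rewrite !ltW.
have [z dz zE] := du t k ltac:(by rewrite in_itv).
have su : csummable (fourier (u t)).
  by apply: hle_csummable (hu t tT') => //; apply: lt_trans ds _; rewrite ltrDl.
have ut : u t = Fser (fourier (u t)).
  by apply: Fser_fourier => //; apply: tu; rewrite in_itv.
have fE : fourier (fun x => `|u t x| ^+ 2 * u t x) k =
    tri (fun _ _ _ => 1) (fourier (u t)) (fourier (u t)) (fourier (u t)) k.
  by rewrite -(fourier_cube_abs k su) -ut.
suff <- : z = - 'i * ((freq_sq k)%:C * fourier (u t) k + mu%:C *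
  tri (fun _ _ _ => 1) (fourier (u t)) (fourier (u t)) (fourier (u t)) k) by [].
rewrite -fE.
have -> : (freq_sq k)%:C * fourier (u t) k + mu%:C * fourier (fun x => `|u t x| ^+ 2 * u t x) k = 'i * z.
  by rewrite zE rmorphN mulNr opprK.
by rewrite mulrA mulNr -expr2 sqrCi opprK mul1r.
Qed.

End solution_coefficients.

(** In the first branch s0 = d/2 + eps and 1 + 2 gamma <= d/2; in the second s0 = 1 + 2 gamma, which
    exceeds d/2. Both values are at least 1 since d >= 2 and gamma >= 0. *)
Lemma sigma1_split (R : realType) (d : nat) (gamma eps : R) : d = 2%N \/ d = 3%N ->
  0 <= gamma <= 1 -> 0 < eps ->
  [/\ (0 < d)%N, d%:R / 2 < sigma1 d gamma eps - 1, 1 <= sigma1 d gamma eps - 1 &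
    1 + 2 * gamma <= sigma1 d gamma eps - 1].
Proof.
move=> hd /andP[g0 g1] e0; rewrite /sigma1.
by case: hd => ->; (split=> //; case: ifPn => [|/negP]; rewrite ?real_leNgt//= => h; lra).
Qed.

Theorem theorem3p10 (R : realType) (d : nat) (gamma eps mu T : R)
    (hd : d = 2%N \/ d = 3%N) (hgamma : 0 <= gamma <= 1) (heps : 0 < eps)
    (hmu : mu != 0) (hT : 0 < T) :
  exists C tau0 : R -> R,
    (forall M : R, 0 < C M /\ 0 < tau0 M) /\
    forall (u0 : 'rV[R]_d -> R[i]) (u : R -> 'rV[R]_d -> R[i]),
      nls_solution mu T u0 u ->
      (sup_sobolev_norm T (sigma1 d gamma eps) u < +oo)%E ->
      let M := fine (sup_sobolev_norm T (sigma1 d gamma eps) u) in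
      forall tau : R, 0 < tau <= tau0 M ->
      forall n : nat, n%:R <= T / tau ->
        (sobolev_norm 1 (fun x => u (n%:R * tau) x - sLRI1 mu tau u0 n x)%R
         <= (C M * tau `^ (1 + gamma))%:E)%E.
Proof.
have [d0 ds s1 gs] := sigma1_split hd hgamma heps.
set sg := sigma1 d gamma eps in ds s1 gs *.
(* [choice] asks for a pair of constants at every real M; a negative M, which cannot be a supremum
   of norms, gets the default pair (1, 1). *)
have conv M : exists C : R * R, 0 < C.1 /\ 0 < C.2 /\ (0 <= M -> 
   forall w, nls_coef (sg - 1) mu T M w -> forall tau, 0 < tau <= C.2 -> forall b : nat -> 'rV[int]_d -> R[i],
   scheme_coef mu tau (w 0) b -> forall n, n%:R * tau <= T ->
   hle 1 (fun k => w (n%:R * tau) k - b n k) (C.1 * tau `^ (1 + gamma))).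
  have [M0|M0] := leP 0 M; last by exists (1, 1); split=> //; split=> //; rewrite leNgt M0.
  have [C [t0 [C0 t00 h]]] := coef_convergence mu d0 ds s1 hgamma gs hT M0.
  exists (C, t0); split=> //; split=> // _; exact: h.
have [F hF] := choice conv.
exists (fun M => (F M).1), (fun M => (F M).2); split=> [M|u0 u sol supoo M tau ht n hn].
  by have [? []] := hF M.
have [_ [_ {}hF]] := hF M.
have nu t : 0 <= t <= T -> (sobolev_norm sg (u t) <= M%:E)%E by move=> tT; exact: le_fine_sup.
have M0 : 0 <= M.
  rewrite -lee_fin; apply: le_trans (sobolev_norm_ge0 sg (u 0)) (nu 0 _).
  by rewrite lexx ltW.
have hu t : 0 <= t <= T -> hle (sg - 1 + 1) (fourier (u t)) M.
  by move=> tT; rewrite subrK; apply: sobolev_hle => //; exact: nu.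
have t0 : 0 < tau by case/andP: ht.
have ntT : n%:R * tau <= T by rewrite -ler_pdivlMr.
have nt : 0 <= n%:R * tau <= T by rewrite ntT mulr_ge0// ltW.
have [u0E tu _ _] := sol.
have tu0 : torus_fun u0 by rewrite -u0E; apply: tu; rewrite in_itv /= lexx ltW.
have sf t : 0 <= t <= T -> csummable (fourier (u t)).
  by move=> /hu; apply: hle_csummable => //; apply: lt_trans ds _; rewrite ltrDl.
have su0 : csummable (fourier u0) by rewrite -u0E; apply: sf; rewrite lexx ltW.
have := hF M0 _ (nls_solution_coef d0 ds hT sol hu) tau ht (fun n => fourier (sLRI1 mu tau u0 n)).
rewrite u0E => /(_ (sLRI1_coef mu tu0 su0 t0) n ntT) hd1.
apply: hle_sobolev; congr (hle 1 _ _): hd1; apply/funext => k; rewrite fourierB//.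
  by have [] := tu (n%:R * tau) ltac:(by rewrite in_itv).
have [sn ->] := sLRI1_Fser mu tu0 su0 t0 n; exact: ccont_Fser.
Qed.
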